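(* Let $M$ and $N$ be second-countable manifolds and let $\pi:M\times N\to M$ be the trivial bundle over $M$ with fiber $N$. The space $\mathrm{Dirac}_\pi(M\times N)$ is a dense subspace of $\mathcal E'_\pi(M\times N)$.
   Context: Manifolds are smooth, Hausdorff and paracompact; functions are $\mathbb C$-valued. $C^\infty(M\times N)$ has the Fréchet topology of uniform convergence of all derivatives on compact sets; $C^\infty_c(M)$ has the LF-topology (inductive limit of the Fréchet spaces $C^\infty_c(L)$ of functions supported in $L$, $L\subset M$ compact). $C^\infty(M\times N)$ is a $C^\infty_c(M)$-module by $(f\cdot F)(x,y)=f(x)F(x,y)$. The space of $\pi$-transversal distributions $\mathcal E'_\pi(M\times N)=\mathrm{Hom}_{C^\infty_c(M)}(C^\infty(M\times N),C^\infty_c(M))$ consists of the continuous $C^\infty_c(M)$-linear maps and has the strong topology of uniform convergence on bounded subsets of $C^\infty(M\times N)$. For $y\in N$, $f\in C^\infty_c(M)$ let $\llbracket E_y,f\rrbracket\in\mathcal E'_\pi(M\times N)$ be $\llbracket E_y,f\rrbracket(F)(x)=f(x)F(x,y)$. $\mathrm{Dirac}_\pi(M\times N)\subset\mathcal E'_\pi(M\times N)$ is the subspace of all finite sums $\sum_i\llbracket E_{y_i},f_i\rrbracket$ with $y_i\in N$, $f_i\in C^\infty_c(M)$. *)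

(* Defs.v *)
From HB Require Import structures.
Set Warnings "-all".
From mathcomp Require Import all_boot all_order all_algebra.
From mathcomp Require Import boolp classical_sets functions cardinality.
From mathcomp Require Import reals topology normedtype derive.
From mathcomp Require Import ring lra.
From mathcomp.real_closed Require Import complex.

Set Implicit Arguments.
Unset Strict Implicit.
Unset Printing Implicit Defensive.

Import Order.TTheory GRing.Theory Num.Theory.
Import numFieldNormedType.Exports.

Local Open Scope classical_set_scope.
Local Open Scope ring_scope.

Section Smooth.
Context {R : realType}.

(* partial [:: j1; ...; jk] g is the iterated partial derivative
   d_{j1} ... d_{jk} g; it is only meaningful where the derivatives exist. *)
Definition partial {d} (s : seq 'I_d) (g : 'rV[R]_d -> R) : 'rV[R]_d -> R :=
  foldr (fun j h => 'D_(delta_mx 0 j) h) g s.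

Definition smooth_on {d} (O : set 'rV[R]_d) (g : 'rV[R]_d -> R) : Prop :=
  forall s x, O x ->
    {for x, continuous (partial s g)} /\
    forall j, derivable (partial s g) x (delta_mx 0 j).

Lemma near_eq_continuous {T U : topologicalType} (f g : T -> U) x :
  (\near x, f x = g x) -> {for x, continuous f} -> {for x, continuous g}.
Proof.
move=> fg cf; rewrite /prop_for /continuous_at -(nbhs_singleton fg).
by apply: cvg_trans cf; exact: near_eq_cvg.
Qed.

Lemma smooth_coind {d} (O : set 'rV[R]_d) (S : set ('rV[R]_d -> R)) :
  open O ->
  (forall g, S g -> (forall x, O x -> {for x, continuous g}) /\
     forall j, exists2 h, S h &
       forall x, O x -> is_derive x (delta_mx 0 j) g (h x)) ->
  S `<=` smooth_on O.
Proof.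
move=> oO HS g Sg.
have key s : exists2 h, S h & forall x, O x -> partial s g x = h x.
  elim: s => [|j s [h Sh hE]]; first by exists g.
  have [_ /(_ j)[h' Sh' h'E]] := HS h Sh; exists h' => // x Ox /=.
  have := h'E x Ox => -[_ <-]; apply: near_eq_derive.
  by near=> y; apply: hE; near: y; apply: open_nbhs_nbhs.
move=> s x Ox; have [h Sh hE] := key s.
have nE : \near x, h x = partial s g x.
  by near=> y; apply/esym/hE; near: y; apply: open_nbhs_nbhs.
have [ch dh] := HS h Sh; split.
  exact: near_eq_continuous nE (ch x Ox).
move=> j; apply: near_eq_derivable nE _.
by have [h' _ /(_ x Ox)[]] := dh j.
Unshelve. all: by end_near. Qed.

Lemma smooth_on_continuous {d} (O : set 'rV[R]_d) g x :
  smooth_on O g -> O x -> {for x, continuous g}.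
Proof. by move=> sg Ox; have [] := sg [::] x Ox. Qed.

Lemma smooth_on_derive {d} (O : set 'rV[R]_d) g x j :
  smooth_on O g -> O x ->
  is_derive x (delta_mx 0 j) g ('D_(delta_mx 0 j) g x).
Proof.
by move=> sg Ox; apply/derivableP; have [_] := sg [::] x Ox; apply.
Qed.

Lemma partial_rcons {d} (g : 'rV[R]_d -> R) s j :
  partial (rcons s j) g = partial s ('D_(delta_mx 0 j) g).
Proof. by rewrite /partial foldr_rcons. Qed.

Lemma smooth_on_partial {d} (O : set 'rV[R]_d) g j :
  smooth_on O g -> smooth_on O ('D_(delta_mx 0 j) g).
Proof. by move=> sg s x Ox; rewrite -partial_rcons; apply: sg. Qed.

Lemma smooth_on_eq {d} (O : set 'rV[R]_d) (g h : 'rV[R]_d -> R) :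
  open O -> (forall x, O x -> g x = h x) -> smooth_on O g -> smooth_on O h.
Proof.
move=> oO gh sg.
apply: (smooth_coind (S := [set k | exists2 g', smooth_on O g' &
   forall x, O x -> g' x = k x])) => //; last by exists g.
move=> k [g' sg' g'k]; split=> [x Ox|j].
  apply: near_eq_continuous (smooth_on_continuous sg' Ox).
  by near=> y; apply: g'k; near: y; apply: open_nbhs_nbhs.
exists ('D_(delta_mx 0 j) g').
  by exists ('D_(delta_mx 0 j) g'); [exact: smooth_on_partial|].
move=> x Ox; apply: near_eq_is_derive (smooth_on_derive j sg' Ox).
by near=> y; apply: g'k; near: y; apply: open_nbhs_nbhs.
Unshelve. all: by end_near. Qed.

Lemma partial_eq {d} (O : set 'rV[R]_d) (g h : 'rV[R]_d -> R) s :
  open O -> (forall x, O x -> g x = h x) ->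
  forall x, O x -> partial s g x = partial s h x.
Proof.
move=> oO gh; elim: s => [|j s IH] x Ox /=; first exact: gh.
apply: near_eq_derive; near=> y; apply: IH.
by near: y; apply: open_nbhs_nbhs.
Unshelve. all: by end_near. Qed.

Lemma smooth_on_comb {d} (O : set 'rV[R]_d) (a b : R) g h : open O ->
  smooth_on O g -> smooth_on O h ->
  smooth_on O (fun x => a * g x + b * h x).
Proof.
move=> oO sg sh.
apply: (smooth_coind (S := [set k | exists g' h',
   [/\ smooth_on O g', smooth_on O h' &
       k = (fun x => a * g' x + b * h' x)]])) => //; last by exists g, h.
move=> _ [g' [h' [sg' sh' ->]]]; split=> [x Ox|j].
  have cg := smooth_on_continuous sg' Ox.
  have ch := smooth_on_continuous sh' Ox.
  apply: (@continuousD _ _ _ (fun x => a * g' x) (fun x => b * h' x)).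
    by apply: (@continuousM _ _ (cst a)) => //; exact: cst_continuous.
  by apply: (@continuousM _ _ (cst b)) => //; exact: cst_continuous.
exists (fun x => a * 'D_(delta_mx 0 j) g' x + b * 'D_(delta_mx 0 j) h' x).
  by do 2 eexists; split; last reflexivity; exact: smooth_on_partial.
move=> x Ox; have dg := smooth_on_derive j sg' Ox.
have dh := smooth_on_derive j sh' Ox.
exact: (is_deriveD (f := a *: g') (g := b *: h')).
Qed.

Lemma partial_comb {d} (O : set 'rV[R]_d) (a b : R) g h s : open O ->
  smooth_on O g -> smooth_on O h -> forall x, O x ->
  partial s (fun x => a * g x + b * h x) x =
  a * partial s g x + b * partial s h x.
Proof.
move=> oO sg sh; elim: s => [//|j s IH] x Ox /=.
have dg : derivable (partial s g) x (delta_mx 0 j).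
  by have [_] := sg s x Ox; apply.
have dh : derivable (partial s h) x (delta_mx 0 j).
  by have [_] := sh s x Ox; apply.
have E := near_eq_derive (delta_mx 0 j)
  (f := partial s (fun x => a * g x + b * h x)) (a := x)
  (g := a *: partial s g + b *: partial s h).
rewrite E; last first.
  by near=> y; apply: IH; near: y; apply: open_nbhs_nbhs.
by rewrite (deriveD (derivableZ (k := a) dg) (derivableZ (k := b) dh)) !deriveZ.
Unshelve. all: by end_near. Qed.

Inductive prod_sum {d} (O : set 'rV[R]_d) : ('rV[R]_d -> R) -> Prop :=
| prod_sum0 : prod_sum O (cst 0)
| prod_sumD p q k : smooth_on O p -> smooth_on O q -> prod_sum O k ->
    prod_sum O (p * q + k).

Lemma smooth_onM {d} (O : set 'rV[R]_d) g h : open O ->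
  smooth_on O g -> smooth_on O h -> smooth_on O (fun x => g x * h x).
Proof.
move=> oO sg sh; apply: (smooth_coind (S := prod_sum O)) => //; last first.
  rewrite /mkset (_ : (fun _ => _) = g * h + cst 0); last first.
    by apply/funext => x; rewrite !fctE addr0.
  by apply: prod_sumD => //; exact: prod_sum0.
move=> u; elim=> [|p q k sp sq _ [kc kd]].
  split=> [x _|j]; first exact: cst_continuous.
  by exists (cst 0); [exact: prod_sum0|move=> x _; exact: is_derive_cst].
split=> [x Ox|j].
  apply: continuousD; last exact: kc.
  by apply: continuousM; [exact: (smooth_on_continuous sp)|
                          exact: (smooth_on_continuous sq)].
have [l Sl kl] := kd j.
exists (p * 'D_(delta_mx 0 j) q + ('D_(delta_mx 0 j) p * q + l)).
  apply: prod_sumD; [exact: sp|exact: smooth_on_partial|].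
  by apply: prod_sumD; [exact: smooth_on_partial|exact: sq|exact: Sl].
move=> x Ox; have dp := smooth_on_derive j sp Ox.
have dq := smooth_on_derive j sq Ox; have dk := kl x Ox.
apply: is_derive_eq.
by rewrite !fctE addrA [X in _ + X + _]mulrC.
Qed.

(* Affine changes of variables: lsubmx : R^(m+n) -> R^m and z |-> (z, w). *)
Lemma derive_affine d e (A : 'rV[R]_d -> 'rV[R]_e) (g : 'rV[R]_e -> R) x v v' :
  (forall h : R, A (h *: v + x) = h *: v' + A x) ->
  'D_v (g \o A) x = 'D_v' g (A x) /\
  (derivable g (A x) v' -> derivable (g \o A) x v).
Proof.
move=> HA; rewrite /derivable /derive.
have -> : (fun h : R => h^-1 *: ((g \o A) (h *: v + x) - (g \o A) x)) =
  (fun h : R => h^-1 *: (g (h *: v' + A x) - g (A x))).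
  by apply/funext => h /=; rewrite HA.
by [].
Qed.

Lemma smooth_on_cst d (O : set 'rV[R]_d) a : open O -> smooth_on O (cst a).
Proof.
move=> oO; apply: (smooth_coind (S := range (fun a : R => cst a))) => //.
move=> _ [b _ <-]; split=> [x _|j]; first exact: cst_continuous.
by exists (cst 0); [exists 0|move=> x _; exact: is_derive_cst].
Qed.

Lemma smooth_on_lsubmx m n (O : set 'rV[R]_m) (O' : set 'rV[R]_(m + n)) g :
  open O' -> (forall z, O' z -> O (lsubmx z)) ->
  smooth_on O g -> smooth_on O' (fun z => g (lsubmx z)).
Proof.
move=> oO' OO' sg.
apply: (smooth_coind (S := [set k | k = cst 0 \/
  exists2 h, smooth_on O h & k = h \o lsubmx])) => //; last first.
  by right; exists g.
move=> k Sk; split=> [x Ox|j].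
  case: Sk => [->|[h sh ->]]; first exact: cst_continuous.
  apply: continuous_comp; first exact: continuous_lsubmx.
  by apply: (smooth_on_continuous sh); exact: OO'.
case: Sk => [->|[h sh ->]].
  by exists (cst 0); [left|move=> x _; exact: is_derive_cst].
case: (split_ordP j) => i ->; last first.
  exists (cst 0); [by left|move=> x Ox].
  have [|E D] := @derive_affine _ _ lsubmx h x (delta_mx 0 (rshift m i)) 0.
    move=> a; rewrite linearD linearZ /=; congr (_ *: _ + _).
    by apply/rowP => l; rewrite !mxE eqxx/= eq_lrshift.
  by split; [apply: D; exact: derivable0|rewrite E derive0].
exists ('D_(delta_mx 0 i) h \o lsubmx).
  by right; exists ('D_(delta_mx 0 i) h); [exact: smooth_on_partial|].
move=> x Ox.
have [|E D] := @derive_affine _ _ lsubmx h x (delta_mx 0 (lshift n i))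
    (delta_mx 0 i).
  move=> a; rewrite linearD linearZ /=; congr (_ *: _ + _).
  by apply/rowP => l; rewrite !mxE eqxx/= (inj_eq (@lshift_inj _ _)).
have [H _] := smooth_on_derive i sh (OO' _ Ox).
by split; [exact: D|exact: E].
Qed.

Lemma slice_derive m n (w : 'rV[R]_n) (g : 'rV[R]_(m + n) -> R) x j :
  'D_(delta_mx 0 j) (fun z => g (row_mx z w)) x =
    'D_(delta_mx 0 (lshift n j)) g (row_mx x w) /\
  (derivable g (row_mx x w) (delta_mx 0 (lshift n j)) ->
   derivable (fun z => g (row_mx z w)) x (delta_mx 0 j)).
Proof.
apply: (@derive_affine _ _ (fun z => row_mx z w) g) => a.
have -> : delta_mx 0 (lshift n j) = row_mx (delta_mx 0 j) 0 :> 'rV[R]_(m + n).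
  apply/rowP => l; rewrite !mxE eqxx/=; case: split_ordP => k ->; rewrite !mxE.
    by rewrite eqxx (inj_eq (@lshift_inj _ _)).
  by rewrite eq_rlshift.
by rewrite scale_row_mx add_row_mx scaler0 add0r.
Qed.

Lemma continuous_row_mx (T : topologicalType) m n
    (f : T -> 'rV[R]_m) (g : T -> 'rV[R]_n) x :
  {for x, continuous f} -> {for x, continuous g} ->
  {for x, continuous (fun z => row_mx (f z) (g z))}.
Proof.
move=> cf cg; apply/cvg_ballP => e e0.
move/cvg_ballP: cf => /(_ e e0) cf; move/cvg_ballP: cg => /(_ e e0) cg.
near=> y; split => // i j; rewrite !mxE; case: split_ordP => k _.
  have [_] : ball (f x) e (f y) by near: y.
  exact.
have [_] : ball (g x) e (g y) by near: y.
exact.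
Unshelve. all: by end_near. Qed.

Lemma smooth_on_slice m n (O : set 'rV[R]_m) (O' : set 'rV[R]_(m + n)) w g :
  open O -> (forall z, O z -> O' (row_mx z w)) ->
  smooth_on O' g -> smooth_on O (fun z => g (row_mx z w)).
Proof.
move=> oO OO' sg.
apply: (smooth_coind (S := [set k | exists2 h, smooth_on O' h &
  k = (fun z => h (row_mx z w))])) => //; last by exists g.
move=> _ [h sh ->]; split=> [x Ox|j].
  apply: continuous_comp.
    by apply: continuous_row_mx; [exact: cvg_id|exact: cst_continuous].
  by apply: (smooth_on_continuous sh); exact: OO'.
exists (fun z => 'D_(delta_mx 0 (lshift n j)) h (row_mx z w)).
  exists ('D_(delta_mx 0 (lshift n j)) h); last by [].
  exact: smooth_on_partial.
move=> x Ox; have [E D] := slice_derive w h x j.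
have [H _] := smooth_on_derive (lshift n j) sh (OO' _ Ox).
by split; [exact: D|exact: E].
Qed.

Lemma compact_norm_bound d (K : set 'rV[R]_d) (u : 'rV[R]_d -> R) :
  compact K -> (forall z, K z -> {for z, continuous u}) ->
  exists2 C, 0 <= C & forall z, K z -> `|u z| <= C.
Proof.
move=> cK cu; have /compact_bounded [M [_ /(_ (`|M| + 1)) HM]] : compact (u @` K).
  apply: continuous_compact cK; apply: continuous_in_subspaceT => z /set_mem.
  exact: cu.
exists (`|M| + 1); first by rewrite addr_ge0.
move=> z Kz; apply: HM; last by exists z.
by rewrite (le_lt_trans (ler_norm M))// ltrDl.
Qed.

Lemma slice_mul_bound m n (O K : set 'rV[R]_m) (O' : set 'rV[R]_(m + n)) w u s :
  open O -> (forall z, O z -> O' (row_mx z w)) -> compact K -> K `<=` O ->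
  smooth_on O u ->
  exists (C : R) (t : seq (seq 'I_(m + n))), 0 <= C /\
    forall v e, smooth_on O' v -> 0 <= e ->
      (forall r z, r \in t -> K z -> `|partial r v (row_mx z w)| <= e) ->
      forall z, K z -> `|partial s (fun x => u x * v (row_mx x w)) z| <= C * e.
Proof.
move=> oO OO' cK KO; elim/last_ind: s u => [|s j IH] u su.
  have [|C C0 HC] := @compact_norm_bound _ K u cK.
    by move=> z Kz; apply: (smooth_on_continuous su); exact: KO.
  exists C, [:: [::]]; split => // v e sv e0 Hv z Kz /=.
  rewrite normrM ler_pM//; first exact: HC.
  by apply: (Hv [::]) => //; rewrite inE.
have [C1 [t1 [C10 H1]]] := IH _ (smooth_on_partial j su).
have [C2 [t2 [C20 H2]]] := IH _ su.
exists (C1 + C2), (t1 ++ [seq rcons r (lshift n j) | r <- t2]).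
split; first exact: addr_ge0.
move=> v e sv e0 Hv z Kz; have Oz := KO _ Kz.
pose vw := fun x => v (row_mx x w).
pose v' := 'D_(delta_mx 0 (lshift n j)) v.
have svw : smooth_on O vw by exact: smooth_on_slice sv.
have sv' : smooth_on O' v' by exact: smooth_on_partial.
have sv'w : smooth_on O (fun x => v' (row_mx x w)) by exact: smooth_on_slice sv'.
have E x : O x -> 'D_(delta_mx 0 j) (fun x => u x * vw x) x =
    1 * ('D_(delta_mx 0 j) u x * vw x) + 1 * (u x * v' (row_mx x w)).
  move=> Ox; have du := smooth_on_derive j su Ox.
  have dv := smooth_on_derive j svw Ox.
  rewrite (deriveM (@ex_derive _ _ _ _ _ _ _ du) (@ex_derive _ _ _ _ _ _ _ dv)).
  rewrite (slice_derive w v x j).1 -/v' !mul1r addrC.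
  by congr (_ + _); rewrite [LHS]mulrC.
have sA := smooth_onM oO (smooth_on_partial j su) svw.
have sB := smooth_onM oO su sv'w.
rewrite partial_rcons (partial_eq s oO E Oz) (partial_comb 1 1 s oO sA sB Oz).
rewrite !mul1r mulrDl (le_trans (ler_normD _ _))// lerD//.
  by apply: H1 => // r y rt; apply: Hv; rewrite mem_cat rt.
apply: H2 => // r y rt Ky; rewrite -partial_rcons; apply: Hv => //.
rewrite mem_cat; apply/orP; right.
by apply/mapP; exists r.
Qed.

(* Complex-valued functions are differentiated through their real and
   imaginary parts. *)
Definition csmooth_on {d} (O : set 'rV[R]_d) (g : 'rV[R]_d -> R[i]) : Prop :=
  smooth_on O (fun x => complex.Re (g x)) /\
  smooth_on O (fun x => complex.Im (g x)).

Definition cpartial {d} (s : seq 'I_d) (g : 'rV[R]_d -> R[i]) x : R[i] :=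
  (partial s (fun x => complex.Re (g x)) x +i*
   partial s (fun x => complex.Im (g x)) x)%C.

Lemma csmooth_on_eq d (O : set 'rV[R]_d) (g h : 'rV[R]_d -> R[i]) :
  open O -> (forall x, O x -> g x = h x) -> csmooth_on O g -> csmooth_on O h.
Proof.
by move=> oO gh [sr si]; split; [apply: smooth_on_eq sr|apply: smooth_on_eq si];
  move=> // x /gh ->.
Qed.

Lemma cpartial_eq d (O : set 'rV[R]_d) (g h : 'rV[R]_d -> R[i]) s :
  open O -> (forall x, O x -> g x = h x) ->
  forall x, O x -> cpartial s g x = cpartial s h x.
Proof.
by move=> oO gh x Ox; congr Complex; apply: (partial_eq s oO _ Ox) => y /gh ->.
Qed.

Lemma csmooth_on_cst d (O : set 'rV[R]_d) a : open O -> csmooth_on O (cst a).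
Proof. by move=> oO; split; exact: (smooth_on_cst _ oO). Qed.

Let ReM (a b : R[i]) : complex.Re (a * b) =
  1 * (complex.Re a * complex.Re b) + -1 * (complex.Im a * complex.Im b).
Proof. by case: a b => [a a'] [b b'] /=; rewrite mul1r mulN1r. Qed.

Let ImM (a b : R[i]) : complex.Im (a * b) =
  1 * (complex.Re a * complex.Im b) + 1 * (complex.Im a * complex.Re b).
Proof. by case: a b => [a a'] [b b'] /=; rewrite !mul1r. Qed.

Lemma csmooth_onM d (O : set 'rV[R]_d) g h : open O ->
  csmooth_on O g -> csmooth_on O h -> csmooth_on O (fun x => g x * h x).
Proof.
move=> oO [gr gi] [hr hi]; split.
  rewrite (_ : (fun _ => _) = fun x =>
    1 * (complex.Re (g x) * complex.Re (h x)) +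
    -1 * (complex.Im (g x) * complex.Im (h x))); last first.
    by apply/funext => x; rewrite ReM.
  exact: (smooth_on_comb 1 (-1) oO (smooth_onM oO gr hr) (smooth_onM oO gi hi)).
rewrite (_ : (fun _ => _) = fun x =>
  1 * (complex.Re (g x) * complex.Im (h x)) +
  1 * (complex.Im (g x) * complex.Re (h x))); last first.
  by apply/funext => x; rewrite ImM.
exact: (smooth_on_comb 1 1 oO (smooth_onM oO gr hi) (smooth_onM oO gi hr)).
Qed.

Lemma csmooth_onD d (O : set 'rV[R]_d) g h : open O ->
  csmooth_on O g -> csmooth_on O h ->
  csmooth_on O (fun x => g x + h x) /\
  forall s x, O x ->
    cpartial s (fun x => g x + h x) x = cpartial s g x + cpartial s h x.
Proof.
move=> oO [gr gi] [hr hi].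
have Er x : complex.Re (g x + h x) = 1 * complex.Re (g x) + 1 * complex.Re (h x).
  by case: (g x) (h x) => [? ?] [? ?]; rewrite /= !mul1r.
have Ei x : complex.Im (g x + h x) = 1 * complex.Im (g x) + 1 * complex.Im (h x).
  by case: (g x) (h x) => [? ?] [? ?]; rewrite /= !mul1r.
rewrite /csmooth_on /cpartial (funext Er) (funext Ei).
split=> [|s x Ox]; first by split; exact: (smooth_on_comb _ _ oO).
by rewrite (partial_comb 1 1 s oO gr hr Ox) (partial_comb 1 1 s oO gi hi Ox) !mul1r.
Qed.

Lemma csmooth_onZ d (O : set 'rV[R]_d) (a : R[i]) g : open O ->
  csmooth_on O g ->
  csmooth_on O (fun x => a * g x) /\
  forall s x, O x -> cpartial s (fun x => a * g x) x = a * cpartial s g x.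
Proof.
move=> oO [gr gi].
have Er x : complex.Re (a * g x) =
    complex.Re a * complex.Re (g x) + - complex.Im a * complex.Im (g x).
  by case: a (g x) => [? ?] [? ?]; rewrite /= mulNr.
have Ei x : complex.Im (a * g x) =
    complex.Re a * complex.Im (g x) + complex.Im a * complex.Re (g x).
  by clear Er; case: a (g x) => [? ?] [? ?].
rewrite /csmooth_on /cpartial (funext Er) (funext Ei).
split=> [|s x Ox]; first by split; exact: (smooth_on_comb _ _ oO).
rewrite (partial_comb _ _ s oO gr gi Ox) (partial_comb _ _ s oO gi gr Ox) mulNr.
by clear Er Ei; case: a.
Qed.

Lemma normc_le_ReIm (a : R[i]) (e : R) :
  `|complex.Re a| <= e -> `|complex.Im a| <= e -> `|a| <= (2 * e)%:C%C.
Proof.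
move=> ar ai; rewrite [a]complexE (le_trans (ler_normD _ _))// normrM.
have -> : `|'i%C : R[i]| = 1 by rewrite normc_def /= expr0n/= add0r expr1n sqrtr1.
have nC (b : R) : `|b%:C%C| = `|b|%:C%C :> R[i].
  by rewrite normc_def /= expr0n/= addr0 sqrtr_sqr.
by rewrite mul1r !nC -rmorphD/= lecR mulrDl mul1r lerD.
Qed.

Lemma ReIm_le_normc (a : R[i]) (e : R) : `|a| <= e%:C%C ->
  `|complex.Re a| <= e /\ `|complex.Im a| <= e.
Proof.
move=> ae; split; rewrite -lecR; apply: le_trans ae; first exact: normc_ge_Re.
by rewrite normc_def lecR -sqrtr_sqr ler_wsqrtr// lerDr sqr_ge0.
Qed.

Lemma cslice_mul_bound m n (O K : set 'rV[R]_m) (O' : set 'rV[R]_(m + n))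
    w u s (e : R[i]) :
  open O -> (forall z, O z -> O' (row_mx z w)) -> compact K -> K `<=` O ->
  csmooth_on O u -> 0 < e ->
  exists (t : seq (seq 'I_(m + n))) (e' : R[i]), 0 < e' /\
    forall v, csmooth_on O' v ->
      (forall r z, r \in t -> K z -> `|cpartial r v (row_mx z w)| < e') ->
      forall z, K z -> `|cpartial s (fun x => u x * v (row_mx x w)) z| < e.
Proof.
move=> oO OO' cK KO [ur ui] e0.
have [C1 [t1 [C10 H1]]] := slice_mul_bound s oO OO' cK KO ur.
have [C2 [t2 [C20 H2]]] := slice_mul_bound s oO OO' cK KO ui.
have [k k0 ek] : exists2 k : R, 0 < k & e = k%:C%C.
  exists (complex.Re e); first by move: e0; rewrite ltcE => /andP[].
  by apply/esym/RRe_real; rewrite realE ltW.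
pose C := C1 + C2 + 1.
have Cp : 0 < C by rewrite ltr_wpDl// addr_ge0.
pose l := k / (4 * C).
have lp : 0 < l by rewrite divr_gt0// mulr_gt0.
exists (t1 ++ t2), l%:C%C; split; first by rewrite ltcR.
move=> v [vr vi] Hv z Kz; have Oz := KO _ Kz.
have Hre r y : r \in t1 ++ t2 -> K y ->
    `|partial r (fun x => complex.Re (v x)) (row_mx y w)| <= l /\
    `|partial r (fun x => complex.Im (v x)) (row_mx y w)| <= l.
  move=> rt Ky; apply: (@ReIm_le_normc (cpartial r v (row_mx y w))).
  exact/ltW/Hv.
have in1 r : r \in t1 -> r \in t1 ++ t2 by rewrite mem_cat => ->.
have in2 r : r \in t2 -> r \in t1 ++ t2 by rewrite mem_cat orbC => ->.
have B11 := H1 _ l vr (ltW lp) (fun r y rt Ky => (Hre r y (in1 r rt) Ky).1) z Kz.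
have B12 := H1 _ l vi (ltW lp) (fun r y rt Ky => (Hre r y (in1 r rt) Ky).2) z Kz.
have B21 := H2 _ l vr (ltW lp) (fun r y rt Ky => (Hre r y (in2 r rt) Ky).1) z Kz.
have B22 := H2 _ l vi (ltW lp) (fun r y rt Ky => (Hre r y (in2 r rt) Ky).2) z Kz.
have svr := smooth_on_slice oO OO' vr; have svi := smooth_on_slice oO OO' vi.
have lE : 2 * (C1 * l + C2 * l) < k.
  rewrite -mulrDl mulrCA (@lt_le_trans _ _ (C * (2 * l)))//.
    have l2 : 0 < 2 * l by rewrite mulr_gt0.
    by rewrite (ltr_pM2r l2) /C ltrDl.
  have -> : C * (2 * l) = k / 2.
    by rewrite /l; field; rewrite gt_eqF.
  by move: k0; clear; lra.
apply: (@le_lt_trans _ _ (2 * (C1 * l + C2 * l))%:C%C); last by rewrite ek ltcR.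
apply: normc_le_ReIm; rewrite /=.
  under [X in partial s X]eq_fun do rewrite ReM.
  rewrite (partial_comb 1 (-1) s oO (smooth_onM oO ur svr)
    (smooth_onM oO ui svi) Oz) mul1r mulN1r.
  by rewrite (le_trans (ler_normB _ _))// lerD.
under [X in partial s X]eq_fun do rewrite ImM.
rewrite (partial_comb 1 1 s oO (smooth_onM oO ur svi)
  (smooth_onM oO ui svr) Oz) !mul1r.
by rewrite (le_trans (ler_normD _ _))// lerD.
Qed.

End Smooth.

Section TranslationTopology.
Context {E : zmodType} (B : set_system E).

(* The topology with base B of neighborhoods of 0, translated to every point. *)
Definition translation_open : set_system E :=
  [set O | forall x, O x -> exists2 U, B U & forall u, U u -> O (x + u)].

Hypothesis B_ex : B !=set0.
Hypothesis B_I : forall U V, B U -> B V -> exists2 W, B W & W `<=` U `&` V.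

Lemma translation_openT : translation_open setT.
Proof. by move=> x _; have [U BU] := B_ex; exists U. Qed.

Lemma translation_openI : setI_closed translation_open.
Proof.
move=> O P HO HP x [/HO[U BU UO] /HP[V BV VP]].
have [W BW WUV] := B_I BU BV.
by exists W => // u /WUV[/UO ? /VP].
Qed.

Lemma translation_open_bigU (I : Type) (f : I -> set E) :
  (forall i, translation_open (f i)) -> translation_open (\bigcup_i f i).
Proof.
move=> Hf x [i _ /Hf[U BU Uf]].
by exists U => // u /Uf fu; exists i.
Qed.

Hypothesis B_0 : forall U, B U -> U 0.
Hypothesis B_half : forall U, B U ->
  exists2 V, B V & forall u v, V u -> V v -> U (u + v).

Lemma translation_nbhsE x A : nbhs_of_open translation_open x A <->
  exists2 U, B U & forall u, U u -> A (x + u).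
Proof.
split=> [[O [oO Ox OA]]|[U BU UA]].
  by have [U BU UO] := oO x Ox; exists U => // u /UO/OA.
exists [set y | exists2 V, B V & forall v, V v -> A (y + v)]; split.
- move=> y [V BV VA]; have [W BW WV] := B_half BV.
  exists W => // u Wu; exists W => // v Wv; rewrite -addrA; apply: VA.
  exact: WV.
- by exists U.
- by move=> y [V BV VA]; rewrite -[y]addr0; apply: VA; exact: B_0.
Qed.

End TranslationTopology.

Definition absolutely_convex {K : numDomainType} {E : lmodType K}
    (A : set E) : Prop :=
  forall (a b : K) x y, A x -> A y -> `|a| + `|b| <= 1 -> A (a *: x + b *: y).

(* Absorbed by every neighborhood of 0. *)
Definition tvs_bounded {K : numDomainType} {E : preTopologicalLmodType K}
    (A : set E) : Prop :=
  forall U : set E, nbhs 0 U ->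
    exists2 r : K, 0 < r & forall a : K, r <= `|a| ->
      forall x, A x -> exists2 u, U u & x = a *: u.

Record chart (R : realType) (d : nat) (X : topologicalType) := Chart {
  chart_dom : set X;
  chart_img : set 'rV[R]_d;
  chart_map : X -> 'rV[R]_d;
  chart_inv : 'rV[R]_d -> X;
  chart_dom_open : open chart_dom;
  chart_img_open : open chart_img;
  chart_map_img : forall x, chart_dom x -> chart_img (chart_map x);
  chart_inv_dom : forall z, chart_img z -> chart_dom (chart_inv z);
  chart_mapK : forall x, chart_dom x -> chart_inv (chart_map x) = x;
  chart_invK : forall z, chart_img z -> chart_map (chart_inv z) = z;
  chart_map_continuous :
    forall x, chart_dom x -> {for x, continuous chart_map};
  chart_inv_continuous :
    forall z, chart_img z -> {for z, continuous chart_inv} }.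

Arguments chart_dom_open {R d X} c : rename.
Arguments chart_img_open {R d X} c : rename.

(* A topological space with charts covering it. A chart has a total inverse,
   so the empty space is covered by the empty set of charts. *)
Record chartedSpace (R : realType) (d : nat) := ChartedSpace {
  carrier :> topologicalType;
  atlas : set (chart R d carrier);
  atlas_cover : forall x, exists2 c, atlas c & chart_dom c x }.

Arguments atlas {R d} c _ : rename.

(* Coordinate changes are smooth; the atlas need not be maximal, since the
   function spaces below depend only on the smooth structure it generates. *)
Definition smooth_atlas (R : realType) d (X : chartedSpace R d) : Prop :=
  forall c c', atlas X c -> atlas X c' -> forall i : 'I_d,
    smooth_on [set z | chart_img c z /\ chart_dom c' (chart_inv c z)]
              (fun z => chart_map c' (chart_inv c z) 0 i).

Definition paracompact (X : topologicalType) : Prop :=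
  forall C : set_system X, C `<=` open -> \bigcup_(U in C) U = setT ->
    exists D : set_system X,
      [/\ D `<=` open, \bigcup_(V in D) V = setT,
          forall V, D V -> exists2 U, C U & V `<=` U &
          forall x : X, exists2 W, nbhs x W &
            finite_set [set V | D V /\ V `&` W !=set0]].

Record manifold (R : realType) (d : nat) := Manifold {
  manifold_charted :> chartedSpace R d;
  manifold_smooth : smooth_atlas manifold_charted;
  manifold_hausdorff : hausdorff_space manifold_charted;
  manifold_paracompact : paracompact manifold_charted }.

Section ProductCharts.
Context {R : realType} {m n : nat}.

Section prod_chart.
Context {X Y : topologicalType} (c : chart R m X) (c' : chart R n Y).

Let dom : set (X * Y) := chart_dom c `*` chart_dom c'.
Let img : set 'rV[R]_(m + n) :=
  [set z | chart_img c (lsubmx z) /\ chart_img c' (rsubmx z)].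
Let map (p : X * Y) : 'rV[R]_(m + n) :=
  row_mx (chart_map c p.1) (chart_map c' p.2).
Let inv (z : 'rV[R]_(m + n)) : X * Y :=
  (chart_inv c (lsubmx z), chart_inv c' (rsubmx z)).

Let dom_open : open dom.
Proof.
rewrite openE => p [p1 p2]; exists (chart_dom c, chart_dom c') => //.
by split; apply: open_nbhs_nbhs; split=> //; exact: chart_dom_open.
Qed.

Let img_open : open img.
Proof.
apply: openI.
  apply: (@open_comp _ _ (lsubmx : 'rV[R]_(m + n) -> 'rV[R]_m)).
    by move=> z _; exact: continuous_lsubmx.
  exact: chart_img_open.
apply: (@open_comp _ _ (rsubmx : 'rV[R]_(m + n) -> 'rV[R]_n)).
  by move=> z _; exact: continuous_rsubmx.
exact: chart_img_open.
Qed.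

Let map_img p : dom p -> img (map p).
Proof.
by move=> [p1 p2]; split; rewrite (row_mxKl, row_mxKr); exact: chart_map_img.
Qed.

Let inv_dom z : img z -> dom (inv z).
Proof. by move=> [z1 z2]; split; exact: chart_inv_dom. Qed.

Let mapK p : dom p -> inv (map p) = p.
Proof.
by case: p => x y [/= px py]; rewrite /inv row_mxKl row_mxKr !chart_mapK.
Qed.

Let invK z : img z -> map (inv z) = z.
Proof. by move=> [z1 z2]; rewrite /map /= !chart_invK// hsubmxK. Qed.

Let map_continuous p : dom p -> {for p, continuous map}.
Proof.
move=> [p1 p2]; apply: continuous_row_mx.
  by apply: (@continuous_comp _ _ _ fst); [exact: cvg_fst|
    exact: chart_map_continuous].
by apply: (@continuous_comp _ _ _ snd); [exact: cvg_snd|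
  exact: chart_map_continuous].
Qed.

Let inv_continuous z : img z -> {for z, continuous inv}.
Proof.
move=> [z1 z2].
have c1 : {for z, continuous (chart_inv c \o
    (lsubmx : 'rV[R]_(m + n) -> 'rV[R]_m))}.
  by apply: continuous_comp; [exact: continuous_lsubmx|
    exact: chart_inv_continuous].
have c2 : {for z, continuous (chart_inv c' \o
    (rsubmx : 'rV[R]_(m + n) -> 'rV[R]_n))}.
  by apply: continuous_comp; [exact: continuous_rsubmx|
    exact: chart_inv_continuous].
exact: (cvg_pair c1 c2).
Qed.

Definition prod_chart : chart R (m + n) (X * Y)%type :=
  Chart dom_open img_open map_img inv_dom mapK invK
        map_continuous inv_continuous.

End prod_chart.

Context (M : chartedSpace R m) (N : chartedSpace R n).

Definition prod_atlas : set (chart R (m + n) (M * N)%type) :=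
  [set prod_chart c.1 c.2 | c in atlas M `*` atlas N].

Lemma prod_atlas_cover (p : M * N) :
  exists2 c, prod_atlas c & chart_dom c p.
Proof.
have [c ac cp] := atlas_cover p.1; have [c' ac' cp'] := atlas_cover p.2.
by exists (prod_chart c c'); [exists (c, c')|].
Qed.

(* The product manifold; only its charts matter for C^oo(M x N). *)
Definition prod_charted : chartedSpace R (m + n) :=
  ChartedSpace prod_atlas_cover.

End ProductCharts.

Section SmoothFunctions.
Context {R : realType} {d : nat} (X : chartedSpace R d).

Definition smooth_fun : {pred X -> R[i]} := fun F =>
  `[< forall c, atlas X c -> csmooth_on (chart_img c) (F \o chart_inv c) >].

Lemma smooth_fun_submod : submod_closed smooth_fun.
Proof.
split=> [|a F G /asboolP sF /asboolP sG]; apply/asboolP => c ac.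
  exact: csmooth_on_cst (chart_img_open c).
have oc := chart_img_open c.
exact: (csmooth_onD oc (csmooth_onZ a oc (sF c ac)).1 (sG c ac)).1.
Qed.

HB.instance Definition _ := GRing.isSubmodClosed.Build _ _ smooth_fun
  smooth_fun_submod.

Record smoothFun := SmoothFun {
  smooth_val :> X -> R[i];
  _ : smooth_val \in smooth_fun }.

HB.instance Definition _ := [isSub for smooth_val].
HB.instance Definition _ := [Choice of smoothFun by <:].
HB.instance Definition _ := [SubChoice_isSubLmodule of smoothFun by <:].

Lemma smoothP (F : smoothFun) c : atlas X c ->
  csmooth_on (chart_img c) (F \o chart_inv c).
Proof. by case: F => F /asboolP/= sF /sF. Qed.

(* Functions whose derivatives d^(s i), i : I, are smaller than e on the
   compact sets K i, read in the charts c i. *)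
Definition smooth_ball (I : finType) (c : I -> chart R d X)
    (K : I -> set 'rV[R]_d) (s : I -> seq 'I_d) (e : R[i]) : set smoothFun :=
  [set F : smoothFun | forall i z, K i z ->
     `|cpartial (s i) (F \o chart_inv (c i)) z| < e].

Definition smooth_base : set_system smoothFun :=
  [set U | exists I c K s e,
     [/\ forall i, [/\ atlas X (c i), compact (K i) & K i `<=` chart_img (c i)],
         0 < e & U = @smooth_ball I c K s e]].

Lemma smooth_base_ex : smooth_base !=set0.
Proof.
exists setT; exists void, (of_void _), (of_void _), (of_void _), 1.
by split=> //; apply/seteqP; split => // F _ [].
Qed.

Lemma smooth_base_I U V : smooth_base U -> smooth_base V ->
  exists2 W, smooth_base W & W `<=` U `&` V.
Proof.
move=> [I [c [K [s [e [H e0 ->]]]]]] [J [c' [K' [s' [e' [H' e0' ->]]]]]].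
pose m := if e <= e' then e else e'.
have m0 : 0 < m by rewrite /m; case: ifP.
have [me me'] : m <= e /\ m <= e'.
  rewrite /m; case: ifPn => // ee'; split=> //.
  by rewrite real_leNgt ?gtr0_real// in ee'; apply/ltW; rewrite -[_ < _]negbK.
exists (@smooth_ball (I + J)%type
  (fun k => match k with inl i => c i | inr j => c' j end)
  (fun k => match k with inl i => K i | inr j => K' j end)
  (fun k => match k with inl i => s i | inr j => s' j end) m).
  by do 5 eexists; split; last reflexivity; [case|].
move=> F HF; split=> i z Kz.
  exact: lt_le_trans (HF (inl i) z Kz) me.
exact: lt_le_trans (HF (inr i) z Kz) me'.
Qed.

Lemma cpartial_smoothD (F G : smoothFun) c s z : atlas X c -> chart_img c z ->
  cpartial s ((F + G : smoothFun) \o chart_inv c) z =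
  cpartial s (F \o chart_inv c) z + cpartial s (G \o chart_inv c) z.
Proof.
move=> ac cz.
exact: (csmooth_onD (chart_img_open c) (smoothP F ac) (smoothP G ac)).2.
Qed.

Lemma cpartial_smoothZ a (F : smoothFun) c s z : atlas X c -> chart_img c z ->
  cpartial s ((a *: F : smoothFun) \o chart_inv c) z =
  a * cpartial s (F \o chart_inv c) z.
Proof.
by move=> ac cz; exact: (csmooth_onZ a (chart_img_open c) (smoothP F ac)).2.
Qed.

Lemma smooth_base_Z U a : smooth_base U -> a != 0 ->
  smooth_base [set F | U (a *: F)].
Proof.
move=> [I [c [K [s [e [H e0 ->]]]]]] a0.
exists I, c, K, s, (`|a|^-1 * e).
split=> //; first by rewrite mulr_gt0// invr_gt0 normr_gt0.
apply/seteqP; split=> F HF i z Kz; have [ac _ Kc] := H i;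
  have := HF i z Kz; rewrite (cpartial_smoothZ _ _ _ ac (Kc _ Kz)) normrM;
  by rewrite ltr_pdivlMl ?normr_gt0.
Qed.

Lemma smooth_base_0 U : smooth_base U -> U 0.
Proof.
move=> [I [c [K [s [e [H e0 ->]]]]]] i z Kz; have [ac _ Kc] := H i.
rewrite -[0 : smoothFun](scale0r 0) (cpartial_smoothZ _ _ _ ac (Kc _ Kz)).
by rewrite mul0r normr0.
Qed.

Lemma smooth_base_half U : smooth_base U ->
  exists2 V, smooth_base V & forall F G, V F -> V G -> U (F + G).
Proof.
move=> [I [c [K [s [e [H e0 ->]]]]]].
exists (@smooth_ball I c K s (e / 2)).
  by exists I, c, K, s, (e / 2); split=> //; rewrite divr_gt0.
move=> F G HF HG i z Kz; have [ac _ Kc] := H i.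
rewrite (cpartial_smoothD _ _ _ ac (Kc _ Kz)) (le_lt_trans (ler_normD _ _))//.
by rewrite [ltRHS]splitr ltrD//; [exact: HF|exact: HG].
Qed.

HB.instance Definition _ := isOpenTopological.Build smoothFun
  (translation_openT smooth_base_ex) (translation_openI smooth_base_I)
  (@translation_open_bigU _ smooth_base).

Lemma smooth_nbhsE (F : smoothFun) A : nbhs F A <->
  exists2 U, smooth_base U & forall G, U G -> A (F + G).
Proof.
exact: (translation_nbhsE smooth_base_0 smooth_base_half).
Qed.

End SmoothFunctions.

Arguments smooth_fun {R d} X _.

Section TestFunctions.
Context {R : realType} {d : nat} (X : chartedSpace R d).

Definition support_set (F : X -> R[i]) : set X := closure [set x | F x != 0].

Definition compactly_supported : {pred smoothFun X} := fun F =>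
  `[< compact (support_set F) >].

Lemma support_set0 : support_set (0 : smoothFun X) = set0.
Proof.
rewrite /support_set (_ : [set x | _] = set0) ?closure0//.
by apply/seteqP; split=> // x /=; rewrite eqxx.
Qed.

Lemma support_setM (f G : X -> R[i]) :
  support_set (fun x => f x * G x) `<=` support_set f.
Proof.
apply: closureS => x /=.
by apply: contra => /eqP ->; rewrite mul0r.
Qed.

Lemma compactly_supported_submod : submod_closed compactly_supported.
Proof.
split=> [|a F G /asboolP cF /asboolP cG]; apply/asboolP.
  by rewrite support_set0; exact: compact0.
apply: (subclosed_compact _ (compactU cF cG)); first exact: closed_closure.
rewrite /support_set -closureU; apply: closureS => x /= aFG.
apply: contrapT => /not_orP[/negP/negPn/eqP F0 /negP/negPn/eqP G0].
move/eqP: aFG; apply; rewrite -[LHS]/(a * F x + G x) F0 G0.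
by rewrite mulr0 addr0.
Qed.

HB.instance Definition _ := GRing.isSubmodClosed.Build _ _ compactly_supported
  compactly_supported_submod.

Record testFun := TestFun {
  test_val :> smoothFun X;
  _ : test_val \in compactly_supported }.

HB.instance Definition _ := [isSub for test_val].
HB.instance Definition _ := [Choice of testFun by <:].
HB.instance Definition _ := [SubChoice_isSubLmodule of testFun by <:].

Lemma testP (f : testFun) : compact (support_set f).
Proof. by case: f => f cf; exact/asboolP. Qed.

(* The inductive limit topology: an absolutely convex set is a neighborhood of
   0 iff, for all compact L, it traces a neighborhood of 0 on the subspace of
   functions supported in L, topologized as a subspace of smoothFun X. *)
Definition test_base : set_system testFun :=
  [set U | absolutely_convex U /\
     forall L : set X, compact L ->
       exists2 V, nbhs (0 : smoothFun X) V &
         forall f : testFun, support_set f `<=` L -> V f -> U f].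

Lemma test_base_ex : test_base !=set0.
Proof.
by exists setT; split=> // L _; exists setT => //; exact: filterT.
Qed.

Lemma test_base_I U V : test_base U -> test_base V ->
  exists2 W, test_base W & W `<=` U `&` V.
Proof.
move=> [Ua HU] [Va HV]; exists (U `&` V) => //; split.
  by move=> a b f g [Uf Vf] [Ug Vg] ab; split; [exact: Ua|exact: Va].
move=> L cL; have [A nA AU] := HU L cL; have [B nB BV] := HV L cL.
exists (A `&` B); first exact: filterI.
by move=> f fL [Af Bf]; split; [exact: AU|exact: BV].
Qed.

Lemma test_base_0 U : test_base U -> U 0.
Proof.
move=> [_ /(_ set0 (@compact0 _))[V nV VU]]; apply: VU.
  by rewrite support_set0.
exact: nbhs_singleton.
Qed.

Lemma test_base_Z U a : test_base U -> a != 0 -> test_base [set f | U (a *: f)].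
Proof.
move=> [Ua HU] a0; split=> [b c f g Uf Ug bc|L cL].
  by rewrite /= scalerDr !scalerA ![a * _]mulrC -!scalerA; exact: Ua.
have [V /smooth_nbhsE [W bW WV] VU] := HU L cL.
exists [set F | W (a *: F)].
  apply/smooth_nbhsE; exists [set F | W (a *: F)]; first exact: smooth_base_Z.
  by move=> F; rewrite /= add0r.
move=> f fL /WV; rewrite add0r => Vf; apply: VU => //.
apply: subset_trans fL; apply: closureS => x /=.
apply: contra => /eqP fx0; apply/eqP.
by rewrite -[LHS]/(a * f x) fx0 mulr0.
Qed.

Lemma test_base_half U : test_base U ->
  exists2 V, test_base V & forall f g, V f -> V g -> U (f + g).
Proof.
move=> bU; have n2 : 2 != 0 :> R[i] by rewrite pnatr_eq0.
exists [set f | U (2 *: f)]; first exact: test_base_Z.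
move=> f g /= Uf Ug; have [Ua _] := bU.
have := Ua 2^-1 2^-1 _ _ Uf Ug; rewrite !scalerA mulVf// !scale1r; apply.
by rewrite ger0_norm ?invr_ge0// [leRHS](splitr 1) div1r.
Qed.

HB.instance Definition _ := isOpenTopological.Build testFun
  (translation_openT test_base_ex) (translation_openI test_base_I)
  (@translation_open_bigU _ test_base).

Lemma test_nbhsE (f : testFun) A : nbhs f A <->
  exists2 U, test_base U & forall g, U g -> A (f + g).
Proof. exact: (translation_nbhsE test_base_0 test_base_half). Qed.

Lemma test_mul_subproof (f : testFun) (G : smoothFun X) :
  (fun x => f x * G x) \in smooth_fun X.
Proof.
apply/asboolP => c ac.
exact: csmooth_onM (chart_img_open c) (smoothP f ac) (smoothP G ac).
Qed.

Lemma test_mul_subproof2 (f : testFun) (G : smoothFun X) :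
  SmoothFun (test_mul_subproof f G) \in compactly_supported.
Proof.
apply/asboolP; apply: (subclosed_compact _ (@testP f)).
  exact: closed_closure.
exact: support_setM.
Qed.

(* The pointwise product f G, as a test function. *)
Definition test_mul (f : testFun) (G : smoothFun X) : testFun :=
  TestFun (test_mul_subproof2 f G).

End TestFunctions.

Section Transversal.
Context {R : realType} {m n : nat}.
Context (M : chartedSpace R m) (N : chartedSpace R n).

Local Notation MN := (prod_charted M N).

Lemma pull_mul_subproof (f : testFun M) (F : smoothFun MN) :
  (fun p : MN => f p.1 * F p) \in smooth_fun MN.
Proof.
apply/asboolP => _ [[c c'] [/= ac ac'] <-].
have aC : atlas MN (prod_chart c c') by exists (c, c').
have oc := chart_img_open (prod_chart c c').
apply: (csmooth_onM (g := fun z => f (chart_inv c (lsubmx z))) oc); last first.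
  exact: (smoothP F aC).
have [fr fi] := smoothP f ac.
have sub z : chart_img (prod_chart c c') z -> chart_img c (lsubmx z).
  by case.
by split; [exact: smooth_on_lsubmx oc sub fr|exact: smooth_on_lsubmx oc sub fi].
Qed.

(* The module structure (f . F) (x, y) = f x * F (x, y). *)
Definition pull_mul (f : testFun M) (F : smoothFun MN) : smoothFun MN :=
  SmoothFun (pull_mul_subproof f F).

Definition transversal :
    {pred smoothFun MN -> testFun M} := fun T =>
  `[< [/\ linear T, forall f F, T (pull_mul f F) = test_mul f (T F) &
          continuous T] >].

Lemma slice_subproof (y : N) (F : smoothFun MN) :
  (fun x => F (x, y)) \in smooth_fun M.
Proof.
apply/asboolP => c ac; have [c' ac' cy] := atlas_cover y.
have aC : atlas MN (prod_chart c c') by exists (c, c').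
have [Fr Fi] := smoothP F aC.
have oc := chart_img_open c.
have sub z : chart_img c z ->
    chart_img (prod_chart c c') (row_mx z (chart_map c' y)).
  by move=> cz; split; rewrite (row_mxKl, row_mxKr) => //; exact: chart_map_img.
have E z : F (chart_inv c z, y) =
    (F \o chart_inv (prod_chart c c')) (row_mx z (chart_map c' y)).
  by rewrite /= row_mxKl row_mxKr chart_mapK.
split.
  have := smooth_on_slice oc sub Fr; apply: smooth_on_eq => // z _.
  by rewrite [in RHS]/= E.
have := smooth_on_slice oc sub Fi; apply: smooth_on_eq => // z _.
by rewrite [in RHS]/= E.
Qed.

Definition slice (y : N) (F : smoothFun MN) : smoothFun M :=
  SmoothFun (slice_subproof y F).

(* [[E_y, f]] (F) (x) = f x * F (x, y) *)
Definition dirac_fun (y : N) (f : testFun M) (F : smoothFun MN) : testFun M :=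
  test_mul f (slice y F).

Lemma testFun_ext (f g : testFun M) : (forall x, f x = g x) -> f = g.
Proof. by move=> fg; apply/val_inj/val_inj/funext. Qed.

Lemma linear_continuousP (T : smoothFun MN -> testFun M) : linear T ->
  continuous T <->
  forall U, test_base U -> exists2 V, smooth_base V & forall F, V F -> U (T F).
Proof.
move=> lT; have T0 : T 0 = 0.
  have := lT 1 0 0; rewrite scaler0 addr0 scale1r.
  by move/(congr1 (fun g => g - T 0)); rewrite addrK subrr.
have TD F G : T (F + G) = T F + T G by have := lT 1 F G; rewrite !scale1r.
split=> [cT U bU|HT F A /test_nbhsE[U bU UA]].
  have /(cT 0)/smooth_nbhsE[V bV VU] : nbhs (T 0) U.
    by apply/test_nbhsE; exists U => // g; rewrite T0 add0r.
  by exists V => // F /VU; rewrite add0r.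
have [V bV VU] := HT U bU; apply/smooth_nbhsE; exists V => // G /VU UG.
by rewrite /= TD; exact: UA.
Qed.

Lemma transversal_submod : submod_closed transversal.
Proof.
split=> [|a T S /asboolP[lT mT cT] /asboolP[lS mS cS]]; apply/asboolP.
  split=> [b F G|f F|].
  - by rewrite /= scaler0 addr0.
  - by apply: testFun_ext => x; rewrite -[LHS]/(0 : R[i]) -[RHS]/(f x * 0) mulr0.
  - exact: cst_continuous.
have lin : linear (a *: T + S).
  move=> b F G; rewrite -[LHS]/(a *: T (b *: F + G) + S (b *: F + G)).
  rewrite lT lS -[RHS]/(b *: (a *: T F + S F) + (a *: T G + S G)).
  by rewrite !scalerDr !scalerA [b * a]mulrC addrACA.
split=> //.
  move=> f F; rewrite -[LHS]/(a *: T (pull_mul f F) + S (pull_mul f F)) mT mS.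
  apply: testFun_ext => x.
  rewrite -[LHS]/(a * (f x * T F x) + f x * S F x).
  by rewrite -[RHS]/(f x * (a * T F x + S F x)) mulrDr mulrCA.
apply/(linear_continuousP lin) => U bU.
have [a0|a0] := eqVneq a 0.
  have [V bV VU] := (linear_continuousP lS).1 cS U bU.
  exists V => // F /VU; rewrite -[X in _ -> U X]/(a *: T F + S F).
  by rewrite a0 scale0r add0r.
have [W bW WU] := test_base_half bU.
have [V1 bV1 V1W] := (linear_continuousP lT).1 cT _ (test_base_Z bW a0).
have [V2 bV2 V2W] := (linear_continuousP lS).1 cS W bW.
have [V bV VV] := smooth_base_I bV1 bV2.
by exists V => // F /VV[/V1W ? /V2W ?]; exact: WU.
Qed.

HB.instance Definition _ := GRing.isSubmodClosed.Build _ _ transversal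
  transversal_submod.

Record transDistr := TransDistr {
  transDistr_val :> smoothFun MN -> testFun M;
  _ : transDistr_val \in transversal }.

HB.instance Definition _ := [isSub for transDistr_val].
HB.instance Definition _ := [Choice of transDistr by <:].
HB.instance Definition _ := [SubChoice_isSubLmodule of transDistr by <:].

(* The strong topology: uniform convergence on bounded subsets. *)
Definition strong_base : set_system transDistr :=
  [set W | exists A U, [/\ tvs_bounded A, nbhs (0 : testFun M) U &
     W = [set T : transDistr | forall F, A F -> U (T F)]]].

Lemma strong_base_ex : strong_base !=set0.
Proof.
exists [set T : transDistr | forall F, set0 F -> setT (T F)].
exists set0, setT; split=> //; last exact: filterT.
by move=> U _; exists 1.
Qed.

Lemma strong_base_I W W' : strong_base W -> strong_base W' ->
  exists2 Z, strong_base Z & Z `<=` W `&` W'.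
Proof.
move=> [A [U [bA nU ->]]] [B [V [bB nV ->]]].
exists [set T : transDistr | forall F, (A `|` B) F -> (U `&` V) (T F)].
  exists (A `|` B), (U `&` V); split=> //; last exact: filterI.
  move=> Z nZ; have [r r0 Hr] := bA Z nZ; have [s s0 Hs] := bB Z nZ.
  exists (r + s) => [|a ra F [AF|BF]]; first exact: addr_gt0.
    by apply: Hr AF; apply: le_trans ra; rewrite lerDl ltW.
  by apply: Hs BF; apply: le_trans ra; rewrite lerDr ltW.
move=> T HT; split=> F HF.
  by have [] := HT F (or_introl HF).
by have [] := HT F (or_intror HF).
Qed.

HB.instance Definition _ := isOpenTopological.Build transDistr
  (translation_openT strong_base_ex) (translation_openI strong_base_I)
  (@translation_open_bigU _ strong_base).

Lemma dirac_fun_transversal y f : dirac_fun y f \in transversal.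
Proof.
apply/asboolP.
have lin : linear (dirac_fun y f).
  move=> a F G; apply: testFun_ext => x.
  rewrite -[LHS]/(f x * (a * F (x, y) + G (x, y))).
  by rewrite -[RHS]/(a * (f x * F (x, y)) + f x * G (x, y)) mulrDr mulrCA.
split=> //.
  move=> g F; apply: testFun_ext => x.
  rewrite -[LHS]/(f x * (g x * F (x, y))).
  by rewrite -[RHS]/(g x * (f x * F (x, y))) mulrCA.
apply/(linear_continuousP lin) => U [_ /(_ _ (@testP _ _ _ f))].
move=> [V /smooth_nbhsE[W [I [c [K [s [e [H e0 ->]]]]]] WV] VU].
have [c' ac' cy] := atlas_cover y.
suff /(filter_forall _) : forall i : I, \forall F \near (0 : smoothFun MN),
    forall z, K i z ->
      `|cpartial (s i) (dirac_fun y f F \o chart_inv (c i)) z| < e.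
  move=> /smooth_nbhsE[B bB HB]; exists B => // F /HB; rewrite add0r => HF.
  apply: VU; first exact: support_setM.
  by rewrite -[X in V X]add0r; apply: WV.
move=> i; have [aci cK Kc] := H i.
have oc := chart_img_open (c i).
pose w := chart_map c' y.
have sub z : chart_img (c i) z -> chart_img (prod_chart (c i) c') (row_mx z w).
  by move=> cz; split; rewrite (row_mxKl, row_mxKr) => //; exact: chart_map_img.
have [t [e' [e'0 He']]] :=
  cslice_mul_bound (s i) oc sub cK Kc (smoothP f aci) e0.
have aC : atlas MN (prod_chart (c i) c') by exists (c i, c').
pose L : set 'rV[R]_(m + n) := (fun z => row_mx z w) @` K i.
have cL : compact L.
  apply: continuous_compact cK; apply: continuous_in_subspaceT => z _.
  apply: (@continuous_row_mx R 'rV[R]_m m n id (cst w) z).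
    exact: cvg_id.
  exact: cst_continuous.
apply/smooth_nbhsE.
exists (@smooth_ball _ _ MN (seq_sub t) (fun=> prod_chart (c i) c')
  (fun=> L) val e').
  exists (seq_sub t), (fun=> prod_chart (c i) c'), (fun=> L), val, e'.
  by split=> // k; split=> // _ [z /Kc/sub ? <-].
move=> F HF z Kz; rewrite add0r.
have E x : chart_img (c i) x -> (dirac_fun y f F \o chart_inv (c i)) x =
    (f \o chart_inv (c i)) x *
    (F \o chart_inv (prod_chart (c i) c')) (row_mx x w).
  by move=> _ /=; rewrite row_mxKl row_mxKr chart_mapK.
rewrite (cpartial_eq (s i) oc E (Kc _ Kz)).
apply: He' => //; first exact: (smoothP F aC).
move=> r x rt Kx; apply: (HF (SeqSub rt)).
by exists x.
Qed.

Definition dirac (y : N) (f : testFun M) : transDistr :=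
  TransDistr (dirac_fun_transversal y f).

Definition Dirac : set transDistr :=
  [set T | exists (k : nat) (y : 'I_k -> N) (f : 'I_k -> testFun M),
     T = \sum_(i < k) dirac (y i) (f i)].

End Transversal.

Arguments Dirac {R m n} M N _.

(* Main.v *)
Require Import Defs.
Set Warnings "-all".
From mathcomp Require Import all_boot all_order all_algebra.
From mathcomp Require Import boolp classical_sets functions.
From mathcomp Require Import reals topology normedtype derive.
From mathcomp Require Import realfun sequences exp.
From mathcomp Require Import ring lra.
From mathcomp.real_closed Require Import complex.

Set Implicit Arguments.
Unset Strict Implicit.
Unset Printing Implicit Defensive.

Import Order.TTheory GRing.Theory Num.Theory.
Import numFieldNormedType.Exports.

Local Open Scope classical_set_scope.
Local Open Scope ring_scope.

(** Let T be a transversal distribution, A a bounded set of smooth functions on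
    M x N and U a neighborhood of 0 in the test functions on M. By continuity, T
    maps into U some ball V, which involves finitely many derivatives on
    finitely many compact sets, each read in a product of charts. It suffices to
    find an operator of finite rank on the N side,

      S F (x, y) = sum_i phi_i y * F (x, y_i),

    with S F - F in V for all F in A. Indeed T is linear over the test functions
    of M, hence over all smooth functions of x ([transversal_tensor]), so T (S F)
    is the sum over i of F (., y_i) * T (1 (x) phi_i), which is the value at F of
    a sum of Dirac elements whose coefficients are the test functions
    T (1 (x) phi_i) ([finite_rank_Dirac]).

    The operators S come from Bernstein polynomials. In a chart of N, the
    Bernstein polynomials of a function on a cube only involve its values at
    finitely many points, and all their derivatives converge to those of the
    function, at a rate governed by bounds on the derivatives ([bern_null],
    [bern_seq_null]); a bounded set A provides bounds that are uniform in F
    ([bounded_bdd]). Multiplied by a cutoff chi supported in the cube, these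
    operators extend by zero to N and approximate F |-> chi F
    ([local_approximation]). If S approximates the identity near W, and B
    approximates multiplication by a cutoff chi equal to 1 on Y, then
    B + (1 - chi) S approximates the identity near the union of W and Y.
    Finitely many such steps cover the projections to N of the compact sets
    defining V ([approximable_compact]).

    Convergence is phrased for families of functions indexed along a filter: a
    family is null on O if each of its derivatives tends to 0 uniformly on O,
    and bounded if each of them is eventually bounded on O. The index set is that
    of the pairs (k, F), with k large and F in A, so that uniformity over A is
    built in. These two notions are stable under derivatives, products and
    changes of coordinates; the last point rests on the chain rule
    ([null_mul_comp]), and allows convergence to be checked in a single
    chart of N ([null_at_chart]). *)

(** * Coordinate boxes and the mean value theorem in one coordinate *)

Section Box.
Context {R : realType} {d : nat}.
Implicit Types (v x y c : 'rV[R]_d) (j : 'I_d).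

Definition box c (rho : 'I_d -> R) : set 'rV[R]_d :=
  [set v | forall j, `|v 0 j - c 0 j| < rho j].

Definition cbox c (rho : 'I_d -> R) : set 'rV[R]_d :=
  [set v | forall j, `|v 0 j - c 0 j| <= rho j].

Lemma nbhs_box x (rho : 'I_d -> R) : (forall j, 0 < rho j) -> nbhs x (box x rho).
Proof.
move=> rho0; exists (fun _ j => ball (x 0 j) (rho j)) => [k j|y Hy j].
  by rewrite ord1; exact: nbhsx_ballx.
by have := Hy 0 j; rewrite /ball/= distrC.
Qed.

Lemma nbhs_boxP x A : nbhs x A -> exists2 r : R, 0 < r & box x (fun=> r) `<=` A.
Proof.
move=> /nbhs_ballP[r /= r0 rA]; exists r => // y yx; apply: rA; split=> // k j.
by rewrite ord1 /ball /= distrC.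
Qed.

Lemma box_open c rho : open (box c rho).
Proof.
rewrite openE => v vc; apply: filterS (nbhs_box v
  (rho := fun j => rho j - `|v 0 j - c 0 j|) _) => [y yv j|j]; last first.
  by rewrite subr_gt0.
have := yv j; rewrite ltrBrDr; apply: le_lt_trans.
by rewrite (le_trans _ (ler_normD _ _))// addrA subrK.
Qed.

Lemma box_cbox c rho : box c rho `<=` cbox c rho.
Proof. by move=> v vc j; exact/ltW/vc. Qed.

Lemma cbox_compact c rho : compact (cbox c rho).
Proof.
have -> : cbox c rho =
    [set v | forall j, `[c 0 j - rho j, c 0 j + rho j]%classic (v ord0 j)].
  by apply/seteqP; split=> v vc j; have := vc j; rewrite /= in_itv/= -ler_distl.
have H := @rV_compact R d (fun j => `[c 0 j - rho j, c 0 j + rho j]%classic).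
by apply: H => j; exact: segment_compact.
Qed.

(** The point obtained from v by giving the value t to its i-th coordinate; as
    a function of t, a line in the direction of the i-th basis vector. *)
Definition upd v i (t : R) : 'rV[R]_d := v + (t - v 0 i) *: delta_mx 0 i.

Lemma updE v i t j : upd v i t 0 j = if j == i then t else v 0 j.
Proof.
rewrite !mxE eqxx/=; case: eqP => [->|_]; first by rewrite mulr1 addrC subrK.
by rewrite mulr0 addr0.
Qed.

Lemma upd_id v i : upd v i (v 0 i) = v.
Proof. by rewrite /upd subrr scale0r addr0. Qed.

Lemma upd_shift v i (s t : R) : s *: delta_mx 0 i + upd v i t = upd v i (s + t).
Proof.
apply/rowP => j; rewrite [RHS]updE !mxE eqxx/=; case: eqP => [->|_].
  by rewrite !mulr1 [v 0 i + _]addrC subrK.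
by rewrite !mulr0 add0r addr0.
Qed.

Lemma is_derive_upd (g : 'rV[R]_d -> R) v i (t : R) :
  derivable g (upd v i t) (delta_mx 0 i) ->
  is_derive t 1 (fun t => g (upd v i t)) ('D_(delta_mx 0 i) g (upd v i t)).
Proof.
have E : (fun h : R => h^-1 *: (g (upd v i (h *: (1 : R) + t)) - g (upd v i t))) =
    (fun h : R => h^-1 *: (g (h *: delta_mx 0 i + upd v i t) - g (upd v i t))).
  apply/funext => h; congr (_ *: (g _ - _)).
  by rewrite upd_shift [h *: _]mulr1.
by move=> dg; split; rewrite /derivable /derive /= E.
Qed.

Lemma upd_mvt_le (g : 'rV[R]_d -> R) v i (a b : R) : a <= b ->
  (forall t, a <= t <= b -> derivable g (upd v i t) (delta_mx 0 i)) ->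
  exists2 c, a <= c <= b &
    g (upd v i b) - g (upd v i a) = (b - a) * 'D_(delta_mx 0 i) g (upd v i c).
Proof.
move=> ab dg.
have dg' t : t \in `[a, b]%R -> is_derive t 1 (fun t => g (upd v i t))
    ('D_(delta_mx 0 i) g (upd v i t)).
  by rewrite in_itv => tab; apply: is_derive_upd; exact: dg.
pose f t := g (upd v i t); pose df t := 'D_(delta_mx 0 i) g (upd v i t).
have /(MVT_segment ab) H : forall t, t \in `]a, b[%R -> is_derive t 1 f (df t).
  by move=> t tab; apply: dg'; apply: subset_itv_oo_cc.
have [|c cab E] := H.
  by apply: derivable_within_continuous => t /dg'[].
rewrite in_itv/= in cab.
by exists c; rewrite // E mulrC.
Qed.

Lemma upd_mvt (g : 'rV[R]_d -> R) v i (b : R) :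
  (forall t, `|t - v 0 i| <= `|b - v 0 i| ->
     derivable g (upd v i t) (delta_mx 0 i)) ->
  exists2 c, `|c - v 0 i| <= `|b - v 0 i| &
    g (upd v i b) - g v = (b - v 0 i) * 'D_(delta_mx 0 i) g (upd v i c).
Proof.
move=> dg; have [vb|bv] := leP (v 0 i) b.
  have [t /andP[vt tb]|c /andP[vc cb] E] := upd_mvt_le (g := g) (v := v) (i := i) vb.
    by apply: dg; rewrite !ger0_norm ?subr_ge0// lerB.
  by exists c; rewrite -?E ?upd_id// !ger0_norm ?subr_ge0// lerB.
have [t /andP[vt tb]|c /andP[vc cb] E] :=
    upd_mvt_le (g := g) (v := v) (i := i) (ltW bv).
  by apply: dg; rewrite !ler0_norm ?subr_le0 ?(ltW bv)// lerN2 lerB.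
exists c; last by rewrite -[LHS]opprB -[b - _]opprB mulNr -E upd_id.
by rewrite !ler0_norm ?subr_le0 ?(ltW bv)// lerN2 lerB.
Qed.

(** Going from y to y' by changing one coordinate at a time, each step obeys the
    one-variable mean value theorem; the intermediate points stay in the box
    spanned by y and y'. This replaces differentiability of g, of which only
    partial derivatives are at hand. *)
Lemma mvt_coords (g : 'rV[R]_d -> R) y y' :
  (forall z : 'rV[R]_d, (forall l, `|z 0 l - y 0 l| <= `|y' 0 l - y 0 l|) ->
     forall i, derivable g z (delta_mx 0 i)) ->
  exists2 xi : 'I_d -> 'rV[R]_d,
    (forall i l, `|xi i 0 l - y 0 l| <= `|y' 0 l - y 0 l|) &
    g y' - g y = \sum_(i < d) (y' 0 i - y 0 i) * 'D_(delta_mx 0 i) g (xi i).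
Proof.
move=> dg; pose p k : 'rV[R]_d := \row_j if (j < k)%N then y' 0 j else y 0 j.
have pE (i : 'I_d) : p i 0 i = y 0 i by rewrite mxE ltnn.
have pS (i : 'I_d) : p i.+1 = upd (p i) i (y' 0 i).
  apply/rowP => j; rewrite updE !mxE; have [->|/eqP ji] := eqVneq j i.
    by rewrite leqnn.
  by rewrite ltnS leq_eqVlt val_eqE; case: eqP ji => //= _ _; rewrite mxE.
have bnd (i : 'I_d) (c : R) : `|c - y 0 i| <= `|y' 0 i - y 0 i| ->
    forall l, `|upd (p i) i c 0 l - y 0 l| <= `|y' 0 l - y 0 l|.
  move=> ci l; rewrite updE; case: eqP => [-> //|_]; rewrite mxE.
  by case: ifP => _ //; rewrite subrr normr0.
have H (i : 'I_d) : exists xi : 'rV[R]_d, 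
      (forall l, `|xi 0 l - y 0 l| <= `|y' 0 l - y 0 l|) /\
    g (p i.+1) - g (p i) = (y' 0 i - y 0 i) * 'D_(delta_mx 0 i) g xi.
  have [t|c cb E] := upd_mvt (g := g) (v := p i) (i := i) (b := y' 0 i).
    by rewrite pE => ti; apply: dg; exact: bnd.
  exists (upd (p i) i c); rewrite pE in cb; split; first exact: bnd.
  by rewrite pS E pE.
have [xi Hxi] := choice H.
exists xi => [i|]; first by have [] := Hxi i.
rewrite [RHS](eq_bigr (fun i : 'I_d => g (p i.+1) - g (p i))); last first.
  by move=> i _; have [] := Hxi i.
rewrite -(big_mkord xpredT (fun i : nat => g (p i.+1) - g (p i))) telescope_sumr//.
by congr (g _ - g _); apply/rowP => j; rewrite mxE ?ltn_ord ?ltn0.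
Qed.

End Box.

Arguments box_open {R d} c rho.
Arguments cbox_compact {R d} c rho.

(** * The chain rule, composition of smooth maps and mixed derivatives *)

Section ChainRule.
Context {R : realType}.

Lemma is_derive_cvg d (f : 'rV[R]_d -> R) x v l :
  (fun h : R => h^-1 *: (f (h *: v + x) - f x)) @ 0^' --> l -> is_derive x v f l.
Proof. by move=> fl; split; [exact: cvgP fl|exact: cvg_lim fl]. Qed.

Lemma is_derive_quotient d (f : 'rV[R]_d -> R) x v l : is_derive x v f l ->
  (fun h : R => h^-1 *: (f (h *: v + x) - f x)) @ 0^' --> l.
Proof. by move=> [df <-]; exact: df. Qed.

(** A directional derivative only gives continuity along its line, which is what
    the chain rule needs of the inner map. *)
Lemma is_derive_line_cvg d (f : 'rV[R]_d -> R) x v l : is_derive x v f l ->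
  (fun h : R => f (h *: v + x)) @ 0^' --> f x.
Proof.
move=> /is_derive_quotient H.
have : (fun h : R => f x + h * (h^-1 *: (f (h *: v + x) - f x))) @ 0^' -->
    f x + 0 * l.
  apply: cvgD; first exact: cvg_cst.
  apply: cvgM H; apply: cvg_within_filter; exact: cvg_id.
rewrite mul0r addr0; apply: cvg_trans; apply: near_eq_cvg.
near=> h; rewrite -[h^-1 *: _]/(h^-1 * _) mulrA mulfV ?mul1r ?[f x + _]addrC ?subrK//.
near: h; exact: nbhs_dnbhs_neq.
Unshelve. all: by end_near. Qed.

(** By [mvt_coords], the increment of g is the sum over i of the increment of the
    i-th component of A times a partial derivative of g at a point that tends to
    A x; continuity of these partial derivatives gives the limit. *)
Lemma chain_rule d e (A : 'rV[R]_d -> 'rV[R]_e) (g : 'rV[R]_e -> R) x v a :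
  (forall i, is_derive x v (fun x => A x 0 i) (a i)) ->
  (\forall y \near A x, forall i, derivable g y (delta_mx 0 i)) ->
  (forall i, {for A x, continuous ('D_(delta_mx 0 i) g)}) ->
  is_derive x v (fun x => g (A x)) (\sum_(i < e) a i * 'D_(delta_mx 0 i) g (A x)).
Proof.
move=> dA /nbhs_boxP[r r0 Hr] cg.
pose B h := A (h *: v + x).
have cB i : (fun h => B h 0 i) @ 0^' --> A x 0 i.
  exact: is_derive_line_cvg (dA i).
have H h : exists xi : 'I_e -> 'rV[R]_e,
    (forall i l, `|xi i 0 l - A x 0 l| <= `|B h 0 l - A x 0 l|) /\
    (box (A x) (fun=> r) (B h) ->
      g (B h) - g (A x) =
        \sum_(i < e) (B h 0 i - A x 0 i) * 'D_(delta_mx 0 i) g (xi i)).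
  have [bh|nbh] := pselect (box (A x) (fun=> r) (B h)).
    have [|xi xiP E] := @mvt_coords R e g (A x) (B h); last by exists xi.
    by move=> z zb; apply: Hr => l; apply: le_lt_trans (zb l) (bh l).
  by exists (fun=> A x); split=> // i l; rewrite subrr normr0.
have [xi Hxi] := choice H.
have near_B (s : R) : 0 < s -> \forall h \near 0^', box (A x) (fun=> s) (B h).
  move=> s0; apply: filter_forall => i.
  have /cvgrPdist_lt/(_ _ s0) := cB i.
  by apply: filterS => h; rewrite distrC.
have cxi i : (fun h => xi h i) @ 0^' --> A x.
  move=> W /nbhs_boxP[s s0 sW]; have := near_B s s0.
  apply: filterS => h hs; apply: sW => l.
  by have [/(_ i l) + _] := Hxi h; move=> /le_lt_trans; apply; exact: hs.
apply: is_derive_cvg.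
have : (fun h : R => \sum_(i < e)
    (h^-1 *: (B h 0 i - A x 0 i)) * 'D_(delta_mx 0 i) g (xi h i)) @ 0^' -->
    \sum_(i < e) a i * 'D_(delta_mx 0 i) g (A x).
  apply: cvg_big => [|i _]; [exact: add_continuous|apply: cvgM].
    exact: is_derive_quotient (dA i).
  exact: (cvg_comp _ _ (cxi i) (cg i)).
apply: cvg_trans; apply: near_eq_cvg; near=> h.
rewrite -[A (h *: v + x)]/(B h) (Hxi h).2; last by near: h; exact: near_B.
by rewrite scaler_sumr; apply: eq_bigr => i _; rewrite scalerAl.
Unshelve. all: by end_near. Qed.

End ChainRule.

Section SmoothComposition.
Context {R : realType}.

Lemma is_derive_congr d (f : 'rV[R]_d -> R) x v l l' :
  is_derive x v f l -> l = l' -> is_derive x v f l'.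
Proof. by move=> ? <-. Qed.

Lemma derive_of d (f : 'rV[R]_d -> R) x v l : is_derive x v f l -> 'D_v f x = l.
Proof. by case. Qed.

Lemma smooth_onW d (O O' : set 'rV[R]_d) g :
  O' `<=` O -> smooth_on O g -> smooth_on O' g.
Proof. by move=> sO sg s x /sO; exact: sg. Qed.

Lemma smooth_on_derivable d (O : set 'rV[R]_d) g x j :
  smooth_on O g -> O x -> derivable g x (delta_mx 0 j).
Proof. by move=> sg Ox; have [_] := sg [::] x Ox; apply. Qed.

Arguments smooth_on_derivable {d O g x} j.

Lemma smooth_onD d (O : set 'rV[R]_d) g h : open O ->
  smooth_on O g -> smooth_on O h -> smooth_on O (fun x => g x + h x).
Proof.
move=> oO sg sh; have := smooth_on_comb 1 1 oO sg sh.
by apply: smooth_on_eq => // x _; rewrite !mul1r.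
Qed.

Lemma smooth_onB d (O : set 'rV[R]_d) g h : open O ->
  smooth_on O g -> smooth_on O h -> smooth_on O (fun x => g x - h x).
Proof.
move=> oO sg sh; have := smooth_on_comb 1 (-1) oO sg sh.
by apply: smooth_on_eq => // x _; rewrite mul1r mulN1r.
Qed.

Lemma partialD d (O : set 'rV[R]_d) g h s x : open O ->
  smooth_on O g -> smooth_on O h -> O x ->
  partial s (fun x => g x + h x) x = partial s g x + partial s h x.
Proof.
move=> oO sg sh Ox; have := partial_comb 1 1 s oO sg sh Ox.
rewrite !mul1r => <-; congr (partial s _ x).
by apply/funext => y; rewrite !mul1r.
Qed.

Lemma partialB d (O : set 'rV[R]_d) g h s x : open O ->
  smooth_on O g -> smooth_on O h -> O x ->
  partial s (fun x => g x - h x) x = partial s g x - partial s h x.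
Proof.
move=> oO sg sh Ox; have := partial_comb 1 (-1) s oO sg sh Ox.
rewrite mul1r mulN1r => <-; congr (partial s _ x).
by apply/funext => y; rewrite mul1r mulN1r.
Qed.

Lemma smooth_on_sum d (O : set 'rV[R]_d) (I : Type) (r : seq I) f : open O ->
  (forall i, smooth_on O (f i)) -> smooth_on O (fun x => \sum_(i <- r) f i x).
Proof.
move=> oO sf; elim: r => [|i r IH].
  under eq_fun do rewrite big_nil; exact: smooth_on_cst.
rewrite (_ : (fun x => _) = fun x => f i x + \sum_(j <- r) f j x).
  exact: (smooth_onD oO (sf i) IH).
by apply/funext => x; rewrite big_cons.
Qed.

Lemma smooth_on_coord d (O : set 'rV[R]_d) i : open O ->
  smooth_on O (fun x => x 0 i).
Proof.
pose S : set ('rV[R]_d -> R) :=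
  [set g | g = (fun x : 'rV[R]_d => x 0 i) \/ exists a, g = cst a].
move=> oO; apply: (smooth_coind (S := S)) => //; last by left.
move=> _ [->|[a ->]]; split=> [x _|j].
- exact: coord_continuous.
- exists (cst ((delta_mx 0 j : 'rV[R]_d) 0 i)); first by right; eexists.
  move=> x _; apply: is_derive_cvg.
  apply: (@cvg_trans _ (((fun=> (delta_mx 0 j : 'rV[R]_d) 0 i) : R -> R) @ 0^')).
    apply: near_eq_cvg; near=> h.
    rewrite !mxE addrK -[_ *: _]/(h^-1 * (h * _)) mulKf//.
    by near: h; exact: nbhs_dnbhs_neq.
  exact: cvg_cst.
- exact: cst_continuous.
- by exists (cst 0); [right; exists 0|move=> x _; exact: is_derive_cst].
Unshelve. all: by end_near. Qed.

Lemma smooth_map_continuous d e (O : set 'rV[R]_d) (A : 'rV[R]_d -> 'rV[R]_e) x :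
  (forall i, smooth_on O (fun x => A x 0 i)) -> O x -> {for x, continuous A}.
Proof.
move=> sA Ox W /nbhs_boxP[r r0 rW].
have H i : \forall y \near x, `|A x 0 i - A y 0 i| < r.
  have cA : (fun y => A y 0 i) @ x --> A x 0 i.
    exact: (smooth_on_continuous (sA i) Ox).
  by move/cvgrPdist_lt : cA => /(_ r r0).
have := filter_forall (nbhs_filter x) H.
by apply: filterS => y Hy; apply: rW => i; rewrite distrC.
Qed.

Section Comp.
Context {d e : nat} (O : set 'rV[R]_d) (O' : set 'rV[R]_e).
Context (A : 'rV[R]_d -> 'rV[R]_e).
Hypotheses (oO : open O) (oO' : open O') (AO : forall x, O x -> O' (A x)).
Hypothesis sA : forall i, smooth_on O (fun x => A x 0 i).

Lemma is_derive_comp g x j : smooth_on O' g -> O x ->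
  is_derive x (delta_mx 0 j) (fun x => g (A x))
    (\sum_(i < e) 'D_(delta_mx 0 j) (fun x => A x 0 i) x *
       'D_(delta_mx 0 i) g (A x)).
Proof.
move=> sg Ox; apply: chain_rule => [i||i].
- exact: smooth_on_derive (sA i) Ox.
- near=> y => i.
  have Oy : O' y; last first. exact: (smooth_on_derivable i sg Oy).
  near: y; apply: open_nbhs_nbhs; split=> //; exact: AO.
- exact: smooth_on_continuous (smooth_on_partial i sg) (AO Ox).
Unshelve. all: by end_near. Qed.

Lemma is_derive_mul_comp p g x j : smooth_on O p -> smooth_on O' g -> O x ->
  is_derive x (delta_mx 0 j) (fun x => p x * g (A x))
    ('D_(delta_mx 0 j) p x * g (A x) +
     \sum_(i < e) (p x * 'D_(delta_mx 0 j) (fun x => A x 0 i) x) *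
       'D_(delta_mx 0 i) g (A x)).
Proof.
move=> sp sg Ox; have dp := smooth_on_derive j sp Ox.
have dg := is_derive_comp j sg Ox.
apply: is_derive_congr (is_deriveM dp dg) _.
rewrite addrC; congr (_ + _); first exact: mulrC.
by rewrite scaler_sumr; apply: eq_bigr => i _; rewrite -mulrA.
Qed.

(** Differentiating p * (g o A) produces a sum of terms of the same shape; this is
    the smallest class containing such products that is closed under
    derivatives, on which [smooth_coind] can be run. *)
Inductive comp_sum : ('rV[R]_d -> R) -> Prop :=
| comp_sum0 : comp_sum (cst 0)
| comp_sumD p g k : smooth_on O p -> smooth_on O' g -> comp_sum k ->
    comp_sum (fun x => p x * g (A x) + k x).

Lemma comp_sum_big (I : Type) (r : seq I) p g k :
  (forall i, smooth_on O (p i)) -> (forall i, smooth_on O' (g i)) ->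
  comp_sum k -> comp_sum (fun x => \sum_(i <- r) p i x * g i (A x) + k x).
Proof.
move=> sp sg sk; elim: r => [|i r IH].
  by under eq_fun do rewrite big_nil add0r.
rewrite (_ : (fun x => _) = fun x => p i x * g i (A x) +
    (\sum_(j <- r) p j x * g j (A x) + k x)).
  exact: comp_sumD.
by apply/funext => x; rewrite big_cons addrA.
Qed.

Lemma smooth_on_comp g : smooth_on O' g -> smooth_on O (fun x => g (A x)).
Proof.
move=> sg; apply: (smooth_coind (S := comp_sum)) => //; last first.
  rewrite (_ : (fun _ => _) = (fun x => cst 1 x * g (A x) + cst 0 x)); last first.
    by apply/funext => x; rewrite mul1r addr0.
  exact: (comp_sumD (smooth_on_cst 1 oO) sg comp_sum0).
move=> u; elim=> [|p h k sp sh _ [kc kd]].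
  split=> [x _|j]; first exact: cst_continuous.
  by exists (cst 0); [exact: comp_sum0|move=> x _; exact: is_derive_cst].
split=> [x Ox|j].
  apply: (@continuousD _ _ _ (fun x => p x * h (A x)) k); last exact: kc.
  apply: (@continuousM _ _ p (fun x => h (A x))).
    exact: (smooth_on_continuous sp).
  apply: (@continuous_comp _ _ _ A h).
    exact: smooth_map_continuous sA Ox.
  by apply: (smooth_on_continuous sh); exact: AO.
have [l Sl kl] := kd j.
exists (fun x => 'D_(delta_mx 0 j) p x * h (A x) + (
  \sum_(i <- index_enum 'I_e)
    (p x * 'D_(delta_mx 0 j) (fun x => A x 0 i) x) * 'D_(delta_mx 0 i) h (A x)
  + l x)).
  pose q i x := p x * 'D_(delta_mx 0 j) (fun x => A x 0 i) x.
  have sq i : smooth_on O (q i).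
    exact: (smooth_onM oO sp (smooth_on_partial j (sA i))).
  exact: (comp_sumD (smooth_on_partial j sp) sh (comp_sum_big
    (index_enum 'I_e) sq (fun i => smooth_on_partial i sh) Sl)).
move=> x Ox.
apply: is_derive_congr (is_deriveD (is_derive_mul_comp j sp sh Ox) (kl x Ox)) _.
by rewrite addrA.
Qed.

End Comp.

(** The mean value theorem, first in the i-th then in the j-th coordinate: the
    second difference of g over a square of side a is a ^ 2 times a mixed
    derivative at some point nearby. *)
Lemma second_difference d (O : set 'rV[R]_d) g x (r a : R) i j : open O ->
  smooth_on O g -> i != j -> 0 <= a -> a < r -> box x (fun=> r) `<=` O ->
  exists2 z, box x (fun=> r) z &
    g (upd (upd x i (x 0 i + a)) j (x 0 j + a)) - g (upd x i (x 0 i + a)) -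
      (g (upd x j (x 0 j + a)) - g x) =
    a * (a * 'D_(delta_mx 0 j) ('D_(delta_mx 0 i) g) z).
Proof.
move=> oO sg ij a0 ar xO.
have r0 : 0 < r by apply: le_lt_trans ar.
pose u z := upd z j (x 0 j + a).
have comm t : u (upd x i t) = upd (u x) i t.
  by apply/rowP => l; rewrite !updE; case: eqP => // ->; rewrite eq_sym (negPf ij).
have ub t l : `|t - x 0 i| <= a -> `|u (upd x i t) 0 l - x 0 l| < r.
  move=> ta; rewrite /u updE; case: eqP => [->|_].
    by rewrite addrC addKr ger0_norm.
  rewrite updE; case: eqP => [->|_]; first exact: le_lt_trans ta ar.
  by rewrite subrr normr0.
have vb t l : `|t - x 0 i| <= a -> `|upd x i t 0 l - x 0 l| < r.
  move=> ta; rewrite updE; case: eqP => [->|_]; first exact: le_lt_trans ta ar.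
  by rewrite subrr normr0.
have aE b : b + a - b = a by rewrite addrC addKr.
pose f t := g (u (upd x i t)) - g (upd x i t).
have df t : `|t - x 0 i| <= a -> is_derive t 1 f
   ('D_(delta_mx 0 i) g (u (upd x i t)) - 'D_(delta_mx 0 i) g (upd x i t)).
  move=> ta; apply: is_deriveB.
    under eq_fun do rewrite comm.
    rewrite comm; apply: is_derive_upd; rewrite -comm.
    by apply: (smooth_on_derivable i sg); apply: xO => l; exact: ub.
  apply: is_derive_upd.
  by apply: (smooth_on_derivable i sg); apply: xO => l; exact: vb.
have xa : x 0 i <= x 0 i + a by rewrite lerDl.
have near_x t : t \in `[x 0 i, x 0 i + a]%R -> `|t - x 0 i| <= a.
  rewrite in_itv/= => /andP[xt ta].
  by rewrite ger0_norm ?subr_ge0// lerBlDl.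
pose f' t := 'D_(delta_mx 0 i) g (u (upd x i t)) - 'D_(delta_mx 0 i) g (upd x i t).
have /(MVT_segment xa) H :
    forall t, t \in `]x 0 i, x 0 i + a[%R -> is_derive t 1 f (f' t).
  by move=> t tx; apply: df; apply: near_x; apply: subset_itv_oo_cc.
have [|t tx E] := H.
  by apply: derivable_within_continuous => t /near_x/df[].
pose y := upd x i t.
have yj : y 0 j = x 0 j by rewrite updE eq_sym (negPf ij).
have [t' t'b|c cb E'] := @upd_mvt R d ('D_(delta_mx 0 i) g) y j (x 0 j + a).
  apply: (smooth_on_derivable j (smooth_on_partial i sg)); apply: xO => l.
  rewrite yj aE (ger0_norm a0) in t'b; rewrite updE; case: eqP => [->|_].
    exact: le_lt_trans t'b ar.
  by apply: vb; exact: near_x.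
exists (upd y j c).
  move=> l; rewrite yj aE (ger0_norm a0) in cb; rewrite updE; case: eqP => [->|_].
    exact: le_lt_trans cb ar.
  by apply: vb; exact: near_x.
rewrite -[LHS]/(f (x 0 i + a) - (g (u x) - g x)).
have -> : g (u x) - g x = f (x 0 i) by rewrite /f upd_id.
rewrite E /f' -/y /u E' yj !aE mulrC.
by congr (_ * _).
Qed.

Lemma limits_apart (a b c c' : R) (e := `|a - b| / 2) :
  a != b -> `|a - c| < e -> `|b - c'| < e -> c <> c'.
Proof.
move=> ab ac bc' cc'; rewrite -{}cc' distrC in bc'.
have := ltrD ac bc'; rewrite /e -splitr => /(le_lt_trans (ler_normD _ _)).
by rewrite addrA subrK ltxx.
Qed.

Lemma subr4C (a b c c' : R) : a - b - (c - c') = a - c - (b - c').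
Proof. by ring. Qed.

(** The second difference of [second_difference] is symmetric in i and j, so both
    mixed derivatives take a common value arbitrarily close to x; both are
    continuous. *)
Lemma partialC d (O : set 'rV[R]_d) g i j x : open O -> smooth_on O g -> O x ->
  'D_(delta_mx 0 j) ('D_(delta_mx 0 i) g) x =
  'D_(delta_mx 0 i) ('D_(delta_mx 0 j) g) x.
Proof.
move=> oO sg Ox; have [->//|ij] := eqVneq i j.
pose gij := 'D_(delta_mx 0 j) ('D_(delta_mx 0 i) g).
pose gji := 'D_(delta_mx 0 i) ('D_(delta_mx 0 j) g).
apply/eqP/negPn/negP => ne.
pose e := `|gij x - gji x| / 2.
have e0 : 0 < e by rewrite divr_gt0// normr_gt0 subr_eq0.
have c1 : gij @ x --> gij x.
  exact: smooth_on_continuous (smooth_on_partial j (smooth_on_partial i sg)) Ox.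
have c2 : gji @ x --> gji x.
  exact: smooth_on_continuous (smooth_on_partial i (smooth_on_partial j sg)) Ox.
move/cvgrPdist_lt : c1 => /(_ _ e0) c1; move/cvgrPdist_lt : c2 => /(_ _ e0) c2.
have nO : nbhs x O by exact: open_nbhs_nbhs.
have [r r0 Hr] := nbhs_boxP (filterI nO (filterI c1 c2)).
have xO : box x (fun=> r) `<=` O by move=> z /Hr[].
have r2 : 0 <= r / 2 by rewrite divr_ge0// ltW.
have r2r : r / 2 < r by rewrite ltr_pdivrMr// ltr_pMr// ltr1n.
have [z /Hr[_ [z1 _]] E1] := second_difference oO sg ij r2 r2r xO.
rewrite eq_sym in ij.
have [z' /Hr[_ [_ z2]] E2] := second_difference oO sg ij r2 r2r xO.
have comm : upd (upd x j (x 0 j + r / 2)) i (x 0 i + r / 2) =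
    upd (upd x i (x 0 i + r / 2)) j (x 0 j + r / 2).
  apply/rowP => l; rewrite !updE; case: eqP => // ->.
  by rewrite eq_sym (negPf ij).
have rn0 : r / 2 != 0 by rewrite mulf_neq0 ?invr_eq0 ?gt_eqF.
rewrite comm subr4C in E2.
have /(mulfI rn0)/(mulfI rn0) E := etrans (esym E1) E2.
exact: limits_apart ne z1 z2 E.
Qed.

Lemma partial_derive d (O : set 'rV[R]_d) g s j x : open O -> smooth_on O g ->
  O x -> partial s ('D_(delta_mx 0 j) g) x = 'D_(delta_mx 0 j) (partial s g) x.
Proof.
move=> oO sg; elim: s x => [//|i s IH] x Ox.
have ss : smooth_on O (partial s g).
  by move=> t; have := sg (t ++ s); rewrite /partial foldr_cat.
rewrite -(partialC j i oO ss Ox) /=.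
apply: near_eq_derive; near=> y; apply: IH; near: y.
exact: open_nbhs_nbhs.
Unshelve. all: by end_near. Qed.

End SmoothComposition.

(** * Smooth cutoff functions *)

Section Cutoff.
Context {R : realType}.
Implicit Types (P : {poly R}) (t : R).

(** The function P(1/t) exp(-1/t), flat at 0. Letting the polynomial P vary makes
    the class of these functions closed under derivatives. *)
Definition flat P t : R := if 0 < t then P.[t^-1] * expR (- t^-1) else 0.

(** With u = 1/t, the exponential series gives exp u >= u ^ (n + 1) / (n + 1)!,
    and for u >= 1 |P(u)| is at most a constant times u ^ n, with n the size of P. *)
Lemma flat_le P : exists2 C : R, 0 <= C &
  forall t, t <= 1 -> `|flat P t| <= C * `|t|.
Proof.
pose n := size P; pose S := \sum_(i < n) `|P`_i|.
have S0 : 0 <= S by apply: sumr_ge0.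
exists (S * n.+1`!%:R); first by rewrite mulr_ge0.
move=> t t1; rewrite /flat; case: ifPn => [t0|_]; last first.
  by rewrite normr0 !mulr_ge0.
set u := t^-1.
have u0 : 0 < u by rewrite invr_gt0.
have u1 : 1 <= u by rewrite invf_ge1.
have Pu : `|P.[u]| <= S * u ^+ n.
  rewrite horner_coef (le_trans (ler_norm_sum _ _ _))// mulr_suml.
  apply: ler_sum => i _; rewrite normrM ler_wpM2l//.
  rewrite (ger0_norm (exprn_ge0 _ (ltW u0))).
  exact: (ler_weXn2l u1 (ltnW (ltn_ord i))).
have eu : u ^+ n.+1 / n.+1`!%:R <= expR u.
  by apply: le_trans (expR_ge1Dxn n (ltW u0)); rewrite lerDr.
have en0 : 0 < u ^+ n.+1 / n.+1`!%:R.
  by rewrite divr_gt0 ?exprn_gt0// ltr0n fact_gt0.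
rewrite expRN normrM [X in _ * X]ger0_norm ?invr_ge0 ?expR_ge0//.
apply: (@le_trans _ _ (S * u ^+ n * (u ^+ n.+1 / n.+1`!%:R)^-1)).
  apply: ler_pM => //; first by rewrite invr_ge0 expR_ge0.
  by rewrite lef_pV2// posrE expR_gt0.
rewrite (gtr0_norm t0) invf_div exprS [u * _]mulrC invfM.
rewrite (_ : _ * _ = S * n.+1`!%:R * u^-1 * (u ^+ n / u ^+ n)); last by ring.
by rewrite divff ?mulr1 ?expf_neq0 ?gt_eqF// /u invrK.
Qed.

(** At 0 the difference quotient of [flat P] is [flat ('X * P)], which tends to 0
    by [flat_le]. *)
Lemma is_derive_flat P t : is_derive t 1 (flat P) (flat ('X^2 * (P - P^`())) t).
Proof.
have [t0|t0|->] := ltgtP t 0.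
- have dc : is_derive t 1 (cst 0 : R -> R) 0 by exact: is_derive_cst.
  rewrite {2}/flat ltNge (ltW t0)/=.
  apply: near_eq_is_derive dc; near=> s; rewrite /flat.
  have -> // : 0 < s = false.
  by apply/negbTE; rewrite -leNgt ltW//; near: s; exact: lt_nbhsl.
- have dV : is_derive t 1 (fun s : R => s^-1) (- t^-1 ^+ 2).
    have := @is_deriveV R id t 1 1 (lt0r_neq0 t0) (is_derive_id t 1).
    move=> H; apply: is_derive_eq H _.
    by rewrite -[_ *: 1]/(_ * 1) mulr1 exprVn.
  have dP := @is_derive1_comp R (horner P) (fun s : R => s^-1) t _ _
    (is_derive_poly P t^-1) dV.
  have dE := @is_derive1_comp R expR (fun s : R => - s^-1) t _ _
    (is_derive_expR (- t^-1)) (is_deriveN dV).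
  have := is_deriveM dP dE.
  rewrite /flat t0 => H; apply: (@near_eq_is_derive _ _ _ _ (flat P)); last first.
    apply: is_derive_eq H _.
    rewrite /= !hornerE -![_ *: _]/(_ * _) /=; ring.
  by near=> s; rewrite /= /flat ifT//; near: s; exact: lt_nbhsr.
have [C C0 HC] := flat_le ('X * P).
have fX s : flat ('X * P) s = s^-1 * flat P s.
  by rewrite /flat; case: ifP => _; [rewrite hornerM hornerX mulrA|rewrite mulr0].
rewrite {2}/flat ltxx.
have cv : (fun h : R => h^-1 *: (flat P (h *: (1 : R) + 0) - flat P 0))
    @ 0^' --> (0 : R).
  apply/cvgrPdist_lt => e e0.
  have C1 : 0 < C + 1 by rewrite ltr_wpDl.
  have m0 : 0 < Num.min 1 (e / (C + 1)) by rewrite lt_min ltr01 divr_gt0.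
  near=> h.
  have hm : `|h| < Num.min 1 (e / (C + 1)).
    by near: h; exact: dnbhs0_lt.
  move: hm; rewrite lt_min => /andP[h1 he].
  rewrite sub0r normrN {2}/flat ltxx subr0 addr0 [h *: _]mulr1.
  rewrite -[_ *: _]/(h^-1 * _) -fX.
  apply: le_lt_trans (HC h (le_trans (ler_norm h) (ltW h1))) _.
  apply: (@le_lt_trans _ _ ((C + 1) * `|h|)); first by rewrite ler_wpM2r// lerDl.
  by rewrite mulrC -ltr_pdivlMr.
by split; [exact: cvgP cv|exact: cvg_lim cv].
Unshelve. all: by end_near. Qed.

Lemma continuous_flat P : continuous (flat P).
Proof.
move=> t; apply/differentiable_continuous/derivable1_diffP.
by have [] := is_derive_flat P t.
Qed.

Lemma smooth_flat P : smooth_on setT (fun v : 'rV[R]_1 => flat P (v 0 0)).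
Proof.
pose S : set ('rV[R]_1 -> R) :=
  [set g | exists P, g = (fun v : 'rV[R]_1 => flat P (v 0 0))].
apply: (smooth_coind (S := S)); [exact: openT| |by exists P].
move=> _ [Q ->]; split=> [x _|j].
  apply: (@continuous_comp _ _ _ (fun v : 'rV[R]_1 => v 0 0) (flat Q)).
    exact: coord_continuous.
  exact: continuous_flat.
exists (fun v : 'rV[R]_1 => flat ('X^2 * (Q - Q^`())) (v 0 0)); first by eexists.
move=> x _.
have [dQ <-] := is_derive_flat Q (x 0 0).
apply: is_derive_cvg; move: dQ; rewrite /derivable /derive /=.
set q1 := (fun h : R => _); set q2 := (fun h : R => _).
suff -> : q1 = q2 by [].
by apply/funext => h; rewrite /q1 /q2 !mxE ord1 eqxx.
Qed.

Lemma smooth_flat_comp d (O : set 'rV[R]_d) P u : open O -> smooth_on O u ->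
  smooth_on O (fun v => flat P (u v)).
Proof.
move=> oO su; pose A v : 'rV[R]_1 := const_mx (u v).
have sA i : smooth_on O (fun v => A v 0 i).
  by apply: smooth_on_eq su => // v _; rewrite mxE.
have := smooth_on_comp oO openT (fun _ _ => Logic.I) sA (smooth_flat P).
by apply: smooth_on_eq => // v _; rewrite mxE.
Qed.

(** With E t = exp(-1/t) for t > 0 and 0 otherwise, the sum [dist v] of the
    E (|v_j - c_j| ^ 2 - r ^ 2) vanishes on the small box and is at least
    D = E (s ^ 2 - r ^ 2) outside the large one. Hence E (1 - dist v / D) / E 1
    is 1 on the former and 0 outside the latter: composing E with itself avoids
    dividing by a function. *)
Lemma cutoff_exists d (c : 'rV[R]_d) (r s : R) : 0 <= r -> r < s ->
  exists chi : 'rV[R]_d -> R, [/\ smooth_on setT chi,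
    forall v, cbox c (fun=> r) v -> chi v = 1 &
    forall v, ~ box c (fun=> s) v -> chi v = 0].
Proof.
move=> r0 rs; pose E := flat 1.
have E_gt0 t : 0 < t -> 0 < E t.
  by move=> t0; rewrite /E /flat t0 hornerC mul1r expR_gt0.
have E0 t : t <= 0 -> E t = 0 by rewrite /E /flat leNgt => /negbTE ->.
have E_ge0 t : 0 <= E t by have [/E_gt0/ltW|/E0 ->] := ltP 0 t.
have E_mono t t' : 0 < t -> t <= t' -> E t <= E t'.
  move=> t0 tt'; have t'0 := lt_le_trans t0 tt'.
  rewrite /E /flat t0 t'0 !hornerC !mul1r ler_expR lerN2.
  by rewrite lef_pV2.
have s2 : 0 < s ^+ 2 - r ^+ 2.
  by rewrite subr_gt0 ltr_pXn2r// ?nnegrE// ltW// (le_lt_trans r0).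
pose D := E (s ^+ 2 - r ^+ 2); have D0 : 0 < D by exact: E_gt0.
pose dist (v : 'rV[R]_d) := \sum_(j < d) E ((v 0 j - c 0 j) ^+ 2 - r ^+ 2).
exists (fun v => E (1 - D^-1 * dist v) * (E 1)^-1); split.
- have oT : open [set: 'rV[R]_d] by exact: openT.
  have sd : smooth_on setT dist.
    apply: (@smooth_on_sum _ _ _ _ _
      (fun j v => E ((v 0 j - c 0 j) ^+ 2 - r ^+ 2)) oT) => j.
    apply: smooth_flat_comp => //.
    have s1 := smooth_onB oT (smooth_on_coord j oT) (smooth_on_cst (c 0 j) oT).
    exact: (smooth_onB oT (smooth_onM oT s1 s1) (smooth_on_cst (r ^+ 2) oT)).
  have s1 := smooth_onB oT (smooth_on_cst 1 oT)
    (smooth_onM oT (smooth_on_cst D^-1 oT) sd).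
  exact: (smooth_onM oT (smooth_flat_comp 1 oT s1) (smooth_on_cst (E 1)^-1 oT)).
- move=> v vc; have -> : dist v = 0.
    apply: big1 => j _; apply: E0; rewrite subr_le0 -real_normK ?num_real//.
    by rewrite ler_pXn2r// nnegrE.
  by rewrite mulr0 subr0 divff// gt_eqF// E_gt0.
move=> v nv; have [j sj] : exists j, s <= `|v 0 j - c 0 j|.
  apply: contrapT => H; apply: nv => j; rewrite ltNge; apply/negP => sj.
  by apply: H; exists j.
rewrite E0 ?mul0r// subr_le0 mulrC ler_pdivlMr// mul1r.
rewrite /dist (bigD1 j)//= (@le_trans _ _ (E ((v 0 j - c 0 j) ^+ 2 - r ^+ 2)))//.
  apply: E_mono => //; rewrite lerB// -(real_normK (num_real (v 0 j - c 0 j))).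
  by rewrite ler_pXn2r// ?nnegrE// (le_trans r0)// ltW.
by rewrite lerDl sumr_ge0.
Qed.

End Cutoff.

(** * Families of functions bounded or null in all derivatives *)

Section Families.
Context {R : realType} {T : Type} (Phi : set_system T) {FPhi : Filter Phi}.

Section Open.
Context {d : nat} (O : set 'rV[R]_d).
Implicit Types f g p : T -> 'rV[R]_d -> R.

Definition smooth_fam g := \forall k \near Phi, smooth_on O (g k).

Definition bdds s g :=
  exists C : R, \forall k \near Phi, forall v, O v -> `|partial s (g k) v| <= C.

(** The index s is kept apart from [null] because the stability lemmas are proved
    by induction on it. *)
Definition nulls s g := forall e : R, 0 < e ->
  \forall k \near Phi, forall v, O v -> `|partial s (g k) v| <= e.

(** Smoothness is only required eventually: a difference quotient of step h is
    smooth on a given box once h is small enough. *)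
Definition bdd g := smooth_fam g /\ forall s, bdds s g.

Definition null g := smooth_fam g /\ forall s, nulls s g.

Lemma bdds_ge0 s g : bdds s g -> exists2 C : R, 0 <= C &
  \forall k \near Phi, forall v, O v -> `|partial s (g k) v| <= C.
Proof.
move=> [C H]; exists `|C| => //; apply: filterS H => k H v /H.
by move=> /le_trans; apply; exact: ler_norm.
Qed.

Lemma null_bdd g : null g -> bdd g.
Proof. by move=> [sg ng]; split=> // s; exists 1; exact: ng. Qed.

Hypothesis oO : open O.

Definition fam_eq f g := \forall k \near Phi, forall v, O v -> f k v = g k v.

Lemma smooth_fam_eq f g : fam_eq f g -> smooth_fam f -> smooth_fam g.
Proof. by apply: filterS2 => k fg; exact: (smooth_on_eq oO fg). Qed.

Lemma nulls_eq f g s : fam_eq f g -> nulls s f -> nulls s g.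
Proof.
move=> fg nf e e0; apply: filterS2 fg (nf e e0) => k fg {}nf v Ov.
by rewrite -(partial_eq s oO fg Ov); exact: nf.
Qed.

Lemma bdds_eq f g s : fam_eq f g -> bdds s f -> bdds s g.
Proof.
move=> fg [C nf]; exists C; apply: filterS2 fg nf => k fg nf v Ov.
by rewrite -(partial_eq s oO fg Ov); exact: nf.
Qed.

Lemma null_eq f g : fam_eq f g -> null f -> null g.
Proof.
move=> fg [sf nf]; split; first exact: smooth_fam_eq sf.
by move=> s; exact: nulls_eq (nf s).
Qed.

Lemma bdd_eq f g : fam_eq f g -> bdd f -> bdd g.
Proof.
move=> fg [sf nf]; split; first exact: smooth_fam_eq sf.
by move=> s; exact: bdds_eq (nf s).
Qed.

Lemma smooth_fam_derive g j : smooth_fam g ->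
  smooth_fam (fun k => 'D_(delta_mx 0 j) (g k)).
Proof. by apply: filterS => k; exact: smooth_on_partial. Qed.

Lemma bdd_derive g j : bdd g -> bdd (fun k => 'D_(delta_mx 0 j) (g k)).
Proof.
move=> [sg bg]; split; first exact: smooth_fam_derive.
move=> s; have [C H] := bg (rcons s j); exists C; apply: filterS H => k.
by rewrite partial_rcons.
Qed.

Lemma null_derive g j : null g -> null (fun k => 'D_(delta_mx 0 j) (g k)).
Proof.
move=> [sg bg]; split; first exact: smooth_fam_derive.
move=> s e e0; have H := bg (rcons s j) e e0; apply: filterS H => k.
by rewrite partial_rcons.
Qed.

Lemma smooth_famD f g : smooth_fam f -> smooth_fam g ->
  smooth_fam (fun k v => f k v + g k v).
Proof. by apply: filterS2 => k; exact: smooth_onD. Qed.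

Lemma smooth_famM f g : smooth_fam f -> smooth_fam g ->
  smooth_fam (fun k v => f k v * g k v).
Proof. by apply: filterS2 => k; exact: smooth_onM. Qed.

Lemma nullsD f g s : smooth_fam f -> smooth_fam g ->
  nulls s f -> nulls s g -> nulls s (fun k v => f k v + g k v).
Proof.
move=> sf sg nf ng e e0; have e2 : 0 < e / 2 by rewrite divr_gt0.
apply: filterS3 (filterI sf sg) (nf _ e2) (ng _ e2) => k [sfk sgk] Hf Hg v Ov.
rewrite (@partialD _ _ O (f k) (g k) s v oO sfk sgk Ov).
rewrite (le_trans (ler_normD _ _))// [leRHS]splitr lerD//.
  exact: Hf.
exact: Hg.
Qed.

Lemma bddsD f g s : smooth_fam f -> smooth_fam g ->
  bdds s f -> bdds s g -> bdds s (fun k v => f k v + g k v).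
Proof.
move=> sf sg [C nf] [D ng]; exists (C + D).
apply: filterS3 (filterI sf sg) nf ng => k [sfk sgk] Hf Hg v Ov.
rewrite (@partialD _ _ O (f k) (g k) s v oO sfk sgk Ov).
by rewrite (le_trans (ler_normD _ _))// lerD//; [exact: Hf|exact: Hg].
Qed.

Lemma nullD f g : null f -> null g -> null (fun k v => f k v + g k v).
Proof.
move=> [sf nf] [sg ng]; split; first exact: smooth_famD.
by move=> s; exact: nullsD.
Qed.

Lemma bddD f g : bdd f -> bdd g -> bdd (fun k v => f k v + g k v).
Proof.
move=> [sf nf] [sg ng]; split; first exact: smooth_famD.
by move=> s; exact: bddsD.
Qed.

(** Leibniz' rule, in the form that drives the inductions on the order of
    derivation in [bddM] and [nullM]. *)
Lemma fam_derive_mul f g j : smooth_fam f -> smooth_fam g ->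
  fam_eq (fun k v => 'D_(delta_mx 0 j) (f k) v * g k v +
                     f k v * 'D_(delta_mx 0 j) (g k) v)
         (fun k => 'D_(delta_mx 0 j) (fun v => f k v * g k v)).
Proof.
apply: filterS2 => k sf sg v Ov.
have /derive_of -> := is_deriveM (smooth_on_derive j sf Ov)
  (smooth_on_derive j sg Ov).
by rewrite addrC; congr (_ + _); exact: mulrC.
Qed.

Lemma bddM f g : bdd f -> bdd g -> bdd (fun k v => f k v * g k v).
Proof.
move=> bf bg; split; first exact: smooth_famM bf.1 bg.1.
move=> s; elim/last_ind: s f g bf bg => [|s j IH] f g bf bg.
  have [C C0 Hf] := bdds_ge0 (bf.2 [::]); have [D D0 Hg] := bdds_ge0 (bg.2 [::]).
  exists (C * D); apply: filterS2 Hf Hg => k Hf Hg v Ov /=.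
  by rewrite normrM ler_pM//; [exact: Hf|exact: Hg].
have [sf sg] := (bf.1, bg.1).
have bf' := bdd_derive j bf; have bg' := bdd_derive j bg.
have := bdds_eq (fam_derive_mul j sf sg)
  (bddsD (smooth_famM bf'.1 sg) (smooth_famM sf bg'.1) (IH _ _ bf' bg) (IH _ _ bf bg')).
by move=> [C H]; exists C; apply: filterS H => k; rewrite partial_rcons.
Qed.

Lemma nullM f g : bdd f -> null g -> null (fun k v => f k v * g k v).
Proof.
move=> bf ng; split; first exact: smooth_famM bf.1 ng.1.
move=> s; elim/last_ind: s f g bf ng => [|s j IH] f g bf ng.
  move=> e e0; have [C C0 Hf] := bdds_ge0 (bf.2 [::]).
  have C1 : 0 < C + 1 by rewrite ltr_wpDl.
  have Hg : \forall k \near Phi, forall v, O v -> `|g k v| <= e / (C + 1).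
    by apply: (ng.2 [::]); rewrite divr_gt0.
  apply: filterS2 Hf Hg => k Hf Hg v Ov /=.
  rewrite normrM (@le_trans _ _ ((C + 1) * (e / (C + 1))))//; last first.
    by rewrite mulrC divfK// gt_eqF.
  by rewrite ler_pM//; [rewrite (le_trans (Hf v Ov))// lerDl|exact: Hg].
have [sf sg] := (bf.1, ng.1).
have bf' := bdd_derive j bf; have ng' := null_derive j ng.
have H := nulls_eq (fam_derive_mul j sf sg)
  (nullsD (smooth_famM bf'.1 sg) (smooth_famM sf ng'.1) (IH _ _ bf' ng) (IH _ _ bf ng')).
by move=> e e0; have := H e e0; apply: filterS => k; rewrite partial_rcons.
Qed.

Lemma null0 : null (fun=> cst 0).
Proof.
split=> [|s e e0]; first by apply: nearW => k; exact: smooth_on_cst.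
apply: nearW => k v Ov.
have s0 := @smooth_on_cst R d O 0 oO.
have -> : (cst 0 : 'rV[R]_d -> R) = (fun x => 0 * cst 0 x + 0 * cst 0 x).
  by apply/funext => x; rewrite mul0r addr0.
by rewrite (partial_comb 0 0 s oO s0 s0 Ov) !mul0r addr0 normr0 ltW.
Qed.

Lemma nullB f g : null f -> null g -> null (fun k v => f k v - g k v).
Proof.
move=> nf ng; have bN : bdd (fun=> cst (-1)).
  split=> [|s]; first by apply: nearW => k; exact: smooth_on_cst.
  elim/last_ind: s => [|s j _].
    by exists 1; apply: nearW => k v _ /=; rewrite normrN normr1.
  exists 1; have [_ /(_ s 1 ltr01)] := null0; apply: filterS => k H v Ov.
  rewrite partial_rcons (_ : 'D_ _ _ = cst 0); first exact: H.
  by apply/funext => w; exact: derive_cst.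
have := nullD nf (nullM bN ng); apply: null_eq.
by apply: nearW => k v _; rewrite mulN1r.
Qed.

End Open.

Lemma nullW d (O O' : set 'rV[R]_d) g : O' `<=` O -> null O g -> null O' g.
Proof.
move=> OO [sg ng]; split.
  by apply: filterS sg => k; exact: smooth_onW.
by move=> s e e0; apply: filterS (ng s e e0) => k H v /OO; exact: H.
Qed.

Lemma bddW d (O O' : set 'rV[R]_d) g : O' `<=` O -> bdd O g -> bdd O' g.
Proof.
move=> OO [sg ng]; split.
  by apply: filterS sg => k; exact: smooth_onW.
by move=> s; have [C H] := ng s; exists C; apply: filterS H => k H v /OO; exact: H.
Qed.

Lemma bdd_fixed d (O K U : set 'rV[R]_d) g : compact K -> K `<=` U -> O `<=` K ->
  smooth_on U g -> bdd O (fun=> g).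
Proof.
move=> cK KU OK sg; split.
  by apply: nearW => _; apply: smooth_onW sg; exact: subset_trans KU.
move=> s; have [|C _ HC] := @compact_norm_bound _ _ K (partial s g) cK.
  by move=> z Kz; have [] := sg s z (KU _ Kz).
by exists C; apply: nearW => _ v /OK; exact: HC.
Qed.

(** By the chain rule, the j-th derivative of p * (g o A) is the sum of
    (d_j p) * (g o A) and of the (p * d_j A_i) * ((d_i g) o A), again products of
    a bounded and a composed null family. The factor p is there to make the
    induction on the order of derivation go through. *)
Lemma null_mul_comp d e (O : set 'rV[R]_d) (O' : set 'rV[R]_e) A p g :
  open O -> open O' -> (forall x, O x -> O' (A x)) ->
  (forall i, bdd O (fun=> fun x => A x 0 i)) -> bdd O p -> null O' g ->
  null O (fun k x => p k x * g k (A x)).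
Proof.
move=> oO oO' AO bA bp ng.
have [P0|nP0] := pselect (Phi set0).
  by split=> [|s r r0]; apply: filterS P0.
have sA i : smooth_on O (fun x => A x 0 i).
  apply: contrapT => nsA; apply: nP0.
  by apply: filterS (bA i).1 => k /nsA.
have sc q h : smooth_fam O q -> smooth_fam O' h ->
    smooth_fam O (fun k x => q k x * h k (A x)).
  apply: filterS2 => k sq sh.
  exact: (smooth_onM oO sq (smooth_on_comp oO oO' AO sA sh)).
split=> [|s]; first exact: sc bp.1 ng.1.
elim/last_ind: s p g bp ng => [|s j IH] p g bp ng.
  move=> r r0; have [C C0 Hp] := bdds_ge0 (bp.2 [::]).
  have C1 : 0 < C + 1 by rewrite ltr_wpDl.
  have Hg : \forall k \near Phi, forall v, O' v -> `|g k v| <= r / (C + 1).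
    by apply: (ng.2 [::]); rewrite divr_gt0.
  apply: filterS2 Hp Hg => k Hp Hg v Ov /=.
  rewrite normrM (@le_trans _ _ ((C + 1) * (r / (C + 1))))//; last first.
    by rewrite mulrC divfK// gt_eqF.
  by rewrite ler_pM//; [rewrite (le_trans (Hp v Ov))// lerDl|apply: Hg; exact: AO].
have bp' := bdd_derive j bp.
pose q i (k : T) x := p k x * 'D_(delta_mx 0 j) (fun x => A x 0 i) x.
have bq i : bdd O (q i).
  exact: bddM bp (bdd_derive j (bA i)).
pose g' i k := 'D_(delta_mx 0 i) (g k).
have ng' i : null O' (g' i) by exact: null_derive.
have E : fam_eq O (fun k x => 'D_(delta_mx 0 j) (p k) x * g k (A x) +
      \sum_(i <- index_enum 'I_e) q i k x * g' i k (A x))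
    (fun k => 'D_(delta_mx 0 j) (fun x => p k x * g k (A x))).
  apply: filterS2 bp.1 ng.1 => k sp sg x Ox.
  by have /derive_of -> := is_derive_mul_comp oO' AO sA j sp sg Ox.
have sS (r : seq 'I_e) :
    smooth_fam O (fun k x => \sum_(i <- r) q i k x * g' i k (A x)) /\
    nulls O s (fun k x => \sum_(i <- r) q i k x * g' i k (A x)).
  elim: r => [|i r [IH1 IH2]].
    have [s0 n0] := null0 oO; split.
      apply: smooth_fam_eq s0 => //.
      by apply: nearW => k x _; rewrite big_nil.
    apply: nulls_eq (n0 s) => //.
    by apply: nearW => k x _; rewrite big_nil.
  have E' : fam_eq O (fun k x => q i k x * g' i k (A x) +
        \sum_(i <- r) q i k x * g' i k (A x))
      (fun k x => \sum_(i <- i :: r) q i k x * g' i k (A x)).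
    by apply: nearW => k x _; rewrite big_cons.
  have sqi := sc _ _ (bq i).1 (ng' i).1; split.
    exact: (smooth_fam_eq oO E' (smooth_famD oO sqi IH1)).
  exact: (nulls_eq oO E' (nullsD oO sqi IH1 (IH _ _ (bq i) (ng' i)) IH2)).
have [s1 s2] := sS (index_enum 'I_e).
have H := nulls_eq oO E (nullsD oO (sc _ _ bp'.1 ng.1) s1 (IH _ _ bp' ng) s2).
by move=> r r0; have := H r r0; apply: filterS => k; rewrite partial_rcons.
Qed.

Lemma null_comp d e (O : set 'rV[R]_d) (O' : set 'rV[R]_e) A g :
  open O -> open O' -> (forall x, O x -> O' (A x)) ->
  (forall i, bdd O (fun=> fun x => A x 0 i)) -> null O' g ->
  null O (fun k x => g k (A x)).
Proof.
move=> oO oO' AO bA ng.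
suff b1 : bdd O (fun=> cst 1).
  apply: null_eq (null_mul_comp oO oO' AO bA b1 ng) => //.
  by apply: nearW => k x _; rewrite mul1r.
split=> [|s]; first by apply: nearW => k; exact: smooth_on_cst.
elim/last_ind: s => [|s j _].
  by exists 1; apply: nearW => k v _ /=; rewrite normr1.
exists 1; have [_ /(_ s 1 ltr01)] := null0 oO; apply: filterS => k H v Ov.
rewrite partial_rcons (_ : 'D_ _ _ = cst 0); first exact: H.
by apply/funext => w; exact: derive_cst.
Qed.

End Families.

(** * Convergence of Bernstein operators in one variable *)

Section Casteljau.
Context {R : realType}.
Implicit Types (u : R) (phi psi : nat -> R).

(** De Casteljau's recursion for the Bernstein polynomial of degree K, at u, of
    the sequence phi of control values: the expectation of phi under the
    binomial law of parameters K and u. It gives the properties below by plain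
    inductions, without binomial coefficients. *)
Fixpoint casteljau (K : nat) u phi : R :=
  if K is K'.+1 then (1 - u) * casteljau K' u phi + u * casteljau K' u (phi \o S)
  else phi 0%N.

Lemma casteljau_ext K u phi psi : (forall l, (l <= K)%N -> phi l = psi l) ->
  casteljau K u phi = casteljau K u psi.
Proof.
elim: K phi psi => [|K IH] phi psi E /=; first exact: E.
by congr (_ * _ + _ * _); apply: IH => l lK; apply: E => //; exact: leqW.
Qed.

Lemma casteljauD K u phi psi a b :
  casteljau K u (fun l => a * phi l + b * psi l) =
  a * casteljau K u phi + b * casteljau K u psi.
Proof.
elim: K phi psi => [//|K IH] phi psi /=.
by rewrite IH (IH (phi \o S) (psi \o S)); ring.
Qed.

Lemma casteljauZ K u phi a :
  casteljau K u (fun l => a * phi l) = a * casteljau K u phi.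
Proof.
transitivity (casteljau K u (fun l => a * phi l + 0 * phi l)).
  by apply: casteljau_ext => l _; rewrite mul0r addr0.
by rewrite casteljauD mul0r addr0.
Qed.

Lemma casteljau_cst K u a : casteljau K u (fun=> a) = a.
Proof. by elim: K => [//|K IH] /=; rewrite [_ \o _](_ : _ = fun=> a)// IH; ring. Qed.

Lemma casteljau_le K u phi psi : 0 <= u <= 1 ->
  (forall l, (l <= K)%N -> phi l <= psi l) ->
  casteljau K u phi <= casteljau K u psi.
Proof.
move=> /andP[u0 u1]; elim: K phi psi => [|K IH] phi psi le /=; first exact: le.
apply: lerD; apply: ler_wpM2l; rewrite ?subr_ge0//; apply: IH => l lK; apply: le => //.
exact: leqW.
Qed.

Lemma casteljau_norm K u phi : 0 <= u <= 1 ->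
  `|casteljau K u phi| <= casteljau K u (fun l => `|phi l|).
Proof.
move=> u01; rewrite ler_norml -mulN1r; apply/andP; split.
  rewrite -casteljauZ; apply: casteljau_le => // l _; rewrite mulN1r lerNl.
  by rewrite -normrN ler_norm.
by apply: casteljau_le => // l _; exact: ler_norm.
Qed.

(** The second moment of the binomial law about an arbitrary point: bias squared
    plus variance. *)
Lemma casteljau_sqr K u h c :
  casteljau K u (fun l => (l%:R * h - c) ^+ 2) =
  (K%:R * u * h - c) ^+ 2 + h ^+ 2 * (K%:R * u * (1 - u)).
Proof.
elim: K c => [|K IH] c /=; first by ring.
rewrite IH (@casteljau_ext K u _ (fun l => (l%:R * h - (c - h)) ^+ 2)).
  by rewrite IH -natr1; ring.
by move=> l _ /=; rewrite -natr1; congr (_ ^+ 2); ring.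
Qed.

Lemma casteljau_sum K u phi :
  casteljau K u phi =
  \sum_(t < K.+1) phi t * casteljau K u (fun l => (l == t)%:R).
Proof.
have H (r : seq nat) : casteljau K u (fun l => \sum_(t <- r) phi t * (l == t)%:R) =
    \sum_(t <- r) phi t * casteljau K u (fun l => (l == t)%:R).
  elim: r => [|t r IH].
    rewrite big_nil -[RHS](casteljau_cst K u 0); apply: casteljau_ext => l _.
    by rewrite big_nil.
  rewrite big_cons -IH -[X in _ + X]mul1r -casteljauD.
  by apply: casteljau_ext => l _; rewrite big_cons mul1r.
rewrite -(big_mkord xpredT (fun t => phi t * casteljau K u (fun l => (l == t)%:R))).
rewrite -H; apply: casteljau_ext => l lK.
rewrite (bigD1_seq l) ?iota_uniq ?mem_index_iota ?ltnS//= eqxx mulr1.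
by rewrite big1 ?addr0// => t tl; rewrite eq_sym (negPf tl) mulr0.
Qed.

(** The derivative in u of a Bernstein polynomial is, up to the factor K, the
    Bernstein polynomial of degree K - 1 of the forward differences. *)
Lemma is_derive_casteljau d K (u : 'rV[R]_d -> R) (G : nat -> 'rV[R]_d -> R) x v
    u' (G' : nat -> R) :
  is_derive x v u u' ->
  (forall l, (l <= K)%N -> is_derive x v (G l) (G' l)) ->
  is_derive x v (fun y => casteljau K (u y) (fun l => G l y))
    (casteljau K (u x) G' +
     u' * (K%:R * casteljau K.-1 (u x) (fun l => G l.+1 x - G l x))).
Proof.
move=> du; elim: K G G' => [|K IH] G G' dG.
  by apply: is_derive_congr (dG 0%N _) _ => //=; rewrite mul0r mulr0 addr0.
have d1 := IH G G' (fun l lK => dG l (leqW lK)).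
have d2 := IH (fun l => G l.+1) (fun l => G' l.+1) (fun l lK => dG l.+1 lK).
have dc : is_derive x v (cst 1 : 'rV[R]_d -> R) 0 by exact: is_derive_cst.
have := is_deriveD (is_deriveM (is_deriveB dc du) d1) (is_deriveM du d2).
move=> /is_derive_congr; apply; rewrite /=.
set a := casteljau K (u x) _; set b := casteljau K (u x) _.
set a1 := casteljau K (u x) _; set b1 := casteljau K.-1 (u x) _.
set c := casteljau K (u x) _; set b2 := casteljau K.-1 (u x) _.
set t := casteljau K (u x) (fun l => G l.+1 x - G l x).
rewrite /GRing.scale /= !fctE.
have tE : t = c - b.
  rewrite -[X in X - _]mul1r -mulN1r -casteljauD.
  by apply: casteljau_ext => l _; rewrite mul1r mulN1r.
case: K @a @b @a1 @b1 @c @b2 @t tE {IH dG d1 d2} => [|K] a b a1 b1 c b2 t tE /=.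
  by rewrite tE; ring.
have t2 : t = (1 - u x) * b1 + u x * b2 by [].
have -> : K.+2%:R * t = K.+1%:R * ((1 - u x) * b1 + u x * b2) + (c - b) :> R.
  by rewrite -t2 -tE -[in LHS]natr1 mulrDl mul1r.
by ring.
Qed.

End Casteljau.

Section Bernstein.
Context {R : realType} {d : nat}.
Implicit Types (g : 'rV[R]_d -> R) (v : 'rV[R]_d) (lo len h r : R).

(** The Bernstein operator in the i-th variable on [lo, lo + len], with nodes
    lo + l h. The step h is independent of K because derivation lowers K but
    keeps the nodes: h need only be asymptotic to len / K. *)
Definition bern i lo len (K : nat) h g v : R :=
  casteljau K ((v 0 i - lo) / len) (fun l => g (upd v i (lo + l%:R * h))).

Lemma upd_derive g i j t v : j != i ->
  'D_(delta_mx 0 j) (fun y => g (upd y i t)) v =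
    'D_(delta_mx 0 j) g (upd v i t) /\
  (derivable g (upd v i t) (delta_mx 0 j) ->
   derivable (fun y => g (upd y i t)) v (delta_mx 0 j)).
Proof.
move=> ji; apply: (@derive_affine _ _ _ (fun y => upd y i t) g) => a.
apply/rowP => l; rewrite updE [in RHS]mxE [X in _ = _ + X]updE !mxE eqxx/=.
case: eqP => [->|//].
by rewrite eq_sym (negPf ji) mulr0 add0r.
Qed.

Lemma upd_derive0 g i t v :
  is_derive v (delta_mx 0 i) (fun y => g (upd y i t)) 0.
Proof.
have [|E D] := @derive_affine R d d (fun y => upd y i t) g v (delta_mx 0 i) 0.
  move=> a; rewrite scaler0 add0r; apply/rowP => l; rewrite !updE !mxE eqxx/=.
  by case: eqP => // _; rewrite mulr0 add0r.
by split; [apply: D; exact: derivable0|rewrite E derive0].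
Qed.

Lemma is_derive_coordinate i lo len j v :
  is_derive v (delta_mx 0 j) (fun y : 'rV[R]_d => (y 0 i - lo) / len)
    ((j == i)%:R / len).
Proof.
apply: is_derive_cvg.
apply: (@cvg_trans _ (((fun=> (j == i)%:R / len) : R -> R) @ 0^')); last first.
  exact: cvg_cst.
apply: near_eq_cvg; near=> h.
have h0 : h != 0 by near: h; exact: nbhs_dnbhs_neq.
have -> : ((h *: delta_mx 0 j + v) 0 i - lo) / len - (v 0 i - lo) / len =
    h * ((j == i)%:R / len).
  by rewrite !mxE eqxx /= [i == j]eq_sym; ring.
by rewrite -[_ *: _]/(h^-1 * _) mulKf.
Unshelve. all: by end_near. Qed.

Lemma bern_derive_other i lo len K h g v j (O : set 'rV[R]_d) :
  smooth_on O g -> j != i ->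
  (forall l, (l <= K)%N -> O (upd v i (lo + l%:R * h))) ->
  is_derive v (delta_mx 0 j) (bern i lo len K h g)
    (bern i lo len K h ('D_(delta_mx 0 j) g) v).
Proof.
move=> sg ji nodes.
have dG l : (l <= K)%N -> is_derive v (delta_mx 0 j)
    (fun y => g (upd y i (lo + l%:R * h)))
    ('D_(delta_mx 0 j) g (upd v i (lo + l%:R * h))).
  move=> /nodes Ol; have [E D] := upd_derive g (lo + l%:R * h) v ji.
  split; last exact: E.
  by apply: D; exact: smooth_on_derivable sg Ol.
have := is_derive_casteljau (is_derive_coordinate i lo len j v) dG.
by move=> /is_derive_congr; apply; rewrite (negPf ji) mul0r mul0r addr0.
Qed.

Definition dquot i (a h : R) g v : R := a * (g (h *: delta_mx 0 i + v) - g v).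

(** The derivative along i is a Bernstein operator with one node less, applied
    to a difference quotient of g; it has the same form as [bern], which allows
    an induction on the order of derivation. *)
Lemma bern_derive_self i lo len K h g v :
  is_derive v (delta_mx 0 i) (bern i lo len K h g)
    (bern i lo len K.-1 h (dquot i (K%:R / len) h g) v).
Proof.
have dG l : (l <= K)%N -> is_derive v (delta_mx 0 i)
    (fun y => g (upd y i (lo + l%:R * h))) 0.
  by move=> _; exact: upd_derive0.
have := is_derive_casteljau (is_derive_coordinate i lo len i v) dG.
move=> /is_derive_congr; apply; rewrite casteljau_cst add0r eqxx mul1r.
set u := _ / len.
rewrite mulrA [_^-1 * _]mulrC -casteljauZ.
rewrite /bern -/u; apply: casteljau_ext => l _; rewrite /dquot.
rewrite upd_shift (_ : lo + l.+1%:R * h = h + (lo + l%:R * h))//.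
by rewrite -natr1; ring.
Qed.

Lemma upd_lipschitz g v i lo hi (C a b : R) : lo <= a <= hi -> lo <= b <= hi ->
  (forall t, lo <= t <= hi -> derivable g (upd v i t) (delta_mx 0 i) /\
     `|'D_(delta_mx 0 i) g (upd v i t)| <= C) ->
  `|g (upd v i b) - g (upd v i a)| <= C * `|b - a|.
Proof.
wlog ab : a b / a <= b => [H|].
  have [/H//|/ltW ba] := leP a b => la lb Hg.
  by rewrite distrC [`|b - a|]distrC; exact: H.
move=> /andP[la ah] /andP[lb bh] Hg.
have [t /andP[ta tb]|c /andP[ac cb] ->] := upd_mvt_le (g := g) (v := v) (i := i) ab.
  by apply: (Hg t _).1; rewrite (le_trans la ta) (le_trans tb bh).
rewrite normrM mulrC ler_wpM2r//.
by apply: (Hg c _).2; rewrite (le_trans la ac) (le_trans cb bh).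
Qed.

(** Chebyshev's inequality: |g (node l) - g v| is at most C |x|, where x is the
    difference between the node and v_i, and |x| <= delta + x ^ 2 / delta, whose expectation is
    given by [casteljau_sqr]. *)
Lemma bern_estimate i lo len K h g v (C delta : R) :
  0 < len -> 0 <= h -> K%:R * h <= len -> 0 < delta -> 0 <= C ->
  lo <= v 0 i <= lo + len ->
  (forall t, lo <= t <= lo + len -> derivable g (upd v i t) (delta_mx 0 i) /\
     `|'D_(delta_mx 0 i) g (upd v i t)| <= C) ->
  `|bern i lo len K h g v - g v| <=
    C * (delta + ((K%:R * h - len) ^+ 2 + h * (K%:R * h)) / delta).
Proof.
move=> len0 h0 Kh delta0 C0 vi Hg; have /andP[lv vl] := vi.
set u := (v 0 i - lo) / len.
have u01 : 0 <= u <= 1.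
  rewrite /u divr_ge0 ?subr_ge0 ?(ltW len0)//=.
  by rewrite ler_pdivrMr// mul1r lerBlDl.
have uE : len * u = v 0 i - lo by rewrite mulrC divfK// gt_eqF.
have node l : (l <= K)%N -> lo <= lo + l%:R * h <= lo + len.
  move=> lK; rewrite lerDl mulr_ge0//= lerD2l (le_trans _ Kh)//.
  by rewrite ler_wpM2r// ler_nat.
have -> : bern i lo len K h g v - g v =
    casteljau K u (fun l => 1 * g (upd v i (lo + l%:R * h)) + -1 * g v).
  by rewrite (casteljauD K u _ (fun=> g v)) casteljau_cst mul1r mulN1r.
apply: le_trans (casteljau_norm K _ u01) _.
apply: (@le_trans _ _ (casteljau K u (fun l =>
    (C / delta) * (l%:R * h - len * u) ^+ 2 + (C * delta) * 1))).
  apply: casteljau_le => // l lK; rewrite mul1r mulN1r.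
  have L := upd_lipschitz vi (node l lK) Hg.
  rewrite upd_id in L; apply: le_trans L _.
  have -> : lo + l%:R * h - v 0 i = l%:R * h - len * u by rewrite uE; ring.
  set x := _ - _; rewrite mulr1.
  have -> : C / delta * x ^+ 2 + C * delta = C * (delta + `|x| ^+ 2 / delta).
    by rewrite real_normK ?num_real//; ring.
  rewrite ler_wpM2l//; have [xd|/ltW xd] := leP `|x| delta.
    by rewrite (le_trans xd)// lerDl divr_ge0 ?sqr_ge0// ltW.
  by rewrite ler_wpDl ?(ltW delta0)// ler_pdivlMr// expr2 ler_wpM2l.
rewrite casteljauD (casteljau_cst K u 1) casteljau_sqr mulr1.
have -> : C / delta * ((K%:R * u * h - len * u) ^+ 2 + h ^+ 2 * (K%:R * u * (1 - u)))
    + C * delta = C * (delta + (u ^+ 2 * (K%:R * h - len) ^+ 2 +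
      (u * (1 - u)) * (h * (K%:R * h))) / delta) by ring.
have /andP[u0 u1] := u01.
rewrite ler_wpM2l// lerD2l ler_wpM2r ?invr_ge0 ?(ltW delta0)// lerD//.
  by rewrite ler_piMl ?sqr_ge0// expr_le1.
rewrite ler_piMl ?mulr_ge0//.
by rewrite mulr_ile1// ?subr_ge0// lerBlDr lerDl.
Qed.

Lemma smooth_on_casteljau (O : set 'rV[R]_d) K (u : 'rV[R]_d -> R) G :
  open O -> smooth_on O u -> (forall l, (l <= K)%N -> smooth_on O (G l)) ->
  smooth_on O (fun y => casteljau K (u y) (fun l => G l y)).
Proof.
move=> oO su; elim: K G => [|K IH] G sG; first exact: (sG 0%N).
have s1 := IH G (fun l lK => sG l (leqW lK)).
have s2 := IH (fun l => G l.+1) (fun l lK => sG l.+1 lK).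
have s3 := smooth_onB oO (smooth_on_cst 1 oO) su.
exact: (smooth_onD oO (smooth_onM oO s3 s1) (smooth_onM oO su s2)).
Qed.

Lemma smooth_on_affine_coord (O : set 'rV[R]_d) i lo len : open O ->
  smooth_on O (fun y : 'rV[R]_d => (y 0 i - lo) / len).
Proof.
move=> oO.
exact: (smooth_onM oO (smooth_onB oO (smooth_on_coord i oO) (smooth_on_cst lo oO))
  (smooth_on_cst len^-1 oO)).
Qed.

Lemma smooth_on_upd (O O' : set 'rV[R]_d) i t g : open O -> open O' ->
  (forall v, O v -> O' (upd v i t)) -> smooth_on O' g ->
  smooth_on O (fun v => g (upd v i t)).
Proof.
move=> oO oO' OO' sg; apply: (smooth_on_comp oO oO' OO' _ sg) => l.
have [->|li] := eqVneq l i.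
  apply: smooth_on_eq (smooth_on_cst t oO) => // y _.
  by rewrite updE eqxx.
apply: smooth_on_eq (smooth_on_coord l oO) => // y _.
by rewrite updE (negPf li).
Qed.

Lemma smooth_on_bern (O : set 'rV[R]_d) i lo len K h g : open O ->
  (forall v l, O v -> (l <= K)%N -> O (upd v i (lo + l%:R * h))) ->
  smooth_on O g -> smooth_on O (bern i lo len K h g).
Proof.
move=> oO nodes sg.
have sG l : (l <= K)%N -> smooth_on O (fun v => g (upd v i (lo + l%:R * h))).
  by move=> lK; apply: (smooth_on_upd oO oO _ sg) => v Ov; exact: nodes.
exact: (smooth_on_casteljau oO (smooth_on_affine_coord i lo len oO) sG).
Qed.

End Bernstein.

Section BernsteinConvergence.
Context {R : realType} {T : Type} (Phi : set_system T) {FPhi : Filter Phi}.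
Context {d : nat}.
Implicit Types (c v w : 'rV[R]_d) (rho : 'I_d -> R) (g : T -> 'rV[R]_d -> R).

Lemma cvg_near_lt (f : T -> R) (l e : R) : f @ Phi --> l -> 0 < e ->
  \forall k \near Phi, `|l - f k| < e.
Proof. by move=> /cvgrPdist_lt H e0; exact: H. Qed.

Definition setc rho i (r : R) (j : 'I_d) := if j == i then r else rho j.

Lemma box_setc c rho i r : r <= rho i -> box c (setc rho i r) `<=` box c rho.
Proof.
move=> ri v vb j; have := vb j; rewrite /setc; case: eqP => // -> vr.
exact: lt_le_trans vr ri.
Qed.

Lemma upd_setc c rho i r (t : R) v : box c (setc rho i r) v ->
  `|t - c 0 i| < rho i -> box c rho (upd v i t).
Proof.
move=> vb ti j; rewrite updE; case: eqP => [->//|ji].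
by have := vb j; rewrite /setc; case: eqP.
Qed.

Lemma upd_add v i (h : R) : upd v i (v 0 i + h) = h *: delta_mx 0 i + v.
Proof. by rewrite /upd [v 0 i + _]addrC addrK addrC. Qed.

Lemma partial_translate w s (f : 'rV[R]_d -> R) v :
  partial s (fun y => f (w + y)) v = partial s f (w + v).
Proof.
elim: s v => [//|j s IH] v /=; rewrite (funext IH).
have [|-> _//] := @derive_affine R d d (fun y => w + y) (partial s f) v
  (delta_mx 0 j) (delta_mx 0 j).
by move=> h; rewrite addrCA.
Qed.

Lemma smooth_on_translate (O O' : set 'rV[R]_d) w f : open O -> open O' ->
  (forall v, O v -> O' (w + v)) -> smooth_on O' f ->
  smooth_on O (fun v => f (w + v)).
Proof.
move=> oO oO' OO' sf; apply: (smooth_on_comp oO oO' OO' _ sf) => l.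
apply: smooth_on_eq oO _ (smooth_onD oO (smooth_on_cst (w 0 l) oO)
  (smooth_on_coord l oO)) => y _.
by rewrite mxE.
Qed.

(** By the mean value theorem and the commutation of partial derivatives, each
    derivative of the difference quotient is a * h, which tends to 1, times a
    derivative along i at a point at distance at most h; bounds on one more
    derivative along i conclude. The box shrinks in the
    i-th direction to leave room for the step. *)
Lemma dquot_null c rho i r (a h : T -> R) g : r < rho i ->
  (\forall k \near Phi, 0 <= h k) -> h @ Phi --> (0 : R) ->
  (fun k => a k * h k) @ Phi --> (1 : R) ->
  bdd Phi (box c rho) g ->
  null Phi (box c (setc rho i r))
    (fun k v => dquot i (a k) (h k) (g k) v - 'D_(delta_mx 0 i) (g k) v).
Proof.
move=> rrho h0 hcvg ahcvg bg.
set O := box c rho; set O' := box c (setc rho i r).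
have oO : open O by exact: box_open.
have oO' : open O' by exact: box_open.
have O1O : O' `<=` O by apply: box_setc; exact: ltW.
have hsmall (e : R) : 0 < e -> \forall k \near Phi, 0 <= h k /\ h k < e.
  move=> e0; have := cvg_near_lt hcvg e0; apply: filterS2 h0 => k h0.
  by rewrite sub0r normrN ger0_norm.
have rr0 : 0 < rho i - r by rewrite subr_gt0.
have Oseg k v (t : R) : 0 <= h k /\ h k < rho i - r -> O' v ->
    v 0 i <= t <= v 0 i + h k -> O (upd v i t).
  move=> [hk0 hk] Ov1 /andP[vt tv]; apply: (upd_setc Ov1).
  have := Ov1 i; rewrite /setc eqxx !ltr_norml => /andP[? ?].
  by apply/andP; split; lra.
have O1tr k v : 0 <= h k /\ h k < rho i - r -> O' v ->
    O (h k *: delta_mx 0 i + v).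
  move=> hk Ov1; rewrite -upd_add.
  by apply: (Oseg k v) => //; rewrite lexx lerDl; case: hk => ->.
have dqE k : dquot i (a k) (h k) (g k) =
    (fun v => a k * g k (h k *: delta_mx 0 i + v) + - a k * g k v).
  by apply/funext => v; rewrite /dquot mulrBr mulNr.
have str k : 0 <= h k /\ h k < rho i - r -> smooth_on O (g k) ->
    smooth_on O' (fun v => g k (h k *: delta_mx 0 i + v)).
  by move=> hk; apply: smooth_on_translate => // v; exact: O1tr.
have sdq k : 0 <= h k /\ h k < rho i - r -> smooth_on O (g k) ->
    smooth_on O' (dquot i (a k) (h k) (g k)).
  move=> hk sg; rewrite dqE.
  exact: (smooth_on_comb _ _ oO' (str k hk sg) (smooth_onW O1O sg)).
split.
  apply: filterS2 (hsmall _ rr0) bg.1 => k hk sg.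
  exact: (smooth_onB oO' (sdq k hk sg) (smooth_onW O1O (smooth_on_partial i sg))).
move=> s e e0.
have [C1 C10 H1] := bdds_ge0 (bg.2 (i :: s)).
have [C2 C20 H2] := bdds_ge0 (bg.2 (i :: i :: s)).
have C1p : 0 < C1 + 1 by rewrite ltr_wpDl.
have C2p : 0 < C2 + 1 by rewrite ltr_wpDl.
have e1 : 0 < e / 2 / (C1 + 1) by rewrite !divr_gt0.
have e2 : 0 < e / 2 / (C2 + 1) by rewrite !divr_gt0.
have ah1 := cvg_near_lt ahcvg e1.
apply: filterS3 (filterI bg.1 (filterI H1 H2)) ah1
  (filterI (hsmall _ rr0) (hsmall _ e2)) =>
  k [sg [{}H1 {}H2]] {}ah1 [hk [hk0 hke]] v Ov1.
have Ov := O1O _ Ov1.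
have sq : smooth_on O (partial s (g k)).
  by move=> t; have := sg (t ++ s); rewrite /partial foldr_cat.
rewrite (@partialB _ _ O' _ _ s v oO' (sdq k hk sg)
  (smooth_onW O1O (smooth_on_partial i sg)) Ov1).
rewrite (partial_derive s i oO sg Ov) dqE.
rewrite (partial_comb (a k) (- a k) s oO' (str k hk sg) (smooth_onW O1O sg) Ov1).
rewrite partial_translate mulNr -mulrBr.
rewrite -upd_add.
have vh : v 0 i <= v 0 i + h k by rewrite lerDl.
have [t /(Oseg k v t hk Ov1) Ot|x vx E] := upd_mvt_le (g := partial s (g k))
    (v := v) (i := i) vh.
  exact: smooth_on_derivable sq Ot.
rewrite upd_id in E; rewrite E [v 0 i + _]addrC addrK.
have vv : v 0 i <= v 0 i <= v 0 i + h k by rewrite lexx.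
have Hseg t : v 0 i <= t <= v 0 i + h k ->
    derivable ('D_(delta_mx 0 i) (partial s (g k))) (upd v i t) (delta_mx 0 i) /\
    `|'D_(delta_mx 0 i) ('D_(delta_mx 0 i) (partial s (g k))) (upd v i t)| <= C2.
  move=> /(Oseg k v t hk Ov1) Ot; split; last exact: (H2 _ Ot).
  exact: smooth_on_derivable (smooth_on_partial i sq) Ot.
have Lip := upd_lipschitz vv vx Hseg.
rewrite upd_id in Lip.
have D1 := H1 _ (Oseg k v x hk Ov1 vx).
rewrite /= in D1.
move: D1 Lip; set A := 'D_ _ _ _; set B := 'D_ _ _ _ => D1 Lip.
have -> : a k * (h k * A) - B = (A - B) - (1 - a k * h k) * A by ring.
rewrite (le_trans (ler_normB _ _))// [leRHS]splitr lerD//.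
  apply: le_trans Lip _; move: vx => /andP[vx xh].
  rewrite ger0_norm ?subr_ge0//.
  apply: (@le_trans _ _ ((C2 + 1) * (e / 2 / (C2 + 1)))).
    apply: ler_pM; rewrite ?subr_ge0// ?lerDl// lerBlDl.
    by rewrite (le_trans xh)// lerD2l ltW.
  by rewrite mulrC divfK// gt_eqF.
rewrite normrM; apply: (@le_trans _ _ ((e / 2 / (C1 + 1)) * (C1 + 1))).
  by apply: ler_pM => //; [exact: ltW|rewrite (le_trans D1)// lerDl].
by rewrite divfK// gt_eqF.
Qed.

(** The regime in which the operators [bern] converge: nodes inside the interval,
    step tending to 0, and K steps asymptotically filling it. *)
Definition mesh (K : T -> nat) (h : T -> R) len :=
  [/\ \forall k \near Phi, 0 <= h k, \forall k \near Phi, (K k)%:R * h k <= len,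
      h @ Phi --> (0 : R) & (fun k => (K k)%:R * h k) @ Phi --> len].

Lemma mesh_pred K h len : 0 < len -> mesh K h len ->
  (\forall k \near Phi, (0 < K k)%N) /\ mesh (fun k => (K k).-1) h len.
Proof.
move=> len0 [h0 Kh hcvg Khcvg].
have K0 : \forall k \near Phi, (0 < K k)%N.
  have := cvg_near_lt Khcvg len0; apply: filterS => k.
  by case: (K k) => [|//]; rewrite mul0r subr0 gtr0_norm// ltxx.
split=> //; split=> //.
  apply: filterS3 K0 h0 Kh => k K0 h0; apply: le_trans.
  by rewrite ler_wpM2r// ler_nat leq_pred.
have : (fun k => (K k)%:R * h k - h k) @ Phi --> len - 0 by exact: cvgB.
rewrite subr0; apply: cvg_trans; apply: near_eq_cvg.
apply: filterS K0 => k; case: (K k) => [//|n _] /=.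
by rewrite -[n.+1%:R]natr1 mulrDl mul1r addrK.
Qed.

Lemma bern_box c rho i r K h (O := box c rho) : 0 <= r -> r < rho i -> 0 <= h ->
  K%:R * h <= 2 * r -> forall v l, O v -> (l <= K)%N ->
  O (upd v i (c 0 i - r + l%:R * h)).
Proof.
move=> r0 rrho h0 Kh v l Ov lK j; rewrite updE; case: eqP => [->|_]; last exact: Ov.
have l0 : 0 <= l%:R * h by rewrite mulr_ge0.
have lh : l%:R * h <= 2 * r by rewrite (le_trans _ Kh)// ler_wpM2r// ler_nat.
by rewrite ltr_norml; apply/andP; split; lra.
Qed.

(** Induction on the order of derivation. At order 0 this is [bern_estimate]. A
    derivative along j <> i commutes with the operator. A derivative along i
    gives the operator with one node less on the difference quotients dq of g,
    which form a bounded family close to d_i g by [dquot_null], so that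
    bern dq - d_i g = (bern dq - dq) + (dq - d_i g) is null. *)
Lemma bern_null c rho i r K h g : 0 < r -> r < rho i ->
  mesh K h (2 * r) -> bdd Phi (box c rho) g ->
  null Phi (box c (setc rho i r))
    (fun k v => bern i (c 0 i - r) (2 * r) (K k) (h k) (g k) v - g k v).
Proof.
move=> r0 rrho mKh bg.
have len0 : 0 < 2 * r by rewrite mulr_gt0.
have sbern rho' K' (g' : T -> _) : r < rho' i -> mesh K' h (2 * r) ->
    bdd Phi (box c rho') g' ->
    smooth_fam Phi (box c rho')
      (fun k => bern i (c 0 i - r) (2 * r) (K' k) (h k) (g' k)).
  move=> rrho' [h0 Kh _ _] bg'.
  apply: filterS3 h0 Kh bg'.1 => k h0 Kh sg.
  by apply: smooth_on_bern sg; [exact: box_open|apply: bern_box => //; exact: ltW].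
have sdiff rho' K' (g' : T -> _) : r < rho' i -> mesh K' h (2 * r) ->
    bdd Phi (box c rho') g' ->
    smooth_fam Phi (box c (setc rho' i r))
      (fun k v => bern i (c 0 i - r) (2 * r) (K' k) (h k) (g' k) v - g' k v).
  move=> rrho' mK' bg'; have := sbern _ _ _ rrho' mK' bg'.
  apply: filterS2 bg'.1 => k sg sb.
  have sub : box c (setc rho' i r) `<=` box c rho' by apply: box_setc; exact: ltW.
  exact: (smooth_onB (box_open c (setc rho' i r)) (smooth_onW sub sb) (smooth_onW sub sg)).
split; first exact: sdiff.
move=> s; elim/last_ind: s rho K g rrho mKh bg => [|s j IH] rho K g rrho mKh bg.
  move=> e e0.
  have [C C0 HC] := bdds_ge0 (bg.2 [:: i]).
  have C1 : 0 < C + 1 by rewrite ltr_wpDl.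
  (* Both terms of the estimate are at most C * del, once the mesh error is at most
     del ^ 2. *)
  pose del := e / (2 * (C + 1)).
  have del0 : 0 < del by rewrite divr_gt0// mulr_gt0.
  have [h0 Kh hcvg Khcvg] := mKh.
  have Ecvg : (fun k => ((K k)%:R * h k - 2 * r) ^+ 2 + h k * ((K k)%:R * h k))
      @ Phi --> (2 * r - 2 * r) * (2 * r - 2 * r) + 0 * (2 * r).
    apply: cvgD; last exact: cvgM.
    have H : (fun k => (K k)%:R * h k - 2 * r) @ Phi --> 2 * r - 2 * r.
      by apply: cvgB => //; exact: cvg_cst.
    exact: (cvgM H H).
  rewrite subrr !mul0r addr0 in Ecvg.
  have d2 : 0 < del ^+ 2 by rewrite exprn_gt0.
  have Esmall := cvg_near_lt Ecvg d2.
  apply: filterS3 (filterI bg.1 HC) (filterI h0 Kh) Esmall =>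
    k [sg {}HC] [{}h0 {}Kh] {}Esmall v vb.
  have vi := vb i; rewrite /setc eqxx in vi.
  have vi' : c 0 i - r <= v 0 i <= c 0 i - r + 2 * r.
    by move: vi; rewrite ltr_norml => /andP[? ?]; apply/andP; split; lra.
  apply: le_trans (bern_estimate (C := C) len0 h0 Kh del0 C0 vi' _) _.
    move=> t /andP[ct tc]; have Ot : box c rho (upd v i t).
      apply: upd_setc vb _; rewrite (le_lt_trans _ rrho)// ler_norml.
      by apply/andP; split; lra.
    by split; [exact: smooth_on_derivable sg Ot|exact: (HC _ Ot)].
  apply: (@le_trans _ _ (C * (del + del))).
    rewrite ler_wpM2l// lerD2l ler_pdivrMr// -expr2.
    by rewrite sub0r normrN in Esmall; exact: le_trans (ler_norm _) (ltW Esmall).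
  have -> : e = (C + 1) * (del + del).
    rewrite /del; field; rewrite gt_eqF//.
  by rewrite ler_wpM2r ?addr_ge0 ?(ltW del0)// lerDl.
have [h0 Kh hcvg Khcvg] := mKh.
have sub : box c (setc rho i r) `<=` box c rho by apply: box_setc; exact: ltW.
suff H : nulls Phi (box c (setc rho i r)) s (fun k => 'D_(delta_mx 0 j) (fun v =>
    bern i (c 0 i - r) (2 * r) (K k) (h k) (g k) v - g k v)).
  by move=> e e0; have := H e e0; apply: filterS => k; rewrite partial_rcons.
have oB := box_open c (setc rho i r).
have bg' : bdd Phi (box c rho) (fun k => 'D_(delta_mx 0 j) (g k)).
  exact: bdd_derive.
have [ji|ji] := eqVneq j i; last first.
  refine (nulls_eq oB _ (IH rho K _ rrho mKh bg')).
  apply: filterS3 h0 Kh bg.1 => k h0 Kh sg v vb.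
  have Ov := sub _ vb.
  have d1 := @bern_derive_other R d i (c 0 i - r) (2 * r) (K k) (h k) (g k) v j
    _ sg ji (fun l => bern_box (ltW r0) rrho h0 Kh Ov).
  exact/esym/(derive_of (is_deriveB d1 (smooth_on_derive j sg Ov))).
subst j.
have [K0 mK'] := mesh_pred len0 mKh.
(* The difference quotients are only defined on a box smaller than that of g, but
   still larger than the one where convergence is claimed. *)
pose r' := (r + rho i) / 2.
have rr' : r < r' by rewrite /r'; lra.
have r'rho : r' < rho i by rewrite /r'; lra.
pose a k : R := (K k)%:R / (2 * r).
have ah : (fun k => a k * h k) @ Phi --> (1 : R).
  have : (fun k => (2 * r)^-1 * ((K k)%:R * h k)) @ Phi --> (2 * r)^-1 * (2 * r).
    by apply: cvgM => //; exact: cvg_cst.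
  rewrite mulVf ?gt_eqF//; apply: cvg_trans; apply: near_eq_cvg.
  by apply: nearW => k; rewrite /a; ring.
have ndq := dquot_null r'rho h0 hcvg ah bg.
pose dq k := dquot i (a k) (h k) (g k).
have oB' := box_open c (setc rho i r').
have sub' : box c (setc rho i r') `<=` box c rho by apply: box_setc; exact: ltW.
have bdq : bdd Phi (box c (setc rho i r')) dq.
  refine (bdd_eq oB' _ (bddD oB' (null_bdd ndq) (bddW sub' bg'))).
  by apply: nearW => k v _; rewrite subrK.
have rrho'' : r < setc rho i r' i by rewrite /setc eqxx.
have setcE : setc (setc rho i r') i r = setc rho i r.
  by apply/funext => l; rewrite /setc; case: eqP.
have n1 := IH _ _ _ rrho'' mK' bdq; rewrite setcE in n1.
have s1 := sdiff _ _ _ rrho'' mK' bdq; rewrite setcE in s1.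
have sub'' : box c (setc rho i r) `<=` box c (setc rho i r').
  by rewrite -setcE; apply: box_setc; exact: ltW.
have n2 : null Phi (box c (setc rho i r))
    (fun k v => dq k v - 'D_(delta_mx 0 i) (g k) v) by exact: nullW ndq.
refine (nulls_eq oB _ (nullsD oB s1 n2.1 n1 (n2.2 s))).
apply: filterS bg.1 => k sg v vb; rewrite addrA subrK.
have d1 := bern_derive_self i (c 0 i - r) (2 * r) (K k) (h k) (g k) v.
exact/esym/(derive_of (is_deriveB d1 (smooth_on_derive i sg (sub _ vb)))).
Qed.

End BernsteinConvergence.

(** * Bernstein operators in several variables *)

Section IteratedBernstein.
Context {R : realType}.

Section Def.
Context {d : nat} (c : 'rV[R]_d) (rho : 'I_d -> R).
Implicit Types (L : seq 'I_d) (g : 'rV[R]_d -> R) (w : 'rV[R]_d).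

Definition bern_seq L (k : nat) g : 'rV[R]_d -> R :=
  foldr (fun i => bern i (c 0 i - rho i / 2) (2 * (rho i / 2)) k
    (2 * (rho i / 2) / k%:R)) g L.

Definition half_on L (j : 'I_d) := if j \in L then rho j / 2 else rho j.

Lemma mesh_uniform (T : Type) (Phi : set_system T) {FPhi : Filter Phi}
    (k : T -> nat) (len : R) : 0 <= len ->
  k @ Phi --> \oo -> mesh Phi k (fun x => len / (k x)%:R) len.
Proof.
move=> len0 kcvg.
have big N : \forall x \near Phi, (N <= k x)%N.
  exact: (kcvg [set y | (N <= y)%N] (nbhs_infty_ge N)).
have kE : \forall x \near Phi, (k x)%:R * (len / (k x)%:R) = len.
  apply: filterS (big 1%N) => x k1.
  by rewrite mulrC divfK// pnatr_eq0 -lt0n.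
split.
- by apply: nearW => x; rewrite divr_ge0.
- by apply: filterS kE => x ->.
- apply/cvgrPdist_lt => e e0.
  have := Num.Theory.archi_boundP (divr_ge0 len0 (ltW e0)).
  set N := Num.bound _ => HN; apply: filterS (big N.+1) => x Nk.
  have k0 : 0 < (k x)%:R :> R by rewrite ltr0n (leq_trans _ Nk).
  rewrite sub0r normrN ger0_norm ?divr_ge0 ?(ltW k0)// ltr_pdivrMr//.
  rewrite mulrC -ltr_pdivrMr// (lt_le_trans HN)// ler_nat.
  exact: leq_trans Nk.
- apply: (@cvg_trans _ ((fun=> len) @ Phi)); last exact: cvg_cst.
  by apply: near_eq_cvg; apply: filterS kE => x.
Qed.

(** One variable at a time: after each operator the family is the sum of the
    original one and of a null one, hence still bounded, on a box halved in one
    more direction. *)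
Lemma bern_seq_null (T : Type) (Phi : set_system T) {FPhi : Filter Phi}
    (k : T -> nat) L (g : T -> 'rV[R]_d -> R) :
  (forall j, 0 < rho j) -> uniq L -> k @ Phi --> \oo ->
  bdd Phi (box c rho) g ->
  null Phi (box c (half_on L)) (fun x v => bern_seq L (k x) (g x) v - g x v).
Proof.
move=> rho0 uL kcvg bg.
have h2 j : 0 < rho j / 2 by rewrite divr_gt0.
have h2r j : rho j / 2 < rho j by rewrite ltr_pdivrMr// ltr_pMr// ltr1n.
elim: L uL => [_|i L IH /= /andP[iL uL]].
  have oB := box_open c (half_on [::]).
  refine (null_eq oB _ (null0 oB)).
  by apply: nearW => x v _; rewrite /= subrr.
have {}IH := IH uL.
have sub : box c (half_on L) `<=` box c rho.
  move=> v vb j; apply: lt_le_trans (vb j) _; rewrite /half_on.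
  by case: ifP => // _; exact: ltW.
have hE : half_on (i :: L) = setc (half_on L) i (rho i / 2).
  apply/funext => j; rewrite /half_on /setc inE.
  by case: eqP => [->|].
have bgL : bdd Phi (box c (half_on L)) (fun x => bern_seq L (k x) (g x)).
  have oB := box_open c (half_on L).
  refine (bdd_eq oB _ (bddD oB (null_bdd IH) (bddW sub bg))).
  by apply: nearW => x v _; rewrite subrK.
have ri : rho i / 2 < half_on L i by rewrite /half_on (negPf iL).
have len0 : 0 <= 2 * (rho i / 2) by rewrite mulr_ge0// ltW.
have n1 := bern_null (h2 i) ri (mesh_uniform len0 kcvg) bgL.
have sub' : box c (half_on (i :: L)) `<=` box c (half_on L).
  by rewrite hE; apply: box_setc; exact: ltW.
rewrite -hE in n1.
have oB := box_open c (half_on (i :: L)).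
refine (null_eq oB _ (nullD oB (n1 FPhi FPhi) (nullW sub' IH))).
by apply: nearW => x v _; rewrite addrA subrK.
Qed.

(** The coordinates frozen at a node after applying the operators in the
    variables of L are those of p; the others are still those of w. *)
Definition merge L (p w : 'rV[R]_d) : 'rV[R]_d :=
  \row_j if j \in L then p 0 j else w 0 j.

(** Each operator freezes one more coordinate at finitely many nodes, with weights
    polynomial in that coordinate. Once L lists all coordinates, only the values
    of g at the points p l remain. *)
Lemma bern_seq_finite_rank L k : uniq L -> (forall j, 0 < rho j) ->
  exists (I : finType) (phi : I -> 'rV[R]_d -> R) (p : I -> 'rV[R]_d),
    [/\ forall l, smooth_on setT (phi l),
        forall l, cbox c (fun j => rho j / 2) (p l) &
        forall g w, bern_seq L k g w = \sum_l phi l w * g (merge L (p l) w)].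
Proof.
move=> uL rho0; elim: L uL => [_|i L IH /= /andP[iL uL]].
  exists unit, (fun=> cst 1), (fun=> c); split.
  - by move=> _; exact: smooth_on_cst openT.
  - by move=> _ j; rewrite subrr normr0 divr_ge0// ltW.
  - move=> g w; rewrite big_const card_unit /= addr0 mul1r; congr g.
    by apply/rowP => j; rewrite mxE.
have [I [phi [p [sphi pb E]]]] := IH uL.
pose lo := c 0 i - rho i / 2; pose len := 2 * (rho i / 2).
pose node (t : nat) := lo + t%:R * (len / k%:R).
pose wt (t : nat) (w : 'rV[R]_d) :=
  casteljau k ((w 0 i - lo) / len) (fun l => (l == t)%:R).
exists ('I_k.+1 * I)%type, (fun (tl : 'I_k.+1 * I) w =>
    wt tl.1 w * phi tl.2 (upd w i (node tl.1))),
  (fun tl : 'I_k.+1 * I => upd (p tl.2) i (node tl.1)); split.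
- move=> [t l] /=.
  have s1 : smooth_on setT (wt t).
    exact: (smooth_on_casteljau openT (smooth_on_affine_coord i lo len openT)
      (fun l _ => smooth_on_cst (l == t)%:R openT)).
  exact: (smooth_onM openT s1
    (smooth_on_upd openT openT (fun _ _ => Logic.I) (sphi l))).
- move=> [t l] j /=; rewrite updE; case: eqP => [->|_]; last exact: pb.
  have r0 : 0 <= rho i / 2 by rewrite divr_ge0// ltW.
  have t0 : 0 <= t%:R * (len / k%:R) by rewrite mulr_ge0// divr_ge0// mulr_ge0.
  have tl : t%:R * (len / k%:R) <= len.
    have len0 : 0 <= len by rewrite mulr_ge0.
    have tk : t%:R * (k%:R)^-1 <= 1 :> R.
      case: (posnP k) => [k0|k0].
        by have -> : (k%:R : R)^-1 = 0; [rewrite k0 invr0|rewrite mulr0].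
      by rewrite ler_pdivrMr ?ltr0n// mul1r ler_nat -ltnS.
    by rewrite mulrCA; exact: ler_piMr.
  rewrite /node; move: (t%:R * _) t0 tl => x x0; rewrite /len /lo => xl.
  by rewrite ler_norml; apply/andP; split; lra.
move=> g w; rewrite /= {1}/bern -/lo -/len casteljau_sum.
rewrite -(pair_big xpredT xpredT (fun (t : 'I_k.+1) (l : I) =>
  wt t w * phi l (upd w i (node t)) * g (merge (i :: L) (upd (p l) i (node t)) w))) /=.
apply: eq_bigr => t _; rewrite E mulr_suml; apply: eq_bigr => l _.
rewrite -/(node t) -/(wt t w) mulrAC [wt t w * _]mulrC; congr (_ * _ * g _).
apply/rowP => j; rewrite mxE [in RHS]mxE !updE inE.
by case: eqP => [->|_] //=; rewrite (negPf iL).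
Qed.

End Def.

Lemma upd_row_mx m n (z : 'rV[R]_m) (w : 'rV[R]_n) i t :
  upd (row_mx z w) (rshift m i) t = row_mx z (upd w i t).
Proof.
apply/rowP => j; rewrite updE mxE [in RHS]mxE; case: split_ordP => l ->.
  by rewrite eq_lrshift.
by rewrite updE (inj_eq (@rshift_inj _ _)).
Qed.

(** Acting on the last n variables only, the operators commute with freezing the
    first m ones. *)
Lemma bern_seq_slice m n (c : 'rV[R]_(m + n)) rho L k g z w :
  bern_seq c rho [seq rshift m i | i <- L] k g (row_mx z w) =
  bern_seq (rsubmx c) (fun i => rho (rshift m i)) L k (fun w => g (row_mx z w)) w.
Proof.
elim: L w => [//|i L IH] w /=; rewrite /bern row_mxEr [rsubmx c _ _]mxE.
by apply: casteljau_ext => l _; rewrite upd_row_mx IH.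
Qed.

End IteratedBernstein.

(** * Extending functions by zero from a chart *)

Section ExtensionByZero.
Context {R : realType}.

Lemma nbhs_cbox d (x : 'rV[R]_d) A : nbhs x A ->
  exists2 r : R, 0 < r & cbox x (fun=> r) `<=` A.
Proof.
move=> /nbhs_boxP[r r0 rA]; exists (r / 2); first by rewrite divr_gt0.
move=> v vx; apply: rA => j; apply: le_lt_trans (vx j) _.
by rewrite ltr_pdivrMr// ltr_pMr// ltr1n.
Qed.

Lemma box_center d (x : 'rV[R]_d) rho : (forall j, 0 < rho j) -> box x rho x.
Proof. by move=> rho0 j; rewrite subrr normr0. Qed.

Lemma smooth_on_local d (O : set 'rV[R]_d) g :
  (forall x, O x -> exists2 O', O' x & smooth_on O' g) -> smooth_on O g.
Proof. by move=> H s x /H[O' O'x]; apply. Qed.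

Lemma open_preim_chart d (X : topologicalType) (b : chart R d X) (U : set X) :
  open U -> open [set z | chart_img b z /\ U (chart_inv b z)].
Proof.
move=> oU; rewrite openE => z [bz Uz].
have n1 : nbhs z (chart_img b).
  by apply: open_nbhs_nbhs; split=> //; exact: chart_img_open.
have n2 : nbhs z (chart_inv b @^-1` U).
  by apply: (chart_inv_continuous bz); exact: open_nbhs_nbhs.
exact: filterI n1 n2.
Qed.

Definition extend d (X : topologicalType) (b : chart R d X)
    (h : 'rV[R]_d -> R) (y : X) : R[i] :=
  if pselect (chart_dom b y) then (h (chart_map b y))%:C%C else 0.

Section Extend.
Context {d : nat} (X : manifold R d) (b : chart R d X) (ab : atlas X b).
Context (K : set 'rV[R]_d) (cK : compact K) (Kb : K `<=` chart_img b).

Lemma closed_chart_image : closed (chart_inv b @` K).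
Proof.
apply: compact_closed; first exact: (@manifold_hausdorff R d X).
apply: continuous_compact cK; apply: continuous_in_subspaceT => z /set_mem Kz.
exact/chart_inv_continuous/Kb.
Qed.

Lemma extend0 h y : (forall v, ~ K v -> h v = 0) -> ~ (chart_inv b @` K) y ->
  extend b h y = 0.
Proof.
move=> h0 nKy; rewrite /extend; case: pselect => // yb.
rewrite h0// => Kby; apply: nKy; exists (chart_map b y) => //.
exact: chart_mapK.
Qed.

Lemma extend_inv h z : chart_img b z -> extend b h (chart_inv b z) = (h z)%:C%C.
Proof.
move=> bz; rewrite /extend; case: (pselect _) => [bz'|[]]; first by rewrite chart_invK.
exact: chart_inv_dom.
Qed.

(** In another chart, the function is either read through a smooth change of
    coordinates, or zero off the compact image of K, which is closed because X is
    Hausdorff. *)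
Lemma extend_smooth h : smooth_on setT h -> (forall v, ~ K v -> h v = 0) ->
  extend b h \in smooth_fun X.
Proof.
move=> sh h0; apply/asboolP => b' ab'.
have oT : open [set: 'rV[R]_d] by exact: openT.
have ImE y : complex.Im (extend b h y) = 0 by rewrite /extend; case: pselect.
split; last first.
  apply: smooth_on_eq (smooth_on_cst 0 (chart_img_open b')).
    exact: chart_img_open.
  by move=> z _; rewrite /= ImE.
apply: smooth_on_local => z b'z.
have [bz|nbz] := pselect (chart_dom b (chart_inv b' z)).
  pose D := [set z | chart_img b' z /\ chart_dom b (chart_inv b' z)].
  have oD : open D by apply: open_preim_chart; exact: chart_dom_open.
  exists D => //.
  have sA := manifold_smooth ab' ab.
  apply: smooth_on_eq oD _ (smooth_on_comp oD oT (fun _ _ => Logic.I) sA sh).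
  by move=> x [_ bx]; rewrite /= /extend; case: pselect.
pose D := [set z | chart_img b' z /\ (~` (chart_inv b @` K)) (chart_inv b' z)].
have oD : open D.
  by apply: open_preim_chart; apply: closed_openC; exact: closed_chart_image.
exists D.
  split=> // -[v Kv vE]; apply: nbz; rewrite -vE.
  exact/chart_inv_dom/Kb.
apply: smooth_on_eq oD _ (smooth_on_cst 0 oD) => x [_ nKx].
by rewrite /= extend0.
Qed.

Lemma extend_support h : (forall v, ~ K v -> h v = 0) ->
  compact (support_set (extend b h)).
Proof.
move=> h0; have cbK : compact (chart_inv b @` K).
  apply: continuous_compact cK; apply: continuous_in_subspaceT => z /set_mem Kz.
  exact/chart_inv_continuous/Kb.
apply: (subclosed_compact _ cbK); first exact: closed_closure.
rewrite [X in _ `<=` X](closure_id _).1; last exact: closed_chart_image.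
apply: closureS => y /= ny; apply: contrapT => nKy.
by move: ny; rewrite extend0// eqxx.
Qed.

End Extend.

Lemma test_function_at d (X : manifold R d) (x : X) :
  exists f : testFun X, f x = 1.
Proof.
have [b ab bx] := atlas_cover x; pose c := chart_map b x.
have [r r0 rb] : exists2 r : R, 0 < r & cbox c (fun=> r) `<=` chart_img b.
  apply: nbhs_cbox; apply: open_nbhs_nbhs; split; first exact: chart_img_open.
  exact: chart_map_img.
have r2 : 0 <= r / 2 by rewrite divr_ge0// ltW.
have r2r : r / 2 < r by rewrite ltr_pdivrMr// ltr_pMr// ltr1n.
have [h [sh h1 h0]] := cutoff_exists c r2 r2r.
have h0' v : ~ cbox c (fun=> r) v -> h v = 0.
  by move=> nv; apply: h0 => /box_cbox.
have cK := cbox_compact c (fun=> r).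
have sE := extend_smooth ab cK rb sh h0'.
have supE : SmoothFun sE \in compactly_supported (X := X).
  exact/asboolP/(extend_support cK rb h0').
exists (TestFun supE); rewrite -[LHS]/(extend b h x).
have := extend_inv h (chart_map_img bx); rewrite chart_mapK// => ->.
by rewrite h1// => j; rewrite subrr normr0.
Qed.

End ExtensionByZero.

(** * Convergence near a point of the product manifold *)

Section LocalConvergence.
Context {R : realType} {m n : nat} (M : manifold R m) (N : manifold R n).
Context {T : Type} (Phi : set_system T) {FPhi : Filter Phi}.
Implicit Types G H : T -> M * N -> R[i].

Definition cnull d (O : set 'rV[R]_d) (g : T -> 'rV[R]_d -> R[i]) :=
  null Phi O (fun k v => complex.Re (g k v)) /\
  null Phi O (fun k v => complex.Im (g k v)).

Definition read (a : chart R m M) (b : chart R n N) (F : M * N -> R[i]) v : R[i] :=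
  F (chart_inv (prod_chart a b) v).

(** The neighborhood W does not depend on the order of derivation, so that local
    convergence inherits the stability properties of [null]. *)
Definition null_in_chart (a : chart R m M) (b : chart R n N) z w G :=
  exists W : set 'rV[R]_(m + n),
    [/\ open W, W (row_mx z w), W `<=` chart_img (prod_chart a b) &
        cnull W (fun k => read a b (G k))].

(** The point of M is arbitrary, as the approximations act on the variable y only. *)
Definition null_at (y : N) G :=
  forall a b z, atlas M a -> atlas N b -> chart_dom b y -> chart_img a z ->
    null_in_chart a b z (chart_map b y) G.

Lemma row_mx_img (a : chart R m M) (b : chart R n N) z w :
  chart_img a z -> chart_img b w -> chart_img (prod_chart a b) (row_mx z w).
Proof. by move=> az bw; split; rewrite (row_mxKl, row_mxKr). Qed.

Lemma cnull_eq d (O : set 'rV[R]_d) g g' : open O ->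
  (forall k v, O v -> g k v = g' k v) -> cnull O g -> cnull O g'.
Proof.
move=> oO E [nr ni]; split.
  by refine (null_eq oO _ nr); apply: nearW => k v /E ->.
by refine (null_eq oO _ ni); apply: nearW => k v /E ->.
Qed.

Lemma smooth_rsub (O : set 'rV[R]_n) (O' : set 'rV[R]_(m + n)) f :
  open O -> open O' -> (forall v, O' v -> O (rsubmx v)) -> smooth_on O f ->
  smooth_on O' (fun v => f (rsubmx v)).
Proof.
move=> oO oO' OO' sf.
apply: (smooth_on_comp (A := rsubmx) oO' oO OO' _ sf) => i.
apply: smooth_on_eq oO' _ (smooth_on_coord (rshift m i) oO') => v _.
by rewrite mxE.
Qed.

(** The passage from a chart b of N to b0 is a composition with a smooth change of
    coordinates, whose derivatives are bounded near the point under
    consideration, so [null_comp] applies. *)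
Lemma null_at_chart b0 y G : atlas N b0 -> chart_dom b0 y ->
  (forall a z, atlas M a -> chart_img a z ->
     null_in_chart a b0 z (chart_map b0 y) G) ->
  null_at y G.
Proof.
move=> ab0 b0y HG a b z aa ab bY az.
have [W0 [oW0 W0y W0img nW0]] := HG a z aa az.
pose C := prod_chart a b.
pose D := [set w | chart_img b w /\ chart_dom b0 (chart_inv b w)].
have oD : open D by apply: open_preim_chart; exact: chart_dom_open.
pose O : set 'rV[R]_(m + n) := chart_img C `&` (rsubmx @^-1` D).
have oO : open O.
  apply: openI; first exact: chart_img_open.
  by apply: open_comp => // v _; exact: continuous_rsubmx.
pose A (v : 'rV[R]_(m + n)) : 'rV[R]_(m + n) :=
  row_mx (lsubmx v) (chart_map b0 (chart_inv b (rsubmx v))).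
have sA i : smooth_on O (fun v => A v 0 i).
  case: (split_ordP i) => l ->.
    apply: smooth_on_eq oO _ (smooth_on_coord (lshift n l) oO) => v _.
    by rewrite row_mxEl mxE.
  have sb := manifold_smooth ab ab0 l.
  apply: smooth_on_eq oO _ (smooth_rsub oD oO _ sb) => v; last by case.
  by rewrite row_mxEr.
pose v0 := row_mx z (chart_map b y).
have Ov0 : O v0.
  split; first by apply: row_mx_img => //; exact: chart_map_img.
  by rewrite /D /= row_mxKr chart_mapK//; split=> //; exact: chart_map_img.
have Av0 : A v0 = row_mx z (chart_map b0 y).
  by rewrite /A row_mxKl row_mxKr chart_mapK.
have [r r0 rO] : exists2 r : R, 0 < r & cbox v0 (fun=> r) `<=` O `&` (A @^-1` W0).
  apply: nbhs_cbox; apply: filterI; first exact: open_nbhs_nbhs.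
  apply: (smooth_map_continuous sA Ov0); apply: open_nbhs_nbhs.
  by rewrite Av0.
have rO' : cbox v0 (fun=> r) `<=` O by move=> v /rO[].
have rW : box v0 (fun=> r) `<=` O by apply: subset_trans rO'; exact: box_cbox.
have oB := box_open v0 (fun=> r).
have bA i : bdd Phi (box v0 (fun=> r)) (fun=> fun v => A v 0 i).
  exact: bdd_fixed (cbox_compact _ _) rO' (@box_cbox _ _ _ _) (sA i).
have AW v : box v0 (fun=> r) v -> W0 (A v) by move=> /box_cbox/rO[].
exists (box v0 (fun=> r)); split=> //.
- exact: box_center.
- by move=> v /rW[].
apply: (@cnull_eq _ _ (fun k v => read a b0 (G k) (A v))) => //.
  move=> k v /rW[_ [bv b0v]]; rewrite /read /A /= row_mxKl row_mxKr.
  by rewrite chart_mapK.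
by split; [exact: null_comp oB oW0 AW bA nW0.1|exact: null_comp oB oW0 AW bA nW0.2].
Qed.

Lemma null_in_chartW a b z w G (U : set 'rV[R]_(m + n)) :
  null_in_chart a b z w G -> nbhs (row_mx z w) U ->
  exists r : R, [/\ 0 < r, cbox (row_mx z w) (fun=> r) `<=` U,
    box (row_mx z w) (fun=> r) `<=` chart_img (prod_chart a b) &
    cnull (box (row_mx z w) (fun=> r)) (fun k => read a b (G k))].
Proof.
move=> [W [oW Ww Wimg [nr ni]]] nU.
have [|r r0 rWU] := @nbhs_cbox R _ (row_mx z w) (W `&` U).
  by apply: filterI => //; exact: open_nbhs_nbhs.
have rW : box (row_mx z w) (fun=> r) `<=` W by move=> v /box_cbox/rWU[].
exists r; split=> //.
- by move=> v /rWU[].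
- exact: subset_trans rW Wimg.
- by split; [exact: nullW nr|exact: nullW ni].
Qed.

Lemma null_at_eq y (Y : set N) G H : open Y -> Y y ->
  (forall k p, Y p.2 -> G k p = H k p) -> null_at y G -> null_at y H.
Proof.
move=> oY Yy E nG a b z aa ab bY az.
have [|r [r0 rU rimg nr]] := @null_in_chartW a b z (chart_map b y) G
    (rsubmx @^-1` [set w | chart_img b w /\ Y (chart_inv b w)])
    (nG a b z aa ab bY az).
  apply: (@continuous_rsubmx R 1 m n (row_mx z (chart_map b y))).
  rewrite row_mxKr; apply: open_nbhs_nbhs; split.
    exact: open_preim_chart.
  by split; [exact: chart_map_img|rewrite /= chart_mapK].
have oB := box_open (row_mx z (chart_map b y)) (fun=> r).
exists (box (row_mx z (chart_map b y)) (fun=> r)); split=> //.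
  exact: box_center.
apply: cnull_eq oB _ nr => k v /box_cbox/rU[_ Yv].
exact: E.
Qed.

Lemma null_at0 y : null_at y (fun _ _ => 0).
Proof.
move=> a b z aa ab bY az.
have oC := chart_img_open (prod_chart a b).
exists (chart_img (prod_chart a b)); split=> //.
  by apply: row_mx_img => //; exact: chart_map_img.
by split; exact: null0.
Qed.

Lemma null_atD y G H : null_at y G -> null_at y H ->
  null_at y (fun k p => G k p + H k p).
Proof.
move=> nG nH a b z aa ab bY az.
have [W [oW Ww Wimg nW]] := nG a b z aa ab bY az.
have [V [oV Vw _ nV]] := nH a b z aa ab bY az.
have oWV : open (W `&` V) by exact: openI.
exists (W `&` V); split=> //; first by move=> v [/Wimg].
have [WV1 WV2] : W `&` V `<=` W /\ W `&` V `<=` V by split=> v [].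
split.
  refine (null_eq oWV _ (nullD oWV (nullW WV1 nW.1) (nullW WV2 nV.1))).
  by apply: nearW => k v _; rewrite /read raddfD.
refine (null_eq oWV _ (nullD oWV (nullW WV1 nW.2) (nullW WV2 nV.2))).
by apply: nearW => k v _; rewrite /read raddfD.
Qed.

Lemma null_at_mul y (pi : smoothFun N) G : null_at y G ->
  null_at y (fun k p => pi p.2 * G k p).
Proof.
move=> nG a b z aa ab bY az; set w := chart_map b y.
pose U : set 'rV[R]_(m + n) := rsubmx @^-1` chart_img b.
have ob := chart_img_open b.
have oU : open U by apply: open_comp ob => v _; exact: continuous_rsubmx.
have [|r [r0 rU rimg nr]] := @null_in_chartW a b z w G U (nG a b z aa ab bY az).
  apply: open_nbhs_nbhs; split=> //.
  by rewrite /U /= row_mxKr; exact: chart_map_img.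
set O := box (row_mx z w) (fun=> r) in rimg nr.
have oO : open O by exact: box_open.
have [pr pim] := smoothP pi ab.
have br : bdd Phi O (fun=> fun v => complex.Re (pi (chart_inv b (rsubmx v)))).
  apply: bdd_fixed (cbox_compact _ _) rU (@box_cbox _ _ _ _) _.
  exact: smooth_rsub ob oU _ pr.
have bi : bdd Phi O (fun=> fun v => complex.Im (pi (chart_inv b (rsubmx v)))).
  apply: bdd_fixed (cbox_compact _ _) rU (@box_cbox _ _ _ _) _.
  exact: smooth_rsub ob oU _ pim.
exists O; split=> //; first exact: box_center.
split.
  refine (null_eq oO _ (nullB oO (nullM oO br nr.1) (nullM oO bi nr.2))).
  apply: nearW => k v _; rewrite /read /=.
  by case: (pi _) (G _ _) => [? ?] [? ?].
refine (null_eq oO _ (nullD oO (nullM oO br nr.2) (nullM oO bi nr.1))).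
apply: nearW => k v _; rewrite /read /=.
by case: (pi _) (G _ _) => [? ?] [? ?].
Qed.

End LocalConvergence.

(** * A finite-rank approximation of a cutoff *)

Section LocalOperator.
Context {R : realType} {m n : nat} (M : manifold R m) (N : manifold R n).
Local Notation MN := (prod_charted M N).
Context (A : set (smoothFun MN)) (bA : tvs_bounded A).

(** Along this filter k tends to infinity while F is arbitrary in A: convergence
    is uniform over A. *)
Definition approx_filter : set_system (nat * smoothFun MN) :=
  filter_prod \oo (globally A).

Local Notation Phi := approx_filter.

Instance approx_filter_filter : Filter Phi.
Proof. exact: filter_prod_filter. Qed.

Lemma near_approx (P : nat * smoothFun MN -> Prop) :
  (forall k F, A F -> P (k, F)) -> \forall x \near Phi, P x.
Proof.
move=> HP; exists (setT, A) => /=; first by split=> //; exact: filterT.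
by move=> [k F] [_ AF]; exact: HP.
Qed.

(** A bounded set is absorbed by each ball of the topology, and a ball for the
    derivative s on K gives a bound for that derivative, uniform over A. *)
Lemma bounded_bdd a b (O K : set 'rV[R]_(m + n)) : atlas M a -> atlas N b ->
  compact K -> K `<=` chart_img (prod_chart a b) -> O `<=` K ->
  bdd Phi O (fun x v => complex.Re (read a b x.2 v)) /\
  bdd Phi O (fun x v => complex.Im (read a b x.2 v)).
Proof.
move=> aa ab cK KC OK; set C := prod_chart a b in KC *.
have aC : atlas MN C by exists (a, b).
have OC : O `<=` chart_img C by exact: subset_trans KC.
have bd s : exists r : R, \forall x \near Phi, forall v, O v ->
    `|cpartial s ((x : nat * smoothFun MN).2 \o chart_inv C) v| <= r%:C%C.
  pose U := @smooth_ball _ _ MN unit (fun=> C) (fun=> K) (fun=> s) 1.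
  have /bA[r r0 Hr] : nbhs (0 : smoothFun MN) U.
    apply/smooth_nbhsE; exists U; last by move=> G; rewrite add0r.
    by exists unit, (fun=> C), (fun=> K), (fun=> s), 1.
  exists (complex.Re r); apply: near_approx => k F /= AF v Ov.
  have rE : r = (complex.Re r)%:C%C by apply/esym/RRe_real; rewrite realE ltW.
  have [|u Uu ->] := Hr r _ F AF; first by rewrite gtr0_norm.
  rewrite (cpartial_smoothZ _ _ _ aC (OC _ Ov)) normrM (gtr0_norm r0) -rE.
  by apply: ler_piMr; [exact: ltW|exact/ltW/(Uu tt)/OK].
split; split.
- by apply: near_approx => k F _; apply: smooth_onW OC _; exact: (smoothP F aC).1.
- move=> s; have [r Hr] := bd s; exists r; apply: filterS Hr => x Hr v /Hr.
  by move=> /ReIm_le_normc[].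
- by apply: near_approx => k F _; apply: smooth_onW OC _; exact: (smoothP F aC).2.
- move=> s; have [r Hr] := bd s; exists r; apply: filterS Hr => x Hr v /Hr.
  by move=> /ReIm_le_normc[].
Qed.

(** The form that a transversal distribution turns into a sum of Dirac elements:
    S F depends on y only through fixed functions phi_i. *)
Definition finite_rank (S : smoothFun MN -> M * N -> R[i]) :=
  exists (I : finType) (y : I -> N) (phi : I -> smoothFun N),
    forall F p, S F p = \sum_i phi i p.2 * F (p.1, y i).

Section Chart.
Context (b : chart R n N) (ab : atlas N b) (c : 'rV[R]_n) (r : R) (r0 : 0 < r).
Hypothesis cb : cbox c (fun=> r) `<=` chart_img b.
Context (chi : 'rV[R]_n -> R) (schi : smooth_on setT chi).
Hypothesis chi0 : forall w, ~ box c (fun=> r / 4) w -> chi w = 0.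

Let K := cbox c (fun=> r / 4).

Let cK : compact K. Proof. exact: cbox_compact. Qed.

Let Kb : K `<=` chart_img b.
Proof.
move=> w wK; apply: cb => j; apply: le_trans (wK j) _.
by rewrite ler_pdivrMr// ler_pMr// ler1n.
Qed.

Let oT : open [set: 'rV[R]_n]. Proof. exact: openT. Qed.

(** The cutoff chi makes the weights of the Bernstein operator, a priori defined in
    the chart only, into smooth functions on all of N. *)
Lemma bern_operator k : exists S, [/\ finite_rank S,
  forall F p, ~ (chart_inv b @` K) p.2 -> S F p = 0 &
  forall F x w, chart_img b w ->
    complex.Re (S F (x, chart_inv b w)) = chi w *
      bern_seq c (fun=> r) (enum 'I_n) k
        (fun w => complex.Re (F (x, chart_inv b w))) w /\
    complex.Im (S F (x, chart_inv b w)) = chi w *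
      bern_seq c (fun=> r) (enum 'I_n) k
        (fun w => complex.Im (F (x, chart_inv b w))) w].
Proof.
have [I [phi [p [sphi pb E]]]] := @bern_seq_finite_rank R n c (fun=> r)
  (enum 'I_n) k (enum_uniq _) (fun=> r0).
pose h l w := chi w * phi l w.
have sh l : smooth_on setT (h l) := smooth_onM oT schi (sphi l).
have h0 l w : ~ K w -> h l w = 0.
  by move=> nK; rewrite /h chi0 ?mul0r// => /box_cbox.
pose f l : smoothFun N := SmoothFun (extend_smooth ab cK Kb (sh l) (h0 l)).
have mE w l : merge (enum 'I_n) (p l) w = p l.
  by apply/rowP => j; rewrite mxE mem_enum.
have ReZ (u : R) (z : R[i]) : complex.Re (u%:C%C * z) = u * complex.Re z.
  by case: z => z1 z2 /=; rewrite mul0r subr0.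
have ImZ (u : R) (z : R[i]) : complex.Im (u%:C%C * z) = u * complex.Im z.
  by case: z => z1 z2 /=; rewrite mul0r addr0.
pose S (F : smoothFun MN) (q : M * N) : R[i] :=
  \sum_l f l q.2 * F (q.1, chart_inv b (p l)).
have SE F x w : chart_img b w -> S F (x, chart_inv b w) =
    \sum_l (h l w)%:C%C * F (x, chart_inv b (p l)).
  move=> bw; apply: eq_bigr => l _ /=; congr (_ * _).
  exact: extend_inv.
exists S; split.
- by exists I, (fun l => chart_inv b (p l)), f.
- move=> F q nq; apply: big1 => l _.
  by rewrite -[f l q.2]/(extend b (h l) q.2) (extend0 (h0 l))// mul0r.
- move=> F x w bw; rewrite (SE F x w bw) !raddf_sum !E !mulr_sumr.
  by split; apply: eq_bigr => l _; rewrite mE mulrA; [exact: ReZ|exact: ImZ].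
Qed.

End Chart.

Lemma open_chart_box (b : chart R n N) (O : set 'rV[R]_n) : open O ->
  open [set y | chart_dom b y /\ O (chart_map b y)].
Proof.
move=> oO; rewrite openE => y [yb Oy]; apply: filterI.
  by apply: open_nbhs_nbhs; split=> //; exact: chart_dom_open.
by apply: (chart_map_continuous yb); exact: open_nbhs_nbhs.
Qed.

(** Three concentric cubes in a chart at q: the operator converges on the cube of
    radius r / 2, the cutoff is supported in that of radius r / 4, and equals 1
    on that of radius r / 8. At a point off the second cube, both S F and chi F
    vanish nearby. *)
Lemma local_approximation (q : N) :
  exists (chi : smoothFun N) (Y : set N) (S : nat -> smoothFun MN -> M * N -> R[i]),
    [/\ open Y, Y q, forall y, Y y -> chi y = 1, forall k, finite_rank (S k) &
        forall y, null_at Phi y (fun x (p : M * N) => S x.1 x.2 p - chi p.2 * x.2 p)].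
Proof.
have [b ab bq] := atlas_cover q; pose c := chart_map b q.
have [r r0 rb] : exists2 r : R, 0 < r & cbox c (fun=> r) `<=` chart_img b.
  apply: nbhs_cbox; apply: open_nbhs_nbhs; split; first exact: chart_img_open.
  exact: chart_map_img.
have r8 : 0 < r / 8 by rewrite divr_gt0.
have r84 : r / 8 < r / 4 by lra.
have [h [sh h1 h0]] := cutoff_exists c (ltW r8) r84.
pose K := cbox c (fun=> r / 4).
have cK : compact K by exact: cbox_compact.
have Kb : K `<=` chart_img b.
  by move=> w wK; apply: rb => j; apply: le_trans (wK j) _; lra.
have h0' w : ~ K w -> h w = 0 by move=> nK; apply: h0 => /box_cbox.
have [chi chiP] : exists chi : smoothFun N, forall y, chi y = extend b h y.
  by exists (SmoothFun (extend_smooth ab cK Kb sh h0')).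
have [S HS] := choice (bern_operator ab r0 rb sh h0).
exists chi, [set y | chart_dom b y /\ box c (fun=> r / 8) (chart_map b y)], S.
split.
- exact/open_chart_box/box_open.
- by split=> //; exact: box_center.
- move=> y [yb /box_cbox yc]; rewrite -[y](chart_mapK yb).
  rewrite chiP extend_inv; last exact: chart_map_img.
  by rewrite h1.
- by move=> k; have [] := HS k.
move=> y.
have [[yb yc]|ny] := pselect (chart_dom b y /\ box c (fun=> r / 2) (chart_map b y)).
  apply: (null_at_chart ab yb) => a z aa az.
  have [s s0 sa] : exists2 s : R, 0 < s & cbox z (fun=> s) `<=` chart_img a.
    by apply: nbhs_cbox; apply: open_nbhs_nbhs; split=> //; exact: chart_img_open.
  pose L := [seq rshift m i | i <- enum 'I_n].
  pose rho (j : 'I_(m + n)) := if (j < m)%N then s else r.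
  have rho_l i : rho (lshift n i) = s by rewrite /rho /= ltn_ord.
  have rho_r i : rho (rshift m i) = r by rewrite /rho /= ltnNge leq_addr.
  have rho0 j : 0 < rho j by rewrite /rho; case: ifP.
  have uL : uniq L by rewrite map_inj_uniq ?enum_uniq//; exact: rshift_inj.
  pose v0 := row_mx z c.
  have KC : cbox v0 rho `<=` chart_img (prod_chart a b).
    move=> v vb; split.
      by apply: sa => j; have := vb (lshift n j); rewrite rho_l row_mxEl mxE.
    by apply: rb => j; have := vb (rshift m j); rewrite rho_r row_mxEr mxE.
  have [bRe bIm] := bounded_bdd aa ab (cbox_compact _ _) KC (@box_cbox _ _ v0 rho).
  have kcvg : (fun x : nat * smoothFun MN => x.1) @ Phi --> \oo.
    exact: cvg_fst.
  have nRe := bern_seq_null rho0 uL kcvg bRe.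
  have nIm := bern_seq_null rho0 uL kcvg bIm.
  pose W := box v0 (half_on rho L).
  have oW : open W by exact: box_open.
  have half_r i : half_on rho L (rshift m i) = r / 2.
    by rewrite /half_on rho_r mem_map ?mem_enum//; exact: rshift_inj.
  have WK : W `<=` cbox v0 rho.
    move=> v /box_cbox vW j; apply: le_trans (vW j) _.
    by rewrite /half_on; case: ifP => // _; have := rho0 j; lra.
  have WC : W `<=` chart_img (prod_chart a b) by exact: subset_trans KC.
  have bh : bdd Phi W (fun=> fun v => h (rsubmx v)).
    apply: bdd_fixed (cbox_compact _ _) (@subsetT _ _) WK _.
    exact: (smooth_rsub (O := setT) openT openT (fun _ _ => Logic.I) sh).
  have rhoE : (fun i => rho (rshift m i)) = (fun=> r) by apply/funext.
  have v0E : rsubmx v0 = c by rewrite row_mxKr.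
  have chiE v : W v -> chi (chart_inv b (rsubmx v)) = (h (rsubmx v))%:C%C.
    by move=> /WC[_ bv]; rewrite chiP; exact: extend_inv.
  have bE k (f : 'rV[R]_(m + n) -> R) v : bern_seq v0 rho L k f v =
      bern_seq c (fun=> r) (enum 'I_n) k (fun w => f (row_mx (lsubmx v) w)) (rsubmx v).
    by rewrite -{1}[v]hsubmxK bern_seq_slice rhoE v0E.
  have ReB (u1 u2 : R[i]) : complex.Re (u1 - u2) = complex.Re u1 - complex.Re u2.
    by case: u1 u2 => [? ?] [? ?].
  have ImB (u1 u2 : R[i]) : complex.Im (u1 - u2) = complex.Im u1 - complex.Im u2.
    by case: u1 u2 => [? ?] [? ?].
  exists W; split=> //.
    move=> j; case: (split_ordP j) => i ->; rewrite !(row_mxEl, row_mxEr).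
      by rewrite subrr normr0 /half_on; case: ifP; rewrite ?divr_gt0.
    by rewrite half_r; exact: yc.
  split.
    refine (null_eq oW _ (nullM oW bh (nRe _))).
    apply: nearW => x v Wv; have [_ bv] := WC _ Wv.
    have [_ _ /(_ x.2 (chart_inv a (lsubmx v)) _ bv)[SRe _]] := HS x.1.
    rewrite /read /= ReB SRe chiE// bE mulrBr; congr (_ * _ - _).
      by congr (bern_seq _ _ _ _ _ _); apply/funext => w /=;
        rewrite row_mxKl row_mxKr.
    by case: (x.2 _) => u1 u2 /=; rewrite mul0r subr0.
  refine (null_eq oW _ (nullM oW bh (nIm _))).
  apply: nearW => x v Wv; have [_ bv] := WC _ Wv.
  have [_ _ /(_ x.2 (chart_inv a (lsubmx v)) _ bv)[_ SIm]] := HS x.1.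
  rewrite /read /= ImB SIm chiE// bE mulrBr; congr (_ * _ - _).
    by congr (bern_seq _ _ _ _ _ _); apply/funext => w /=;
        rewrite row_mxKl row_mxKr.
  by case: (x.2 _) => u1 u2 /=; rewrite mul0r addr0.
have clK : closed (chart_inv b @` K) by exact: closed_chart_image.
have nKy : ~ (chart_inv b @` K) y.
  move=> [w wK wy]; apply: ny; rewrite -wy.
  have bw := Kb _ wK; split; first exact: chart_inv_dom.
  rewrite chart_invK// => j; apply: le_lt_trans (wK j) _; lra.
apply: (@null_at_eq _ _ _ _ _ _ _ _ y (~` (chart_inv b @` K)) (fun _ _ => 0)) => //.
- exact: closed_openC.
- move=> x p nKp; have [_ -> // _] := HS x.1.
  by rewrite chiP (extend0 h0')// mul0r subr0.
- exact: null_at0.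
Qed.

End LocalOperator.

(** * Gluing approximations, and the density of Dirac sums *)

Section Gluing.
Context {R : realType} {m n : nat} (M : manifold R m) (N : manifold R n).
Local Notation MN := (prod_charted M N).
Context (A : set (smoothFun MN)) (bA : tvs_bounded A).

Local Notation Phi := (approx_filter A).

Lemma smooth_fun_mul (f g : smoothFun N) : (fun y => f y * g y) \in smooth_fun N.
Proof.
apply/asboolP => c ac.
exact: csmooth_onM (chart_img_open c) (smoothP f ac) (smoothP g ac).
Qed.

Lemma smooth_fun1 d (X : chartedSpace R d) : (fun=> 1) \in smooth_fun X.
Proof. apply/asboolP => c ac; exact: csmooth_on_cst (chart_img_open c). Qed.

Lemma finite_rank_glue (chi : smoothFun N) (S S' : smoothFun MN -> M * N -> R[i]) :
  finite_rank S -> finite_rank S' ->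
  finite_rank (fun F p => S F p + (1 - chi p.2) * S' F p).
Proof.
move=> [I [y [phi HS]]] [J [y' [phi' HS']]].
pose co : smoothFun N := SmoothFun (smooth_fun1 N) - chi.
pose psi j : smoothFun N := SmoothFun (smooth_fun_mul co (phi' j)).
exists (I + J)%type, (fun k => match k with inl i => y i | inr j => y' j end),
  (fun k => match k with inl i => phi i | inr j => psi j end) => F p.
rewrite big_sumType /= HS HS' mulr_sumr; congr (_ + _).
by apply: eq_bigr => j _; rewrite mulrA.
Qed.

Definition approximable (W : set N) :=
  exists S : nat -> smoothFun MN -> M * N -> R[i],
    (forall k, finite_rank (S k)) /\
    forall y, W y -> null_at Phi y (fun x (p : M * N) => S x.1 x.2 p - x.2 p).

Lemma approximable0 : approximable set0.
Proof.
exists (fun _ _ _ => 0); split=> // _.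
exists void, (of_void _), (of_void _) => F p.
by rewrite big1// => -[].
Qed.

(** Near-covering compactness for the filter of finite sets ordered by inclusion.
    The space is not assumed to have a base point, since N may be empty. *)
Lemma finite_subcover (X : topologicalType) (Q : set X) (Y : X -> set X) :
  compact Q -> (forall q, open (Y q)) -> (forall q, Y q q) ->
  exists qs : seq X, forall y, Q y -> exists2 q, q \in qs & Y q y.
Proof.
move=> /compact_near_coveringP cQ oY Yq.
pose F : set_system (seq X) :=
  [set P | exists qs : seq X, forall qs' : seq X, {subset qs <= qs'} -> P qs'].
have FF : Filter F.
  split=> [|P P' [qs H] [qs' H']|P P' PP' [qs H]]; first by exists [::].
    exists (qs ++ qs') => r sr; split; [apply: H|apply: H'] => q qr;
      by apply: sr; rewrite mem_cat qr ?orbT.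
  by exists qs => r /H/PP'.
have [|qs H] := cQ _ F (fun qs y => exists2 q, q \in qs & Y q y) FF.
  move=> q Qq; exists (Y q, [set qs : seq X | q \in qs]).
    split; first by apply: open_nbhs_nbhs; split; [exact: oY|exact: Yq].
    by exists [:: q] => qs /(_ q); rewrite inE eqxx; apply.
  by move=> [y qs] [/= Yy qqs]; exists q.
by exists qs; exact: H.
Qed.

(** If S approximates the identity on W and Sq approximates multiplication by chi,
    where chi = 1 on Y, then
    Sq F + (1 - chi) S F - F = (Sq F - chi F) + (1 - chi) (S F - F)
    is null on W, and also on Y where the second term vanishes. *)
Lemma approximable_compact (Q : set N) : compact Q -> approximable Q.
Proof.
have /choice[chi /choice[Y HY]] := local_approximation bA.
move=> /(@finite_subcover _ _ Y)[q|q|D QD].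
- by have [S []] := HY q.
- by have [S []] := HY q.
suff H (qs : seq N) : approximable [set y | exists2 q, q \in qs & Y q y].
  have [S [fS nS]] := H D; exists S; split=> // y /QD[q qD Yqy].
  by apply: nS; exists q.
elim: qs => [|q qs [S [fS nS]]].
  have [S [fS _]] := approximable0; exists S; split=> // y [q].
  by rewrite in_nil.
have [Sq [oY Yq chi1 fSq nSq]] := HY q.
exists (fun k F p => Sq k F p + (1 - chi q p.2) * S k F p); split=> [k|y].
  exact: finite_rank_glue.
move=> [q']; rewrite inE => /orP[/eqP ->|q'qs] Yy.
  apply: null_at_eq oY Yy _ (nSq y) => x p Yp.
  by rewrite chi1// mul1r subrr mul0r addr0.
pose co : smoothFun N := SmoothFun (smooth_fun1 N) - chi q.
have nS' : null_at Phi y (fun x (p : M * N) => S x.1 x.2 p - x.2 p).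
  by apply: nS; exists q'.
apply: null_at_eq openT (Logic.I : [set: N] y) _
  (null_atD (nSq y) (null_at_mul co nS')) => x p _.
rewrite -[co p.2]/(1 - chi q p.2); ring.
Qed.

(** Compactness turns local convergence into uniform convergence on K; real and
    imaginary parts are combined at the price of a factor 2. *)
Lemma null_at_uniform (G : nat * smoothFun MN -> M * N -> R[i]) a b
    (K : set 'rV[R]_(m + n)) s (e : R[i]) :
  atlas M a -> atlas N b -> compact K -> K `<=` chart_img (prod_chart a b) ->
  (forall v, K v -> null_at Phi (chart_inv b (rsubmx v)) G) -> 0 < e ->
  \forall x \near Phi, forall v, K v -> `|cpartial s (read a b (G x)) v| < e.
Proof.
move=> aa ab /compact_near_coveringP cK KC nG e0.
have [k k0 ek] : exists2 k : R, 0 < k & e = k%:C%C.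
  exists (complex.Re e); first by move: e0; rewrite ltcE => /andP[].
  by apply/esym/RRe_real; rewrite realE ltW.
apply: (cK _ Phi (fun x v => `|cpartial s (read a b (G x)) v| < e)) => v Kv.
have [av bv] := KC _ Kv.
have [W [oW Wv _ [nRe nIm]]] := nG v Kv a b (lsubmx v) aa ab (chart_inv_dom bv) av.
rewrite chart_invK// hsubmxK in Wv.
have k4 : 0 < k / 4 by rewrite divr_gt0.
exists (W, [set x |
   (forall v, W v ->
      `|partial s (fun w => complex.Re (read a b (G x) w)) v| <= k / 4) /\
   (forall v, W v ->
      `|partial s (fun w => complex.Im (read a b (G x) w)) v| <= k / 4)]).
  split; first exact: open_nbhs_nbhs.
  exact: filterI (nRe.2 s _ k4) (nIm.2 s _ k4).
move=> [v' x] [/= Wv' [HRe HIm]].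
have H := @normc_le_ReIm R (cpartial s (read a b (G x)) v') (k / 4)
  (HRe v' Wv') (HIm v' Wv').
apply: (le_lt_trans H).
by rewrite ek ltcR; lra.
Qed.

End Gluing.

Section Density.
Context {R : realType} {m n : nat} (M : manifold R m) (N : manifold R n).
Local Notation MN := (prod_charted M N).

Lemma tensor_smooth (g : smoothFun M) (phi : smoothFun N) :
  (fun p : MN => g p.1 * phi p.2) \in smooth_fun MN.
Proof.
apply/asboolP => _ [[a b] [/= aa ab] <-].
have oC := chart_img_open (prod_chart a b).
have sa v : chart_img (prod_chart a b) v -> chart_img a (lsubmx v) by case.
have sb v : chart_img (prod_chart a b) v -> chart_img b (rsubmx v) by case.
have [gr gi] := smoothP g aa; have [pr pim] := smoothP phi ab.
apply: (csmooth_onM (g := fun v => g (chart_inv a (lsubmx v)))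
  (h := fun v => phi (chart_inv b (rsubmx v))) oC).
  by split; [exact: smooth_on_lsubmx oC sa gr|exact: smooth_on_lsubmx oC sa gi].
have ob := chart_img_open b.
by split; [exact: smooth_rsub ob oC sb pr|exact: smooth_rsub ob oC sb pim].
Qed.

Definition tensor g phi : smoothFun MN := SmoothFun (tensor_smooth g phi).

Definition one_tensor phi : smoothFun MN := tensor (SmoothFun (smooth_fun1 M)) phi.

Lemma smoothFun_ext d (X : chartedSpace R d) (F G : smoothFun X) :
  (forall p, F p = G p) -> F = G.
Proof. by move=> FG; apply/val_inj/funext. Qed.

Lemma transDistrP (T : transDistr M N) :
  [/\ linear T, forall f F, T (pull_mul f F) = test_mul f (T F) & continuous T].
Proof. by case: T => T /= /asboolP. Qed.

(** T is only linear over compactly supported functions of x, but the identity is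
    pointwise in x: multiply by a test function f with f x = 1 and move f g, which
    is a test function, through T. *)
Lemma transversal_tensor (T : transDistr M N) g phi x :
  T (tensor g phi) x = T (one_tensor phi) x * g x.
Proof.
have [_ mT _] := transDistrP T; have [f fx] := test_function_at x.
have E : pull_mul f (tensor g phi) = pull_mul (test_mul f g) (one_tensor phi).
  apply: smoothFun_ext => p.
  rewrite -[LHS]/(f p.1 * (g p.1 * phi p.2)).
  by rewrite -[RHS]/(f p.1 * g p.1 * (1 * phi p.2)) mul1r mulrA.
have := congr1 (fun F => T F x) E; rewrite !mT.
rewrite -[X in X = _]/(f x * T (tensor g phi) x) fx mul1r => ->.
by rewrite -[LHS]/(f x * g x * T (one_tensor phi) x) fx mul1r mulrC.
Qed.

Lemma transDistr_sum (T : transDistr M N) (I : Type) (r : seq I)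
    (F : I -> smoothFun MN) :
  T (\sum_(i <- r) F i) = \sum_(i <- r) T (F i).
Proof.
have [lT _ _] := transDistrP T.
have TD G H : T (G + H) = T G + T H by have := lT 1 G H; rewrite !scale1r.
have T0 : T 0 = 0.
  have := TD 0 0; rewrite addr0 => /esym/eqP.
  by rewrite addrC -subr_eq0 addrK => /eqP.
by elim: r => [|i r IH]; rewrite ?big_nil ?T0// !big_cons TD IH.
Qed.

Lemma sum_smoothE d (X : chartedSpace R d) (I : Type) (r : seq I)
    (F : I -> smoothFun X) p : (\sum_(i <- r) F i) p = \sum_(i <- r) F i p.
Proof.
by elim: r => [|i r IH]; rewrite ?big_nil// !big_cons -IH.
Qed.

Lemma sum_transDistrE (I : Type) (r : seq I) (D : I -> transDistr M N) F :
  (\sum_(i <- r) D i) F = \sum_(i <- r) D i F.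
Proof.
by elim: r => [|i r IH]; rewrite ?big_nil// !big_cons -IH.
Qed.

(** Lets sums be indexed by any finite type, such as a disjoint union. *)
Lemma Dirac_finType (I : finType) (y : I -> N) (f : I -> testFun M) :
  Dirac M N (\sum_i dirac (y i) (f i)).
Proof.
exists #|I|, (fun k => y (enum_val k)), (fun k => f (enum_val k)).
by rewrite (reindex (enum_val (A := I)))//; exact: onW_bij (enum_val_bij I).
Qed.

Lemma Dirac_submod : GRing.submod_closed [in Dirac M N].
Proof.
split.
  rewrite inE; have := Dirac_finType (of_void N) (of_void _).
  by rewrite big1// => -[].
move=> a D E; rewrite !inE => -[k [y [f ->]]] [l [z [g ->]]].
have := Dirac_finType (I := ('I_k + 'I_l)%type)
  (fun i => match i with inl i => y i | inr j => z j end)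
  (fun i => match i with inl i => a *: f i | inr j => g j end).
rewrite big_sumType /=; congr (Dirac M N (_ + _)).
rewrite scaler_sumr; apply: eq_bigr => i _; apply/val_inj/funext => F.
apply: testFun_ext => x.
by rewrite -[LHS]/(a * f i x * F (x, y i)) -mulrA.
Qed.

End Density.

Section Dense.
Context {R : realType} {m n : nat} (M : manifold R m) (N : manifold R n).
Local Notation MN := (prod_charted M N).

(** T (S F) is the value at F of the sum of the Dirac elements at y_i with
    coefficient T (1 (x) phi_i), by [transversal_tensor]. *)
Lemma finite_rank_Dirac (T : transDistr M N) S : finite_rank S ->
  exists2 D : transDistr M N, Dirac M N D &
    forall F, exists2 G : smoothFun MN,
      forall p, G p = S F p - F p & D F - T F = T G.
Proof.
move=> [I [y [phi SE]]].
exists (\sum_i dirac (y i) (T (one_tensor M (phi i)))); first exact: Dirac_finType.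
move=> F; pose SF : smoothFun MN := \sum_i tensor (slice (y i) F) (phi i).
exists (SF - F) => [p|].
  rewrite -[LHS]/(SF p - F p) SE /SF sum_smoothE; congr (_ - _).
  by apply: eq_bigr => i _; exact: mulrC.
have [lT _ _] := transDistrP T.
have -> : T (SF - F) = T SF - T F.
  have := lT (-1) F SF; rewrite !scaleN1r => H.
  by rewrite addrC H addrC.
congr (_ - _); rewrite /SF transDistr_sum sum_transDistrE; apply: eq_bigr => i _.
by apply: testFun_ext => x; rewrite transversal_tensor.
Qed.

Lemma Dirac_dense : dense (Dirac M N).
Proof.
move=> O [T OT] oO.
have [B [oB BT BO]] : nbhs T O by exact: open_nbhs_nbhs.
have [W [A [U [bA nU ->]]] WB] := oB T BT.
have [U1 bU1 U1U] := (test_nbhsE 0 U).1 nU.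
have [lT _ cT] := transDistrP T.
have [V [I [c [K [s [e [HI e0 ->]]]]]] VU] := (linear_continuousP lT).1 cT U1 bU1.
have ab (i : I) : exists ab : chart R m M * chart R n N,
    [/\ atlas M ab.1, atlas N ab.2 & c i = prod_chart ab.1 ab.2].
  by have [[[a b] [/= aa bb] <-] _ _] := HI i; exists (a, b).
have {ab}[ch Hch] := choice ab.
pose Q i := (fun v : 'rV[R]_(m + n) => chart_inv (ch i).2 (rsubmx v)) @` K i.
have cQ i : compact (Q i).
  have [_ cK Kc] := HI i; have [_ _ cE] := Hch i.
  apply: continuous_compact cK; apply: continuous_in_subspaceT => v /set_mem.
  move=> /Kc; rewrite cE => -[_ bv].
  apply: (@continuous_comp _ _ _ (rsubmx : 'rV[R]_(m + n) -> 'rV[R]_n)).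
    exact: continuous_rsubmx.
  exact: chart_inv_continuous.
have cQs : compact (\bigcup_i Q i).
  apply/compact_near_coveringP => J F P FF HP.
  have Hi i : \forall j \near F, Q i `<=` P j.
    have /compact_near_coveringP cQi := cQ i.
    by apply: cQi => y Qy; apply: HP; exists i.
  have := filter_forall FF Hi.
  by apply: filterS => j Hj y [i _ Qy]; exact: (Hj i y Qy).
have [S [fS nS]] := approximable_compact bA cQs.
have nearV i : \forall x \near approx_filter A, forall v, K i v ->
    `|cpartial (s i) (read (ch i).1 (ch i).2
        (fun p => S x.1 x.2 p - x.2 p)) v| < e.
  have [_ cK Kc] := HI i; have [aa bb cE] := Hch i; rewrite cE in Kc.
  apply: null_at_uniform => // v Kv; apply: nS; exists i => //.
  by exists v.
have [[P P'] [/= nP AP'] PV] := filter_forall (approx_filter_filter A) nearV.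
have [k Pk] := filter_ex nP.
have [D DD HD] := finite_rank_Dirac T (fS k).
exists D; split=> //; apply: BO.
rewrite -[D](subrK T) addrC; apply: WB => F AF.
rewrite -[g in U g]add0r; apply: U1U.
rewrite -[(D - T) F]/(D F - T F); have [G GE ->] := HD F.
apply: VU => i v Kv.
have := PV (k, F) (conj Pk (AP' F AF)) i v Kv.
have [_ _ ->] := Hch i.
rewrite (_ : _ \o _ = read (ch i).1 (ch i).2 (fun p => S k F p - F p))//.
by apply/funext => w /=; rewrite GE.
Qed.

End Dense.

Theorem proposition3p8 (R : realType) (m n : nat)
    (M : manifold R m) (N : manifold R n)
    (hM : @second_countable M) (hN : @second_countable N) :
  GRing.submod_closed [in Dirac M N] /\ dense (Dirac M N).
Proof. by split; [exact: Dirac_submod|exact: Dirac_dense]. Qed.
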